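(* Let $f \colon \mathbb{B}_n \to \mathbb{B}_N$ be a rational proper map of degree $d$. Then there exist numbers $0 \leq \sigma_1 \leq \sigma_2 \leq \cdots \leq \sigma_n \leq \frac{d-1}{2}$ and automorphisms $\psi \in \operatorname{Aut}(\mathbb{B}_n)$ and $\tau \in \operatorname{Aut}(\mathbb{B}_N)$ such that $\tau \circ f \circ \psi = \frac{P}{G}$ (in lowest terms), where $P(0)=0$, $G$ is of degree at most $d-1$, and the expansion of $G$ into homogeneous polynomials ($G_j$ homogeneous of degree $j$) is $$G(z) = 1 + G_2(z) + G_3(z) + \cdots + G_{d-1}(z), \qquad \text{where} \quad G_2(z) = \sum_{k=1}^n \sigma_k z_k^2 .$$ The numbers $\sigma_1,\ldots,\sigma_n$ are spherical invariants of $f$, and this form is a normal form up to composition with unitary maps; that is: if $F=\frac{P}{G} \colon \mathbb{B}_n \to \mathbb{B}_N$ and $\Phi=\frac{\Pi}{\Gamma} \colon \mathbb{B}_n \to \mathbb{B}_N$ are spherically equivalent rational proper maps of degree $d$, both written in lowest terms, with $P(0)=0$ and $\Pi(0)=0$, with $G$ and $\Gamma$ of degree at most $d-1$, and with homogeneous expansions $G = 1 + G_2 + G_3 + \cdots + G_{d-1}$ and $\Gamma = 1 + \Gamma_2 + \Gamma_3 + \cdots + \Gamma_{d-1}$ (no linear terms) in which $G_2(z) = \sum_{k=1}^n \sigma_k z_k^2$ with $0 \leq \sigma_1 \leq \cdots \leq \sigma_n \leq \frac{d-1}{2}$ and $\Gamma_2(z) = \sum_{k=1}^n \sigma_k' z_k^2$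 with $0 \leq \sigma_1' \leq \cdots \leq \sigma_n' \leq \frac{d-1}{2}$, then $\sigma_k = \sigma_k'$ for all $k=1,\ldots,n$, and $\Phi = U \circ F \circ V$ for some unitary matrices $U$ (of size $N\times N$) and $V$ (of size $n \times n$) with $G_2 \circ V = G_2$, where $G_2$ is the quadratic part of $G$.
   Context: $\mathbb{B}_n \subset \mathbb{C}^n$ denotes the open unit ball and $\operatorname{Aut}(\mathbb{B}_n)$ its group of holomorphic automorphisms. A rational proper map $f\colon \mathbb{B}_n \to \mathbb{B}_N$ is a proper holomorphic map of the form $f = \frac{p}{g}$ with $p \colon \mathbb{C}^n \to \mathbb{C}^N$ and $g\colon \mathbb{C}^n \to \mathbb{C}$ polynomial; it is in lowest terms if $g$ and the components of $p$ have no common nonconstant polynomial factor. The degree $d$ of $f$ is the maximum of the degrees of $p$ and $g$ when $\frac{p}{g}$ is in lowest terms. Two maps $f, F \colon \mathbb{B}_n \to \mathbb{B}_N$ are spherically equivalent if $F = \tau \circ f \circ \psi$ for some $\psi \in \operatorname{Aut}(\mathbb{B}_n)$ and $\tau \in \operatorname{Aut}(\mathbb{B}_N)$; a quantity invariant under this equivalence is a spherical invariant. When $d-1<2$ the expansion of $G$ is to be read as $G \equiv 1$, with $G_2 = 0$ and all $\sigma_k=0$ (and likewise for $\Gamma$). *)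

(* Defs.v *)
From HB Require Import structures.
From mathcomp Require Import all_boot all_order all_algebra.
From mathcomp Require Import spectral complex.
From mathcomp Require Import all_classical all_reals all_analysis.
(* Only the structures of [mpoly] are imported: its notations clash with analysis. *)
From mathcomp Require mpoly.
Import (canonicals, coercions) mpoly.

Set Implicit Arguments.
Unset Strict Implicit.
Unset Printing Implicit Defensive.

Import Order.TTheory GRing.Theory Num.Theory.
Import numFieldNormedType.Exports.

Local Open Scope classical_set_scope.
Local Open Scope ring_scope.

(* Typed as a numClosedFieldType (rather than used as the bare R[i]) so that the
   normed topology of numeric fields, hence that of 'cV[Cplx R]_n, is found. *)
Definition Cplx (R : realType) : numClosedFieldType := R[i].

Definition toC (R : realType) (x : R) : Cplx R := (x%:C)%C.

Notation cpoly R n := (mpoly.mpoly n (Cplx R)).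

Section Maps.
Variable R : realType.
Local Notation C := (Cplx R).

(* The norm of analysis on 'cV[C]_n is the sup norm; the ball is Euclidean.
   The norm of a complex number is a (real) element of C itself. *)
Definition unit_ball (n : nat) : set 'cV[C]_n :=
  [set z | \sum_(i < n) `|z i ord0| ^+ 2 < 1].

(* A map B_n -> B_N is a total function on C^n of which only the restriction to
   B_n matters. *)
Definition maps_ball (n N : nat) (f : 'cV[C]_n -> 'cV[C]_N) : Prop :=
  forall z, unit_ball z -> unit_ball (f z).

(* [differentiable] between C-normed modules is complex differentiability. *)
Definition holomorphic_on_ball (n N : nat) (f : 'cV[C]_n -> 'cV[C]_N) : Prop :=
  forall z, unit_ball z -> differentiable f z.

Definition ball_automorphism (n : nat) (psi : 'cV[C]_n -> 'cV[C]_n) : Prop :=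
  [/\ maps_ball psi, holomorphic_on_ball psi &
      exists phi : 'cV[C]_n -> 'cV[C]_n,
        [/\ maps_ball phi, holomorphic_on_ball phi,
            forall z, unit_ball z -> phi (psi z) = z &
            forall z, unit_ball z -> psi (phi z) = z]].

Definition proper_ball_map (n N : nat) (f : 'cV[C]_n -> 'cV[C]_N) : Prop :=
  maps_ball f /\
  forall K : set 'cV[C]_N, K `<=` @unit_ball N -> compact K ->
    compact (@unit_ball n `&` f @^-1` K).

Definition spherically_equivalent (n N : nat) (f F : 'cV[C]_n -> 'cV[C]_N) :
    Prop :=
  exists (psi : 'cV[C]_n -> 'cV[C]_n) (tau : 'cV[C]_N -> 'cV[C]_N),
    [/\ ball_automorphism psi, ball_automorphism tau &
        forall z, unit_ball z -> F z = tau (f (psi z))].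

Definition peval (n : nat) (p : cpoly R n) (z : 'cV[C]_n) : C :=
  mpoly.meval (fun i => z i ord0) p.

Definition is_fraction (n N : nat) (f : 'cV[C]_n -> 'cV[C]_N)
    (p : 'I_N -> cpoly R n) (g : cpoly R n) : Prop :=
  forall z, unit_ball z ->
    peval g z != 0 /\ f z = \col_i (peval (p i) z / peval g z).

Definition pdvd (n : nat) (h q : cpoly R n) : Prop := exists k, q = k * h.

(* [msize] is one plus the total degree, and 0 for the zero polynomial. *)
Definition pdeg (n : nat) (p : cpoly R n) : nat := (mpoly.msize p).-1.

Definition lowest_terms (n N : nat) (p : 'I_N -> cpoly R n) (g : cpoly R n) :
    Prop :=
  g != 0 /\
  forall h : cpoly R n, pdvd h g -> (forall i, pdvd h (p i)) -> pdeg h = 0%N.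

Definition fraction_deg (n N : nat) (p : 'I_N -> cpoly R n) (g : cpoly R n) :
    nat :=
  maxn (\max_(i < N) pdeg (p i)) (pdeg g).

Definition rational_proper_map (n N d : nat) (f : 'cV[C]_n -> 'cV[C]_N) : Prop :=
  [/\ proper_ball_map f, holomorphic_on_ball f &
      exists (p : 'I_N -> cpoly R n) (g : cpoly R n),
        [/\ is_fraction f p g, lowest_terms p g & fraction_deg p g = d]].

Definition homog_part (n j : nat) (p : cpoly R n) : cpoly R n :=
  mpoly.pihomog mpoly.mdeg j p.

Definition admissible (n d : nat) (sigma : 'I_n -> R) : Prop :=
  [/\ forall k, 0 <= sigma k,
      forall k l : 'I_n, (k <= l)%N -> sigma k <= sigma l &
      forall k, sigma k <= (d%:R - 1) / 2].

(* deg G <= d-1 is msize G <= d, so G = 1 + G_2 + ... + G_{d-1}.  For d <= 2 the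
   degree bound makes G = 1, G_2 = 0, and so sigma = 0. *)
Definition normal_fraction (n N d : nat) (sigma : 'I_n -> R)
    (P : 'I_N -> cpoly R n) (G : cpoly R n) : Prop :=
  [/\ lowest_terms P G,
      forall i, peval (P i) 0 = 0,
      (mpoly.msize G <= d)%N,
      homog_part 0 G = 1 /\ homog_part 1 G = 0 &
      homog_part 2 G =
        \sum_(k < n) toC (sigma k) *: mpoly.mpolyX C (mpoly.mnm1 k) ^+ 2].

Definition has_normal_form (n N d : nat) (f : 'cV[C]_n -> 'cV[C]_N)
    (sigma : 'I_n -> R) : Prop :=
  admissible d sigma /\
  exists (psi : 'cV[C]_n -> 'cV[C]_n) (tau : 'cV[C]_N -> 'cV[C]_N)
         (P : 'I_N -> cpoly R n) (G : cpoly R n),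
    [/\ ball_automorphism psi, ball_automorphism tau,
        is_fraction (fun z => tau (f (psi z))) P G &
        normal_fraction d sigma P G].

End Maps.

(* Main.v *)
(* A map [f = P / G] of degree [d] is encoded by the vector [(G, P)], on which automorphisms of
   the two balls act through matrices preserving [|v_0|^2 - |v'|^2].  Hence the function
   [Lambda(z) = (|G(z)|^2 - |P(z)|^2) / (1 - |z|^2)^d] is invariant up to a constant factor.

   Existence, for [d >= 2] and [P(0) = 0]: Schwarz' lemma gives
   [Lambda >= |G|^2 (1 - |z|^2)^(1-d)], and [G] has no zero on the closed ball (Cima-Suffridge), so
   [Lambda] has a minimum; once it is moved to [0], the linear part of [G] vanishes.  On a line
   through [0], [G] becomes [prod_j (1 - a_j t)] with at most [d - 1] factors, [|a_j| < 1] and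
   [sum_j a_j = 0].  Takagi's factorization diagonalizes [G_2], and [sigma_k = - sum_j a_j^2 / 2]
   is bounded by [(d - 1) / 2].

   Uniqueness: weighted AM-GM on these factors shows that [0] is the only minimum of [Lambda], so an
   equivalence between two normal forms fixes the origins and is unitary by Schwarz' lemma; the
   [sigma_k] are then the singular values of [G_2].

   Cima-Suffridge: if [G(q) = 0], let a prime factor of [G] through [q] not divide some [P_i], and
   eliminate the variable in the direction of [q] between the two.  On a plane [x q + s u] the Taylor
   coefficients in [s] of [P / G] are rational in [x], and [|P|^2 = |G|^2] on the sphere bounds them
   inductively on the circle [|x| = 1], so that none has a pole at [x = 1]; this contradicts the
   elimination identity. *)
Require Import Defs.
From HB Require Import structures.
From mathcomp Require Import all_boot all_order all_algebra.
From mathcomp Require Import perm spectral complex cyclic separable cyclotomic.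
From mathcomp Require Import all_classical all_reals all_analysis.
From mathcomp Require mpoly.
Import (canonicals, coercions) mpoly.
Import -(notations) mpoly.
From mathcomp Require Import ring lra zify.

Set Implicit Arguments.
Unset Strict Implicit.
Unset Printing Implicit Defensive.

Import Order.TTheory GRing.Theory Num.Theory.
Import numFieldNormedType.Exports.

Local Open Scope classical_set_scope.
Local Open Scope ring_scope.

(** * Norms and the Hermitian product *)

(** Automorphisms enter only as biholomorphic maps of the ball; that matrices preserving the form
    induce them is itself a consequence of Schwarz' lemma, applied at 0 and, after boosts, at other
    points. Two facts make the passage to vectors faithful: polynomials factor uniquely, so a
    fraction in lowest terms is determined up to a constant; and the matrices preserve lowest terms
    and degree, a drop of degree being a common factor at infinity. Zeros of [G] on the sphere are
    the main obstacle: the lower bound of [Lambda] and the strict inequality |a_j| < 1 both rest on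
    excluding them. In the elimination identity a pi + b p = r, with pi the prime factor and g = pi
    kappa, one has pi (a + b kappa p / g) = r. The lowest coefficient of r in s is a nonzero
    constant, so pi cannot vanish at q once the Taylor coefficients of p / g are regular there.
    Degree 1 is apart: [Lambda] is then constant and does not single out the origin, but both normal
    forms are linear isometries, which a unitary map of the target exchanges. *)

Section ComplexNorm.
Variable R : realType.
Local Notation C := (Cplx R).
Implicit Types (x y : R) (z w : C).

(** The norm of analysis takes values in [C]; its real part moves estimates to [R], where linear
    arithmetic applies. *)
Definition nrm z : R := complex.Re `|z|.
Definition rpart z : R := complex.Re z.
Definition ipart z : R := complex.Im z.

Fact toC_is_additive : additive (@toC R).
Proof. by move=> x y; rewrite /toC rmorphB. Qed.
Fact toC_is_multiplicative : multiplicative (@toC R).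
Proof. by split=> [x y|]; rewrite /toC ?rmorphM ?rmorph1. Qed.
HB.instance Definition _ := GRing.isZmodMorphism.Build R C (@toC R) toC_is_additive.
HB.instance Definition _ := GRing.isMultiplicative.Build R C (@toC R)
  toC_is_multiplicative.

Lemma toC_inj : injective (@toC R).
Proof. by move=> x y []. Qed.

Lemma toC_eq0 x : (toC x == 0) = (x == 0).
Proof. by rewrite -(rmorph0 (@toC R)) (inj_eq toC_inj). Qed.

Lemma toC_le x y : (toC x <= toC y) = (x <= y).
Proof. by rewrite /toC; exact: lecR. Qed.

Lemma toC_lt x y : (toC x < toC y) = (x < y).
Proof. by rewrite /toC; exact: ltcR. Qed.

Lemma rpart_toC x : rpart (toC x) = x. Proof. by []. Qed.
Lemma ipart_toC x : ipart (toC x) = 0. Proof. by []. Qed.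

Lemma rpartD z w : rpart (z + w) = rpart z + rpart w.
Proof. by case: z w => [a b] [c d]. Qed.
Lemma ipartD z w : ipart (z + w) = ipart z + ipart w.
Proof. by case: z w => [a b] [c d]. Qed.
Lemma rpartN z : rpart (- z) = - rpart z.
Proof. by case: z => [a b]. Qed.
Lemma ipartN z : ipart (- z) = - ipart z.
Proof. by case: z => [a b]. Qed.
Lemma rpartB z w : rpart (z - w) = rpart z - rpart w.
Proof. by rewrite rpartD rpartN. Qed.
Lemma ipartB z w : ipart (z - w) = ipart z - ipart w.
Proof. by rewrite ipartD ipartN. Qed.
Lemma rpartM z w : rpart (z * w) = rpart z * rpart w - ipart z * ipart w.
Proof. by case: z w => [a b] [c d]. Qed.
Lemma ipartM z w : ipart (z * w) = rpart z * ipart w + ipart z * rpart w.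
Proof. by case: z w => [a b] [c d]. Qed.

Lemma complex_eqP z w : rpart z = rpart w -> ipart z = ipart w -> z = w.
Proof. by case: z w => [a b] [c d] /= -> ->. Qed.

Lemma normE z : `|z| = toC (nrm z).
Proof. by rewrite /nrm normc_def. Qed.

Lemma nrm_ge0 z : 0 <= nrm z.
Proof. by rewrite /nrm normc_def /= sqrtr_ge0. Qed.
Hint Resolve nrm_ge0 : core.

Lemma nrm0 : nrm 0 = 0. Proof. by apply: toC_inj; rewrite -normE normr0 rmorph0. Qed.
Lemma nrm1 : nrm 1 = 1. Proof. by apply: toC_inj; rewrite -normE normr1 rmorph1. Qed.
Lemma nrmN z : nrm (- z) = nrm z.
Proof. by apply: toC_inj; rewrite -!normE normrN. Qed.
Lemma nrmB z w : nrm (z - w) = nrm (w - z).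
Proof. by rewrite -nrmN opprB. Qed.
Lemma nrmM z w : nrm (z * w) = nrm z * nrm w.
Proof. by apply: toC_inj; rewrite rmorphM -!normE normrM. Qed.
Lemma nrmV z : nrm z^-1 = (nrm z)^-1.
Proof. by apply: toC_inj; rewrite fmorphV -!normE normfV. Qed.
Lemma nrmX z n : nrm (z ^+ n) = nrm z ^+ n.
Proof. by apply: toC_inj; rewrite rmorphXn -!normE normrX. Qed.
Lemma nrmD z w : nrm (z + w) <= nrm z + nrm w.
Proof. by rewrite -toC_le rmorphD -!normE ler_normD. Qed.
Lemma nrm_eq0 z : (nrm z == 0) = (z == 0).
Proof. by rewrite -toC_eq0 -normE normr_eq0. Qed.
Lemma nrm_gt0 z : (0 < nrm z) = (z != 0).
Proof. by rewrite lt_def nrm_eq0 nrm_ge0 andbT. Qed.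
Lemma nrm_conj z : nrm z^* = nrm z.
Proof. by apply: toC_inj; rewrite -!normE norm_conjC. Qed.
Lemma nrm_toC x : nrm (toC x) = `|x|.
Proof. by rewrite /nrm /toC normc_def /= expr0n addr0 sqrtr_sqr. Qed.
Lemma nrm_le_sub z w : nrm z - nrm w <= nrm (z - w).
Proof. by rewrite lerBlDr; apply: le_trans (nrmD _ _); rewrite subrK. Qed.
Lemma nrm_sum (I : Type) (r : seq I) (P : pred I) (F : I -> C) :
  nrm (\sum_(i <- r | P i) F i) <= \sum_(i <- r | P i) nrm (F i).
Proof.
elim/big_rec2: _ => [|i y z _ h]; first by rewrite nrm0.
by apply: le_trans (nrmD _ _) _; rewrite lerD2l.
Qed.

Lemma nrm_sqr z : nrm z ^+ 2 = rpart z ^+ 2 + ipart z ^+ 2.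
Proof.
rewrite /nrm normc_def /= sqr_sqrtr // addr_ge0 ?sqr_ge0 //.
Qed.

Lemma rpart_le z : `|rpart z| <= nrm z.
Proof.
rewrite -(@ler_pXn2r _ 2) ?nnegrE ?normr_ge0 // nrm_sqr real_normK ?num_real //.
by rewrite lerDl sqr_ge0.
Qed.
Lemma ipart_le z : `|ipart z| <= nrm z.
Proof.
rewrite -(@ler_pXn2r _ 2) ?nnegrE ?normr_ge0 // nrm_sqr real_normK ?num_real //.
by rewrite lerDr sqr_ge0.
Qed.

Lemma nrm_le_parts z : nrm z <= `|rpart z| + `|ipart z|.
Proof.
rewrite -(@ler_pXn2r _ 2) ?nnegrE ?addr_ge0 // nrm_sqr sqrrD !real_normK ?num_real //.
by rewrite lerD2r lerDl mulrn_wge0 // mulr_ge0.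
Qed.

Lemma mulCconj z : z * z^* = toC (nrm z ^+ 2).
Proof. by rewrite -normCK normE rmorphXn. Qed.

Lemma conj_toC x : (toC x)^* = toC x.
Proof. by apply/CrealP; rewrite complex_real. Qed.

Definition imC : C := (0 +i* 1)%C.

Lemma imC_sqr : imC * imC = -1.
Proof. by apply: complex_eqP; rewrite ?rpartM ?ipartM /=; ring. Qed.

Lemma conj_imC : imC^* = - imC.
Proof.
have i0 : imC != 0 by apply/eqP => -[] /eqP; rewrite oner_eq0.
have n1 : nrm imC ^+ 2 = 1 by rewrite nrm_sqr /= expr0n expr1n add0r.
by apply: (mulfI i0); rewrite mulCconj n1 mulrN imC_sqr opprK rmorph1.
Qed.

Lemma complexE z : z = toC (rpart z) + imC * toC (ipart z).
Proof. by apply: complex_eqP; rewrite ?rpartD ?ipartD ?rpartM ?ipartM /=; ring. Qed.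

Lemma conjE z : z^* = toC (rpart z) - imC * toC (ipart z).
Proof. by rewrite [in LHS](complexE z) rmorphD rmorphM /= conj_imC !conj_toC mulNr. Qed.

Lemma rpart_conj z : rpart z^* = rpart z.
Proof. by rewrite conjE rpartB rpartM /=; ring. Qed.
Lemma ipart_conj z : ipart z^* = - ipart z.
Proof. by rewrite conjE ipartB ipartM /=; ring. Qed.

Lemma addCconj z : z + z^* = toC (2 * rpart z).
Proof.
by apply: complex_eqP; rewrite ?rpartD ?ipartD ?rpart_conj ?ipart_conj /=; ring.
Qed.

Lemma toC_nneg z : 0 <= z -> z = toC (nrm z).
Proof. by move=> z0; rewrite -normE ger0_norm. Qed.

Lemma nrm_sqrD z w :
  nrm (z + w) ^+ 2 = nrm z ^+ 2 + 2 * rpart (z * w^*) + nrm w ^+ 2.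
Proof. by rewrite !nrm_sqr rpartM rpartD ipartD rpart_conj ipart_conj; ring. Qed.

Lemma rpart0 : rpart 0 = 0. Proof. by []. Qed.
Lemma ipart0 : ipart 0 = 0. Proof. by []. Qed.
Lemma rpart1 : rpart 1 = 1. Proof. by []. Qed.
Lemma ipart1 : ipart 1 = 0. Proof. by []. Qed.
Lemma rpart_imC : rpart imC = 0. Proof. by []. Qed.
Lemma ipart_imC : ipart imC = 1. Proof. by []. Qed.

Definition partE := (rpartD, ipartD, rpartN, ipartN, rpartM, ipartM, rpart0, ipart0,
  rpart1, ipart1, rpart_toC, ipart_toC, rpart_imC, ipart_imC, rpart_conj, ipart_conj).

End ComplexNorm.
Arguments imC {R}.
#[global] Hint Resolve nrm_ge0 : core.

Section Vectors.
Variable R : realType.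
Local Notation C := (Cplx R).
Implicit Types (x y : R) (a b : C).

Definition nsq n (z : 'cV[C]_n) : R := \sum_(i < n) nrm (z i ord0) ^+ 2.
Definition dot n (z w : 'cV[C]_n) : C := \sum_(i < n) z i ord0 * (w i ord0)^*.

Lemma nsq_ge0 n (z : 'cV[C]_n) : 0 <= nsq z.
Proof. by apply: sumr_ge0 => i _; exact: sqr_ge0. Qed.
Hint Resolve nsq_ge0 : core.

Lemma unit_ballE n (z : 'cV[C]_n) : unit_ball z <-> nsq z < 1.
Proof.
rewrite /unit_ball /= -toC_lt rmorph1 /nsq rmorph_sum /=.
rewrite (eq_bigr (fun i => toC (nrm (z i ord0) ^+ 2))) // => i _.
by rewrite rmorphXn /= -normE.
Qed.

Lemma dotzz n (z : 'cV[C]_n) : dot z z = toC (nsq z).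
Proof. by rewrite /dot rmorph_sum; apply: eq_bigr => i _; rewrite mulCconj. Qed.

Lemma dotDl n (z z' w : 'cV[C]_n) : dot (z + z') w = dot z w + dot z' w.
Proof. by rewrite /dot -big_split; apply: eq_bigr => i _; rewrite mxE mulrDl. Qed.
Lemma dotZl n a (z w : 'cV[C]_n) : dot (a *: z) w = a * dot z w.
Proof. by rewrite /dot mulr_sumr; apply: eq_bigr => i _; rewrite mxE mulrA. Qed.
Lemma dot_conj n (z w : 'cV[C]_n) : (dot z w)^* = dot w z.
Proof.
rewrite /dot rmorph_sum; apply: eq_bigr => i _.
by rewrite rmorphM /= conjCK mulrC.
Qed.
Lemma dotDr n (z w w' : 'cV[C]_n) : dot z (w + w') = dot z w + dot z w'.
Proof. by rewrite -dot_conj dotDl rmorphD /= !dot_conj. Qed.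
Lemma dotZr n a (z w : 'cV[C]_n) : dot z (a *: w) = a^* * dot z w.
Proof. by rewrite -dot_conj dotZl rmorphM /= dot_conj. Qed.
Lemma dotNl n (z w : 'cV[C]_n) : dot (- z) w = - dot z w.
Proof. by rewrite -scaleN1r dotZl mulN1r. Qed.
Lemma dotNr n (z w : 'cV[C]_n) : dot z (- w) = - dot z w.
Proof. by rewrite -dot_conj dotNl rmorphN /= dot_conj. Qed.
Lemma dot0l n (w : 'cV[C]_n) : dot 0 w = 0.
Proof. by rewrite /dot big1 // => i _; rewrite mxE mul0r. Qed.
Lemma dot0r n (w : 'cV[C]_n) : dot w 0 = 0.
Proof. by rewrite -dot_conj dot0l rmorph0. Qed.

Lemma nsq0 n : nsq (0 : 'cV[C]_n) = 0.
Proof. by rewrite /nsq big1 // => i _; rewrite mxE nrm0 expr0n. Qed.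
Lemma nsqZ n a (z : 'cV[C]_n) : nsq (a *: z) = nrm a ^+ 2 * nsq z.
Proof. by rewrite /nsq mulr_sumr; apply: eq_bigr => i _; rewrite mxE nrmM exprMn. Qed.
Lemma nsqN n (z : 'cV[C]_n) : nsq (- z) = nsq z.
Proof. by rewrite -scaleN1r nsqZ nrmN nrm1 expr1n mul1r. Qed.
Lemma nsq_eq0 n (z : 'cV[C]_n) : nsq z = 0 -> z = 0.
Proof.
move=> /eqP; rewrite psumr_eq0 => [/allP h|i _]; last exact: sqr_ge0.
apply/colP => i; rewrite mxE; have := h i (mem_index_enum i).
by rewrite /= expf_eq0 /= nrm_eq0 => /eqP.
Qed.
Lemma nrm_sqr_le_nsq n (z : 'cV[C]_n) i : nrm (z i ord0) ^+ 2 <= nsq z.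
Proof.
by rewrite /nsq (bigD1 i) //= lerDl; apply: sumr_ge0 => j _; exact: sqr_ge0.
Qed.

Lemma nsqD n (z w : 'cV[C]_n) :
  nsq (z + w) = nsq z + 2 * rpart (dot z w) + nsq w.
Proof.
apply: toC_inj; rewrite -dotzz dotDl !dotDr !rmorphD /= -addCconj dot_conj !dotzz.
ring.
Qed.

Lemma cauchy_schwarz n (z w : 'cV[C]_n) : nrm (dot z w) ^+ 2 <= nsq z * nsq w.
Proof.
have [w0|w0] := eqVneq (nsq w) 0.
  by rewrite (nsq_eq0 w0) dot0r nrm0 expr0n nsq0 mulr0.
have wp : 0 < nsq w by rewrite lt_def w0 nsq_ge0.
(* This is |w|^2 times the component of [z] orthogonal to [w], which avoids a division. *)
have := nsq_ge0 (toC (nsq w) *: z - dot z w *: w).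
have -> : nsq (toC (nsq w) *: z - dot z w *: w) =
    nsq w * (nsq z * nsq w - nrm (dot z w) ^+ 2).
  rewrite nsqD nsqN !nsqZ dotNr dotZr dotZl nrm_toC ger0_norm //.
  have -> : - ((dot z w)^* * (toC (nsq w) * dot z w)) =
      toC (- (nsq w * nrm (dot z w) ^+ 2)).
    by rewrite rmorphN rmorphM /= -mulCconj; ring.
  by rewrite rpart_toC; ring.
by rewrite pmulr_rge0 // subr_ge0.
Qed.

Lemma unit_ball0 n : unit_ball (0 : 'cV[C]_n).
Proof. by apply/unit_ballE; rewrite nsq0. Qed.

End Vectors.
#[global] Hint Resolve nsq_ge0 : core.

(** * Unique factorization *)

Section Ufd.
Variable R : idomainType.
Implicit Types a b c p u v : R.

Definition rdvd a b := exists k, b = k * a.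

Definition prime_elt p :=
  [/\ p != 0, p \isn't a GRing.unit &
      forall a b, rdvd p (a * b) -> rdvd p a \/ rdvd p b].

Definition all_prime (s : seq R) := forall p, p \in s -> prime_elt p.

Definition prime_factorization a u (s : seq R) :=
  [/\ u \is a GRing.unit, all_prime s & a = u * \prod_(p <- s) p].

Lemma all_prime_cons p s : prime_elt p -> all_prime s -> all_prime (p :: s).
Proof. by move=> pp ps q; rewrite inE => /orP[/eqP->//|/ps]. Qed.

Lemma all_prime_behead p s : all_prime (p :: s) -> prime_elt p /\ all_prime s.
Proof.
move=> h; split; first by apply: h; rewrite mem_head.
by move=> q qs; apply: h; rewrite inE qs orbT.
Qed.

(** Each prime of [s] divides one of the two factors and is cancelled there. The number of primes is
    part of the measure that decreases in [ufd_poly]. *)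
Lemma prime_factorization_split s u a b : prime_factorization (a * b) u s ->
  exists s1 s2 u1 u2, [/\ prime_factorization a u1 s1,
    prime_factorization b u2 s2 & size s = (size s1 + size s2)%N].
Proof.
elim: s a b => [|p s IHs] a b [uu ps E].
  exists [::], [::], a, b; move: uu; rewrite big_nil mulr1 in E.
  rewrite -E unitrM => /andP[ua ub].
  by split=> //; split=> //; rewrite big_nil mulr1.
have [[p0 nup pp] ps'] := all_prime_behead ps.
have : rdvd p (a * b).
  by exists (u * \prod_(q <- s) q); rewrite E big_cons mulrCA mulrC.
case/pp => [[a' Ea]|[b' Eb]].
- have E' : prime_factorization (a' * b) u s.
    split=> //; apply: (mulfI p0).
    transitivity (a * b); first by rewrite Ea; ring.
    by rewrite E big_cons; ring.
  have [s1 [s2 [u1 [u2 [[h1 h2 h3] h4 h5]]]]] := IHs _ _ E'.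
  exists (p :: s1), s2, u1, u2; split=> //; last by rewrite /= h5.
  split=> //; first exact: all_prime_cons.
  by rewrite big_cons Ea h3 mulrC mulrCA.
- have E' : prime_factorization (a * b') u s.
    split=> //; apply: (mulfI p0).
    transitivity (a * b); first by rewrite Eb; ring.
    by rewrite E big_cons; ring.
  have [s1 [s2 [u1 [u2 [h4 [h1 h2 h3] h5]]]]] := IHs _ _ E'.
  exists s1, (p :: s2), u1, u2; split=> //; last by rewrite /= h5 addnS.
  split=> //; first exact: all_prime_cons.
  by rewrite big_cons Eb h3 mulrC mulrCA.
Qed.

End Ufd.

(** The factors are prime, not merely irreducible, so that existence of a factorization already
    carries its uniqueness. *)
Definition ufd (R : idomainType) :=
  forall a : R, a != 0 -> exists u s, prime_factorization a u s.

Section UfdPoly.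
Variable R : idomainType.
Implicit Types (f g h : {poly R}) (p c : R).

Lemma rdvd_polyC p f : rdvd p%:P f <-> forall i, rdvd p f`_i.
Proof.
split=> [[k ->] i|H]; first by exists k`_i; rewrite coefMC.
have /choice[k Hk] := H.
exists (\poly_(i < size f) k i); apply/polyP => i.
rewrite coefMC coef_poly; case: ltnP => [_|szi]; first exact: Hk.
by rewrite mul0r nth_default.
Qed.

(** Gauss' lemma: take the first coefficients of [f] and of [g] that [p] does not divide, of indices
    [i] and [j]. Modulo [p], the coefficient of index [i + j] of the product is the product of these
    two. *)
Lemma prime_elt_polyC p : prime_elt p -> prime_elt p%:P.
Proof.
move=> [p0 nup pp]; split.
- by rewrite polyC_eq0.
- by apply: contra nup; rewrite poly_unitE coefC eqxx => /andP[].
move=> f g pfg; apply: contrapT => /not_orP[Nf Ng].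
have ex f0 : ~ rdvd p%:P f0 -> exists i, ~ rdvd p f0`_i /\
    forall j, (j < i)%N -> rdvd p f0`_j.
  move=> Nf0; have : exists i, ~~ `[< rdvd p f0`_i >].
    apply: contrapT => H; apply: Nf0; apply/rdvd_polyC => i.
    by apply: contrapT => /asboolPn H'; apply: H; exists i.
  case/ex_minnP => i /asboolPn Ni Hmin; exists i; split=> // j ji.
  apply: contrapT => /asboolPn /Hmin; by rewrite leqNgt ji.
have [i [Ni Hi]] := ex _ Nf; have [j [Nj Hj]] := ex _ Ng.
have /rdvd_polyC/(_ (i + j)%N) := pfg.
rewrite coefM.
have li : (i < (i + j).+1)%N by rewrite ltnS leq_addr.
rewrite (bigD1 (Ordinal li)) //= addKn => -[k Ek].
have : rdvd p (f`_i * g`_j).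
  have [k' Ek'] : rdvd p (\sum_(i0 < (i + j).+1 | i0 != Ordinal li)
      f`_i0 * g`_(i + j - i0)).
    apply: big_ind => [|x y [kx ->] [ky ->]|l lNi].
    - by exists 0; rewrite mul0r.
    - by exists (kx + ky); rewrite mulrDl.
    - have [lti|] := ltnP l i.
        by have [k1 ->] := Hi _ lti; exists (k1 * g`_(i + j - l)); rewrite mulrAC.
      rewrite leq_eqVlt => /orP[il|il].
        by rewrite -val_eqE /= eq_sym il in lNi.
      have lj : (i + j - l < j)%N by have := ltn_ord l; lia.
      by have [k1 ->] := Hj _ lj; exists (f`_l * k1); rewrite mulrA.
  exists (k - k'); rewrite mulrBl -Ek -Ek'; ring.
by case/pp.
Qed.

(** The primes of [c] are removed one at a time: each divides [h * x] but not [h], hence divides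
    [x]. *)
Lemma prime_polyC_cancel u s h x w c : prime_factorization c u s ->
  (forall p, prime_elt p -> ~ rdvd p%:P h) ->
  c%:P * w = h * x -> exists y, w = h * y.
Proof.
move=> [uu ps ->] Nh; elim: s ps w x => [|p s IHs] ps w x.
  rewrite big_nil mulr1 => E; exists (u^-1%:P * x).
  by rewrite mulrCA -E mulrA -polyCM mulVr // mul1r.
have [pp ps'] := all_prime_behead ps.
have ppP := prime_elt_polyC pp; have [p0 _ ppd] := ppP.
rewrite big_cons mulrCA polyCM -mulrA => E.
have : rdvd p%:P (h * x) by rewrite -E; exists ((u * \prod_(j <- s) j)%:P * w); rewrite mulrC.
case/ppd => [/Nh //|[x' Ex]]; apply: (IHs ps' w x').
by apply: (mulfI p0); rewrite E Ex; ring.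
Qed.

Lemma prime_polyC_split u s h a b c : prime_factorization c u s ->
  c%:P * h = a * b ->
  exists a' b', [/\ h = a' * b', size a' = size a & size b' = size b].
Proof.
move=> [uu ps ->]; elim: s ps a b => [|p s IHs] ps a b.
  rewrite big_nil mulr1 => E; exists (u^-1%:P * a), b; split=> //.
    by rewrite -mulrA -E mulrA -polyCM mulVr // mul1r.
  by rewrite mul_polyC size_scale // invr_neq0 //; apply: contraTneq uu => ->; rewrite unitr0.
have [pp ps'] := all_prime_behead ps.
have ppP := prime_elt_polyC pp; have [p0 _ ppd] := ppP.
have p0' : p != 0 by rewrite -polyC_eq0.
rewrite big_cons mulrCA polyCM -mulrA => E.
have : rdvd p%:P (a * b) by rewrite -E; exists ((u * \prod_(j <- s) j)%:P * h); rewrite mulrC.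
case/ppd => [[a' Ea]|[b' Eb]].
- have [|a2 [b2 [-> sa sb]]] := IHs ps' a' b.
    by apply: (mulfI p0); rewrite E Ea; ring.
  by exists a2, b2; split=> //; rewrite sa Ea mulrC mul_polyC size_scale.
- have [|a2 [b2 [-> sa sb]]] := IHs ps' a b'.
    by apply: (mulfI p0); rewrite E Eb; ring.
  by exists a2, b2; split=> //; rewrite sb Eb mulrC mul_polyC size_scale.
Qed.

Import Pdiv.Idomain.

Hypothesis ufdR : ufd R.

(* [h] is irreducible over the fraction field, whose role is played by
   pseudo-division, and nonzero constants cancel by [prime_polyC_cancel]. *)
Lemma prime_poly_min h : (1 < size h)%N ->
  (forall p, prime_elt p -> ~ rdvd p%:P h) ->
  (forall a b, h = a * b -> (1 < size a)%N -> (size h <= size a)%N) ->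
  prime_elt h.
Proof.
move=> sh Nh hmin; have h0 : h != 0 by rewrite -size_poly_gt0 ltnW.
split=> //.
  by rewrite poly_unitE negb_and; apply/orP; left; rewrite gtn_eqF.
have cancel (c : R) w x : c != 0 -> c%:P * w = h * x -> rdvd h w.
  move=> c0 E; have [u [s cs]] := ufdR c0.
  by have [y ->] := prime_polyC_cancel cs Nh E; exists y; rewrite mulrC.
move=> f g [k Efg].
have /dvdpP[[c q] /= c0 Eh] := dvdp_gcdl h f.
have [u [s cs]] := ufdR c0.
rewrite -mul_polyC in Eh.
have [a [b [Eab sa sb]]] := prime_polyC_split cs Eh.
have q0 : q != 0.
  by apply: contraNneq h0 => q0; move: Eh; rewrite q0 mul0r => /eqP; rewrite mulf_eq0 polyC_eq0 (negPf c0).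
have e0 : gcdp h f != 0 by rewrite gcdp_eq0 negb_and h0.
have a0 : (0 < size a)%N by rewrite sa size_poly_gt0.
have b0 : (0 < size b)%N by rewrite sb size_poly_gt0.
have sab : size h = (size a + size b).-1.
  by rewrite Eab size_mul // -size_poly_gt0.
(* Up to constants, [a] is the cofactor in [h] of the gcd of [h] and [f]. If it is not constant,
   minimality gives it the degree of [h], so [h] and [f] are coprime and [h] divides [g]; if it is
   constant, [h] is the gcd and divides [f]. *)
have [sa1|sa1] := ltnP 1 (size a).
  have := hmin _ _ Eab sa1; rewrite sab => sb1.
  have sb1' : size (gcdp h f) == 1%N by rewrite -sb; apply/eqP; lia.
  right; have : h %| f * g by apply/dvdpP; exists (1, k); rewrite ?oner_neq0 //= scale1r.
  rewrite Gauss_dvdpr /coprimep //.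
  by move=> /dvdpP[[c' q'] /= c0' E']; apply: (cancel c' g q') => //; rewrite mul_polyC E' mulrC.
left; have /size_poly1P[c' c0' Eq] : size q == 1%N by rewrite -sa; apply/eqP; lia.
have /dvdpP[[c2 q2] /= c20 Ef] := dvdp_gcdr h f.
apply: (cancel (c' * c2) f (q2 * c%:P)); first by rewrite mulf_neq0.
rewrite polyCM -mulrA [c2%:P * f]mul_polyC Ef mulrCA -Eq -Eh; ring.
Qed.

(** Induction on the size of [f] plus the number of primes of its leading coefficient. A prime
    constant dividing [f] lowers the second term; otherwise a nonconstant divisor of least size is
    prime, and splitting it off lowers the first. *)
Lemma ufd_poly : ufd {poly R}.
Proof.
move=> f f0.
have [u [s]] : exists u s, prime_factorization (lead_coef f) u s.
  by apply: ufdR; rewrite lead_coef_eq0.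
have [m] := ubnP (size f + size s)%N.
elim: m f f0 u s => // m IHm f f0 u s /ltnSE lem fs.
have [sf1|sf1] := leqP (size f) 1.
  have [uu ps Es] := fs.
  exists u%:P, (map polyC s); split; first by rewrite rmorph_unit.
    by move=> p /mapP[q /ps /prime_elt_polyC qs ->].
  rewrite (size1_polyC sf1) big_map.
  rewrite -(big_morph polyC (@polyCM R) (polyC1 R)) -polyCM; congr (_%:P).
  by rewrite -Es lead_coefE; case: (size f) sf1 => [|[]].
have [[p [pp [g Ef]]]|Np] := pselect (exists p, prime_elt p /\ rdvd p%:P f).
  have g0 : g != 0 by apply: contraNneq f0 => g0; rewrite Ef g0 mul0r.
  have : prime_factorization (lead_coef g * p) u s.
    by rewrite -[p in _ * p]lead_coefC -lead_coefM -Ef.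
  move=> /prime_factorization_split[s1 [s2 [u1 [u2 [f1 [v1 v2 v3] ss]]]]].
  have s2n : (0 < size s2)%N.
    case: (s2) v3 => // v3; have [_ + _] := pp.
    by rewrite v3 big_nil mulr1 v1.
  have p0 : p != 0 by case: pp.
  have [|v [t [uv pt Eg]]] := IHm g g0 u1 s1 _ f1.
    apply: leq_trans lem; have -> : size f = size g by rewrite Ef mulrC mul_polyC size_scale.
    by rewrite ltn_add2l ss -addn1 leq_add2l.
  exists v, (p%:P :: t); split=> //.
    by apply: all_prime_cons => //; apply: prime_elt_polyC.
  by rewrite big_cons Ef Eg mulrC mulrCA.
have : exists k, `[< exists h g, [/\ f = h * g, (1 < size h)%N & size h = k] >].
  by exists (size f); apply/asboolP; exists f, 1; rewrite mulr1.
case/ex_minnP => k /asboolP[h [g [Ef sh shk]]] kmin.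
have /andP[h0 g0] : (h != 0) && (g != 0) by rewrite -negb_or -mulf_eq0 -Ef.
have ph : prime_elt h.
  apply: prime_poly_min => // [p pp [q Eh]|a b Eh sa].
    by apply: Np; exists p; split=> //; exists (q * g); rewrite Ef Eh mulrAC.
  rewrite shk; apply: kmin; apply/asboolP; exists a, (b * g).
  by rewrite Ef Eh mulrA.
have : prime_factorization (lead_coef h * lead_coef g) u s.
  by rewrite -lead_coefM -Ef.
move=> /prime_factorization_split[s1 [s2 [u1 [u2 [_ f2 ss]]]]].
have [|v [t [uv pt Eg]]] := IHm g g0 u2 s2 _ f2.
  apply: leq_trans lem; rewrite Ef size_mul // ss.
  by rewrite -subn1; move: sh; lia.
exists v, (h :: t); split=> //; first exact: all_prime_cons.
by rewrite big_cons Ef Eg mulrCA.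
Qed.

End UfdPoly.

Lemma ufd_iso (R S : idomainType) (f : {rmorphism R -> S}) (g : {rmorphism S -> R}) :
  cancel f g -> cancel g f -> ufd S -> ufd R.
Proof.
move=> fK gK uS a a0.
have [|u [s [uu ps E]]] := uS (f a).
  by rewrite -(rmorph0 f) (inj_eq (can_inj fK)).
exists (g u), (map g s); split; first exact: rmorph_unit.
  move=> p /mapP[q /ps [q0 nu pq] ->]; split.
  - by rewrite -(rmorph0 g) (inj_eq (can_inj gK)).
  - by apply: contra nu => /(rmorph_unit f); rewrite gK.
  - move=> b c [k Ek]; have /pq : rdvd q (f b * f c).
      by exists (f k); rewrite -rmorphM Ek rmorphM gK.
    move=> [[k' E']|[k' E']]; [left|right]; exists (g k').
      by rewrite -[b]fK E' rmorphM.
    by rewrite -[c]fK E' rmorphM.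
by rewrite -[a]fK E rmorphM rmorph_prod big_map.
Qed.

Section UfdMpoly.
Variable F : fieldType.

(** The inverse of [muni], which makes the last variable the main one; it carries [ufd_poly] over to
    several variables. *)
Definition of_muni n (p : {poly mpoly n F}) : mpoly n.+1 F :=
  (map_poly (@mwiden n F) p).[mpolyX F (mnm1 ord_max)].

Fact of_muni_is_additive n : additive (@of_muni n).
Proof. by move=> p q; rewrite /of_muni raddfB hornerD hornerN. Qed.
Fact of_muni_is_multiplicative n : multiplicative (@of_muni n).
Proof.
split=> [p q|]; rewrite /of_muni; first by rewrite rmorphM hornerM.
by rewrite rmorph1 hornerC.
Qed.
HB.instance Definition _ n := GRing.isZmodMorphism.Build _ _ (@of_muni n)
  (@of_muni_is_additive n).
HB.instance Definition _ n := GRing.isMultiplicative.Build _ _ (@of_muni n)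
  (@of_muni_is_multiplicative n).

Lemma widen_or_max n (i : 'I_n.+1) :
  (exists j : 'I_n, i = widen_ord (leqnSn n) j) \/ i = ord_max.
Proof.
have [lt|ge] := ltnP i n; [left; exists (Ordinal lt)|right]; apply: val_inj => //=.
by have := ltn_ord i; lia.
Qed.

Lemma muniX_widen n (i : 'I_n) :
  muni (mpolyX F (mnm1 (widen_ord (leqnSn n) i))) = (mpolyX F (mnm1 i))%:P.
Proof.
rewrite muniE msuppX big_seq1 mcoeffX eqxx scale1r mnm1E.
rewrite -val_eqE /= (ltn_eqF (ltn_ord i)) expr0 -mul_polyC mulr1.
congr (_%:P); congr (mpolyX _ _); apply/mnmP => j.
by rewrite multinomE tnth_mktuple !mnm1E.
Qed.

Lemma muniX_max n :
  muni (mpolyX F (mnm1 (ord_max : 'I_n.+1))) = 'X.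
Proof.
rewrite muniE msuppX big_seq1 mcoeffX eqxx scale1r mnm1E eqxx expr1.
rewrite -[RHS]scale1r -mpolyX0; congr (mpolyX _ _ *: _); apply/mnmP => j.
by rewrite multinomE tnth_mktuple !mnm1E mnm0E -val_eqE /= (gtn_eqF (ltn_ord j)).
Qed.

Lemma mpoly_rmorph_eq n (S : comNzRingType) (f g : {rmorphism mpoly n F -> S}) :
  (forall c, f (mpolyC n c) = g (mpolyC n c)) ->
  (forall i, f (mpolyX F (mnm1 i)) = g (mpolyX F (mnm1 i))) -> f =1 g.
Proof.
move=> eC eX p; rewrite [p]mpolyE !rmorph_sum; apply: eq_bigr => m _.
rewrite -mul_mpolyC !rmorphM eC mpolyXE_id !rmorph_prod; congr (_ * _).
by apply: eq_bigr => i _; rewrite !rmorphXn eX.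
Qed.

Lemma of_muniX n : of_muni ('X : {poly mpoly n F}) = mpolyX F (mnm1 ord_max).
Proof. by rewrite /of_muni map_polyX hornerX. Qed.

Lemma of_muniC n (c : mpoly n F) : of_muni c%:P = mwiden c.
Proof. by rewrite /of_muni map_polyC hornerC. Qed.

Lemma mwiden_mpolyX n (i : 'I_n) :
  mwiden (mpolyX F (mnm1 i)) = mpolyX F (mnm1 (widen_ord (leqnSn n) i)).
Proof. by rewrite mwidenX mnmwiden1. Qed.

Lemma muniK n : cancel (@muni n F) (@of_muni n).
Proof.
move=> p; have := @mpoly_rmorph_eq _ _ (@of_muni n \o @muni n F) idfun; apply.
  by move=> c /=; rewrite muniC of_muniC mwidenC.
move=> i /=; have [[j ->]|->] := widen_or_max i.
  by rewrite muniX_widen of_muniC mwiden_mpolyX.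
by rewrite muniX_max of_muniX.
Qed.

Lemma of_muniK n : cancel (@of_muni n) (@muni n F).
Proof.
have wK (c : mpoly n F) : muni (mwiden c) = c%:P.
  have := @mpoly_rmorph_eq _ _ (@muni n F \o @mwiden n F) polyC; apply.
    by move=> d /=; rewrite mwidenC muniC.
  by move=> i /=; rewrite mwiden_mpolyX muniX_widen.
move=> p; elim/poly_ind: p => [|p c IH].
  by rewrite !raddf0.
rewrite (rmorphD (@of_muni n)) (rmorphM (@of_muni n)) /= of_muniC of_muniX.
by rewrite muniD muniM muniX_max IH wK.
Qed.

Lemma mpoly0_polyC (p : mpoly 0 F) : p = mpolyC 0 (mcoeff (@mnm0 0) p).
Proof.
apply/mpolyP => m; rewrite mcoeffC.
have -> : m = @mnm0 0 by apply/mnmP => -[].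
by rewrite eqxx mulr1.
Qed.

Lemma ufd_mpoly n : ufd (mpoly n F).
Proof.
elim: n => [|n IHn]; last exact: ufd_iso (@muniK n) (@of_muniK n) (ufd_poly IHn).
move=> a a0; exists a, [::]; split=> //; last by rewrite big_nil mulr1.
have Ea := mpoly0_polyC a; set c := mcoeff _ _ in Ea.
have c0 : c != 0 by apply: contraNneq a0 => c0; rewrite Ea c0 mpolyC0.
apply/unitrP; exists (mpolyC 0 c^-1).
by rewrite Ea -!mpolyCM mulVf // divff.
Qed.

End UfdMpoly.

(** * Polynomials on lines and on the ball *)

Section PolyRoots.
Variable R : realType.
Local Notation C := (Cplx R).

Lemma poly_eq0_near0 (p : {poly C}) (e : R) : 0 < e ->
  (forall t : R, 0 < t -> t < e -> p.[toC t] = 0) -> p = 0.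
Proof.
move=> e0 h.
pose s := [seq toC (e / k.+2%:R) | k <- iota 0 (size p)].
apply: (@roots_geq_poly_eq0 _ _ s).
- apply/allP => z /mapP[k _ ->]; apply/rootP; apply: h.
    by rewrite divr_gt0.
  by rewrite ltr_pdivrMr // ltr_pMr // ltr1n.
- rewrite map_inj_uniq ?iota_uniq // => k l /toC_inj.
  move=> /(mulfI (lt0r_neq0 e0)) /invr_inj /eqP.
  by rewrite eqr_nat => /eqP [].
- by rewrite size_map size_iota.
Qed.

Lemma prim_root_Cplx n : (0 < n)%N -> exists z : C, n.-primitive_root z.
Proof.
move=> n0; have [r Er] := closed_field_poly_normal ('X^n - 1 : {poly C}).
have Er' : 'X^n - 1 = \prod_(z <- r) ('X - z%:P) :> {poly C}.
  by rewrite Er (monicP (monicXnsubC _ n0)) scale1r.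
suff /hasP[z _ pz] : has n.-primitive_root r by exists z.
apply: has_prim_root => //.
- by apply/allP => z; rewrite -root_prod_XsubC -Er'.
- by rewrite -separable_prod_XsubC -Er' separable_Xn_sub_1 // pnatr_eq0 -lt0n.
- by rewrite -ltnS -(size_prod_XsubC r id) -Er' size_XnsubC.
Qed.

(** The powers of a root of unity of order larger than the degree give enough zeros on the
    circle. *)
Lemma poly_eq0_circle (p : {poly C}) :
  (forall u : C, nrm u = 1 -> p.[u] = 0) -> p = 0.
Proof.
move=> h; have [z pz] := prim_root_Cplx (ltn0Sn (size p)).
pose s := [seq z ^+ k | k <- iota 0 (size p)].
have nz1 : nrm z = 1.
  have /(congr1 (@nrm R)) := prim_expr_order pz; rewrite nrmX nrm1 => /eqP.
  by rewrite pexpr_eq1 ?nrm_ge0 // => /eqP.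
apply: (@roots_geq_poly_eq0 _ _ s).
- apply/allP => w /mapP[k _ ->]; apply/rootP; apply: h.
  by rewrite nrmX nz1 expr1n.
- rewrite map_inj_in_uniq ?iota_uniq // => k l.
  rewrite !mem_iota !add0n /= => kl ll /eqP.
  by rewrite (eq_prim_root_expr pz) !modn_small ?ltnS 1?ltnW // => /eqP.
- by rewrite size_map size_iota.
Qed.

End PolyRoots.

Section Peval.
Variables (R : realType) (n : nat).
Local Notation C := (Cplx R).
Implicit Types (p q : cpoly R n) (z v : 'cV[C]_n).

Lemma pevalD p q z : peval (p + q) z = peval p z + peval q z.
Proof. by rewrite /peval mevalD. Qed.
Lemma pevalB p q z : peval (p - q) z = peval p z - peval q z.
Proof. by rewrite /peval mevalB. Qed.
Lemma pevalM p q z : peval (p * q) z = peval p z * peval q z.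
Proof. by rewrite /peval mevalM. Qed.
Lemma pevalXn p k z : peval (p ^+ k) z = peval p z ^+ k.
Proof. by rewrite /peval rmorphXn. Qed.
Lemma pevalZ a p z : peval (a *: p) z = a * peval p z.
Proof. by rewrite /peval mevalZ. Qed.
Lemma pevalC (a : C) z : peval (mpolyC n a) z = a.
Proof. by rewrite /peval mevalC. Qed.
Lemma peval0 z : peval 0 z = 0.
Proof. by rewrite /peval meval0. Qed.
Lemma peval1 z : peval 1 z = 1.
Proof. by rewrite /peval meval1. Qed.
Lemma pevalX (i : 'I_n) z : peval (mpolyX C (mnm1 i)) z = z i ord0.
Proof. by rewrite /peval mevalXU. Qed.
Lemma peval_sum (I : Type) (r : seq I) (P : pred I) (F : I -> cpoly R n) z :
  peval (\sum_(i <- r | P i) F i) z = \sum_(i <- r | P i) peval (F i) z.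
Proof. by rewrite /peval raddf_sum. Qed.
Lemma peval_prod (I : Type) (r : seq I) (P : pred I) (F : I -> cpoly R n) z :
  peval (\prod_(i <- r | P i) F i) z = \prod_(i <- r | P i) peval (F i) z.
Proof. by rewrite /peval rmorph_prod. Qed.

Definition on_line z v p : {poly C} :=
  mmap polyC (fun i => (z i ord0)%:P + (v i ord0) *: 'X) p.

Lemma on_lineE z v p t : (on_line z v p).[t] = peval p (z + t *: v).
Proof.
rewrite /peval mevalE /on_line /mmap -[LHS]/(horner_eval t _) raddf_sum.
apply: eq_bigr => m _; rewrite /= /horner_eval hornerM hornerC; congr (_ * _).
rewrite /mmap1 horner_prod; apply: eq_bigr => i _.
by rewrite horner_exp hornerD hornerZ hornerX hornerC !mxE [t * _]mulrC.
Qed.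

Lemma size_on_line z v p : (size (on_line z v p) <= msize p)%N.
Proof.
rewrite /on_line /mmap msizeE; apply: (leq_trans (size_sum _ _ _)).
apply/bigmax_leqP_seq => m mp _.
apply: (@leq_trans (mdeg m).+1); last exact: (@leq_bigmax_seq _ _ xpredT (fun m => (mdeg m).+1)).
rewrite mul_polyC; apply: leq_trans (size_scale_leq _ _) _.
have lin i : (size ((z i ord0)%:P + v i ord0 *: 'X)%R <= 2)%N.
  apply: leq_trans (size_polyD _ _) _; rewrite geq_max.
  rewrite (leq_trans (size_polyC_leq1 _)) //=.
  by apply: leq_trans (size_scale_leq _ _) _; rewrite size_polyX.
rewrite /mmap1 mdegE; elim/big_rec2: _ => [|i x y _ h]; first by rewrite size_poly1.
apply: leq_trans (size_polyMleq _ _) _.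
have : (size (((z i ord0)%:P + v i ord0 *: 'X) ^+ m i)%R <= (m i).+1)%N.
  apply: leq_trans (size_poly_exp_leq _ _) _; rewrite ltnS.
  by have := lin i; case: (size _) => [|[|[|]]] //= _; rewrite ?mul0n ?mul1n.
by move: h; move: (size x) (size (polyseq (_ ^+ m i)%R)) => a b; lia.
Qed.

(** Restriction to a line through 0 turns homogeneous parts into coefficients; this is how
    statements on the linear and quadratic parts of [G] are reduced to one variable. *)
Lemma on_line0_coef v p k : (on_line 0 v p)`_k = peval (homog_part k p) v.
Proof.
rewrite /on_line /mmap coef_sum /homog_part pihomogE peval_sum [in RHS]big_mkcond /=.
apply: eq_bigr => m _; rewrite coefCM /mmap1.
have -> : \prod_(i < n) (((0 : 'cV[C]_n) i ord0)%:P + v i ord0 *: 'X) ^+ m i =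
   (\prod_(i < n) v i ord0 ^+ m i) *: 'X^(mdeg m).
  rewrite mdegE -mul_polyC rmorph_prod /= -prodrXr -big_split /=.
  by apply: eq_bigr => i _; rewrite mxE add0r exprZn -mul_polyC.
rewrite coefZ coefXn eq_sym; case: eqP => [_|_]; last by rewrite !mulr0.
by rewrite mulr1 pevalZ /peval mevalX.
Qed.

Lemma meval_muni k (v : 'I_k -> C) (x : C) (q : mpoly k.+1 C) :
  (map_poly (meval v) (muni q)).[x] =
  meval (fun i => if unlift ord_max i is Some j then v j else x) q.
Proof.
pose f := horner_eval x \o map_poly (meval v) \o @muni k C.
apply: (@mpoly_rmorph_eq _ _ _ f (meval _)) => [c|i] /=; rewrite /f /= /horner_eval.
  by rewrite muniC map_polyC hornerC /= !mevalC.
rewrite mevalXU; have [[j ->]|->] := widen_or_max i.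
  rewrite muniX_widen map_polyC hornerC /= mevalXU.
  have -> : widen_ord (leqnSn k) j = lift ord_max j.
    by apply: val_inj; rewrite /= /bump leqNgt ltn_ord.
  by rewrite liftK.
by rewrite unlift_none muniX_max map_polyX hornerX.
Qed.

Lemma mpoly_eq0_muni k (p : mpoly k C) :
  (forall v : 'I_k -> C, meval v p = 0) -> p = 0.
Proof.
elim: k p => [|k IHk] p h.
  have Ep := mpoly0_polyC p; have := h (fun=> 0).
  by rewrite Ep mevalC => ->; rewrite mpolyC0.
apply: (can_inj (@muniK _ _)); rewrite muni0; apply/polyP => i; rewrite coef0.
apply: IHk => v.
have : map_poly (meval v) (muni p) = 0.
  by apply: (@poly_eq0_near0 R _ 1) => // t _ _; rewrite meval_muni h.
by move=> /(congr1 (fun q : {poly C} => q`_i)); rewrite coef_map coef0.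
Qed.

(** A small positive multiple of any point lies in the ball, so the restriction to the line through
    that point has infinitely many zeros. *)
Lemma mpoly_eq0_ball p : (forall z, unit_ball z -> peval p z = 0) -> p = 0.
Proof.
move=> h; apply: mpoly_eq0_muni => v; pose z : 'cV[C]_n := \col_i v i.
have -> : meval v p = peval p (0 + 1 *: z).
  by rewrite add0r scale1r; apply: meval_eq => i; rewrite mxE.
rewrite -on_lineE (_ : on_line 0 z p = 0) ?horner0 //.
have z1 : 0 < 1 + nsq z by rewrite ltr_pwDl ?ltr01 ?nsq_ge0.
apply: (@poly_eq0_near0 R _ (1 + nsq z)^-1); first by rewrite invr_gt0.
move=> t t0 te; rewrite on_lineE add0r; apply: h; apply/unit_ballE.
rewrite nsqZ nrm_toC gtr0_norm //.
have t1 : t * (1 + nsq z) < 1 by rewrite -ltr_pdivlMr // div1r.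
by have := nsq_ge0 z; nra.
Qed.

Lemma mpoly_eq_ball p q :
  (forall z, unit_ball z -> peval p z = peval q z) -> p = q.
Proof.
by move=> h; apply/subr0_eq/mpoly_eq0_ball => z zb; rewrite pevalB h // subrr.
Qed.

Lemma msize_le_homog p d : (msize p <= d.+1)%N -> homog_part d p = 0 ->
  (msize p <= d)%N.
Proof.
move=> sp hp; rewrite msizeE; apply/bigmax_leqP_seq => m mp _.
have : (mdeg m < d.+1)%N by apply: leq_trans (msize_mdeg_lt mp) sp.
rewrite ltnS leq_eqVlt => /orP[/eqP md|//].
have : mcoeff m (homog_part d p) = mcoeff m p.
  rewrite /homog_part pihomogE raddf_sum /= -big_filter (bigD1_seq m) /=.
  - rewrite mcoeffZ mcoeffX eqxx mulr1 big1_seq ?addr0 // => m' /andP[m'm _].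
    by rewrite mcoeffZ mcoeffX (negPf m'm) mulr0.
  - by rewrite mem_filter md eqxx.
  - by rewrite filter_uniq ?msupp_uniq.
by rewrite hp mcoeff0 => /esym/eqP; rewrite mcoeff_eq0 mp.
Qed.

End Peval.

(** * Lowest terms and linear fractional maps *)

Section LowestTerms.
Variables (R : realType) (n : nat).
Local Notation C := (Cplx R).
Implicit Types (g h q : cpoly R n).

Lemma pdeg0_unit h : h != 0 -> pdeg h = 0%N -> h \is a GRing.unit.
Proof.
move=> h0; rewrite /pdeg => sh.
have Eh : h = mpolyC n (mcoeff mnm0 h) by apply: msize1_polyC; move: sh; lia.
set c := mcoeff _ _ in Eh.
have c0 : c != 0 by apply: contraNneq h0 => c0; rewrite Eh c0 mpolyC0.
by apply/unitrP; exists (mpolyC n c^-1); rewrite Eh -!mpolyCM mulVf ?divff.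
Qed.

Lemma unit_pdeg0 h : h \is a GRing.unit -> pdeg h = 0%N.
Proof.
move=> /unitrP[h' [_ hh']].
have /andP[h0 h'0] : (h != 0) && (h' != 0).
  by rewrite -negb_or -mulf_eq0 hh' oner_eq0.
have := msizeM h0 h'0; rewrite hh' msize1 /pdeg.
have : msize h != 0%N by rewrite msize_poly_eq0.
have : msize h' != 0%N by rewrite msize_poly_eq0.
move: (msize h) (msize h') => a b; lia.
Qed.

Lemma unit_mpolyC h : h \is a GRing.unit -> exists2 c : C, c != 0 & h = mpolyC n c.
Proof.
move=> uh; have /unit_pdeg0 sh := uh.
have Eh : h = mpolyC n (mcoeff mnm0 h) by apply: msize1_polyC; move: sh; rewrite /pdeg; lia.
exists (mcoeff mnm0 h) => //; apply: contraTneq uh => c0.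
by rewrite Eh c0 mpolyC0 unitr0.
Qed.

(** The primes of [G] are stripped one at a time: by lowest terms a prime [q] of [G] misses some
    [P i], and as it divides [P i * g = p i * G] it divides [g]. *)
Lemma lowest_terms_dvd N (P p : 'I_N -> cpoly R n) G g : lowest_terms P G ->
  (forall i, P i * g = p i * G) -> exists2 k, g = k * G & forall i, p i = k * P i.
Proof.
move=> lPG Epg; have G0 : G != 0 by case: lPG.
suff [k Ek] : pdvd G g.
  exists k => // i; apply: (mulIf G0).
  by rewrite -Epg Ek mulrCA mulrA.
have [u [s [uu ps EG]]] := ufd_mpoly G0.
elim: s ps G G0 EG p g lPG Epg => [|q s IHs] ps G G0 EG p g [_ lPG] Epg.
  rewrite big_nil mulr1 in EG; exists (g * G^-1).
  by rewrite mulrVK // EG.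
have [[q0 nuq pq] ps'] := all_prime_behead ps.
pose G1 := u * \prod_(r <- s) r.
have EG1 : G = G1 * q by rewrite EG big_cons /G1; ring.
have [i Ni] : exists i, ~ rdvd q (P i).
  apply: contrapT => H; apply: (negP nuq); apply: pdeg0_unit => //.
  apply: lPG; first by exists G1.
  by move=> i; apply: contrapT => H'; apply: H; exists i.
have : rdvd q (P i * g) by exists (p i * G1); rewrite Epg EG1 mulrA.
case/pq => [//|[g1 Eg]].
have G10 : G1 != 0 by apply: contraNneq G0 => E; rewrite EG1 E mul0r.
have [||k Ek] := IHs ps' G1 G10 erefl p g1.
- split=> // h [k hG] hP; apply: lPG => //.
  by exists (k * q); rewrite EG1 hG; ring.
- by move=> j; apply: (mulIf q0); transitivity (P j * g); [rewrite Eg | rewrite Epg EG1]; ring.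
- by exists k; rewrite Eg Ek EG1 -mulrA.
Qed.

Lemma lowest_terms_unique N (P p : 'I_N -> cpoly R n) G g :
  lowest_terms P G -> lowest_terms p g -> (forall i, P i * g = p i * G) ->
  exists c : C, [/\ c != 0, g = c *: G & forall i, p i = c *: P i].
Proof.
move=> lPG lpg /(lowest_terms_dvd lPG) [k Eg Ep].
have k0 : k != 0 by apply: contraNneq (proj1 lpg) => k0; rewrite Eg k0 mul0r.
have /(pdeg0_unit k0)/unit_mpolyC[c c0 Ek] : pdeg k = 0%N.
  apply: (proj2 lpg) => [|i]; first by exists G; rewrite mulrC.
  by exists (P i); rewrite mulrC.
by exists c; split=> [//||i]; rewrite ?Eg ?Ep Ek mul_mpolyC.
Qed.

End LowestTerms.

(** * Homogeneous coordinates and the action of U(1, n) on the ball *)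

Section Homogeneous.
Variable R : realType.
Local Notation C := (Cplx R).

Definition homv n (z : 'cV[C]_n) : 'cV[C]_n.+1 :=
  \col_i oapp (fun j => z j ord0) 1 (unlift ord0 i).

(** The Hermitian form of signature (1, n). It is positive on [homv z] exactly when [z] is in the
    ball, so its isometries act on the ball by linear fractional maps. *)
Definition qf n (v : 'cV[C]_n.+1) : R := nrm (v ord0 ord0) ^+ 2 - nsq (row' ord0 v).

Definition pseudo_unitary n (M : 'M[C]_n.+1) : Prop :=
  M \in unitmx /\ forall v, qf (M *m v) = qf v.

Definition den n (M : 'M[C]_n.+1) (z : 'cV[C]_n) : C := (M *m homv z) ord0 ord0.
Definition act n (M : 'M[C]_n.+1) (z : 'cV[C]_n) : 'cV[C]_n :=
  (den M z)^-1 *: row' ord0 (M *m homv z).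

Lemma homv0 n (z : 'cV[C]_n) : homv z ord0 ord0 = 1.
Proof. by rewrite mxE unlift_none. Qed.
Lemma homvS n (z : 'cV[C]_n) j : homv z (lift ord0 j) ord0 = z j ord0.
Proof. by rewrite mxE liftK. Qed.
Lemma row'_homv n (z : 'cV[C]_n) : row' ord0 (homv z) = z.
Proof. by apply/colP => i; rewrite mxE homvS. Qed.
Lemma row'Z n a (v : 'cV[C]_n.+1) : row' ord0 (a *: v) = a *: row' ord0 v.
Proof. by apply/colP => i; rewrite !mxE. Qed.
Lemma col_homvP n (v w : 'cV[C]_n.+1) :
  v ord0 ord0 = w ord0 ord0 -> row' ord0 v = row' ord0 w -> v = w.
Proof.
move=> e0 e; apply/colP => i; case: (unliftP ord0 i) => [j|] ->; last by [].
by have /colP/(_ j) := e; rewrite !mxE.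
Qed.

Lemma qf_homv n (z : 'cV[C]_n) : qf (homv z) = 1 - nsq z.
Proof. by rewrite /qf homv0 row'_homv nrm1 expr1n. Qed.

Lemma qfZ n a (v : 'cV[C]_n.+1) : qf (a *: v) = nrm a ^+ 2 * qf v.
Proof.
by rewrite /qf mxE nrmM exprMn row'Z nsqZ mulrBr.
Qed.

Lemma act_homv n (M : 'M[C]_n.+1) z : den M z != 0 ->
  M *m homv z = den M z *: homv (act M z).
Proof.
move=> d0; apply: col_homvP; first by rewrite [RHS]mxE homv0 mulr1.
rewrite row'Z row'_homv.
by rewrite scalerA divff // scale1r.
Qed.

Lemma homv_eq_act n (M : 'M[C]_n.+1) z (a : C) w :
  a != 0 -> M *m homv z = a *: homv w -> den M z = a /\ act M z = w.
Proof.
move=> a0 E; have Ed : den M z = a by rewrite /den E mxE homv0 mulr1.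
split=> //; rewrite /act Ed E.
rewrite row'Z row'_homv.
by rewrite scalerA mulVf // scale1r.
Qed.

Lemma pseudo_unitary_mul n (A B : 'M[C]_n.+1) :
  pseudo_unitary A -> pseudo_unitary B -> pseudo_unitary (A *m B).
Proof.
move=> [uA qA] [uB qB]; split; first by rewrite unitmx_mul uA.
by move=> v; rewrite -mulmxA qA qB.
Qed.
Lemma pseudo_unitary_inv n (A : 'M[C]_n.+1) :
  pseudo_unitary A -> pseudo_unitary (invmx A).
Proof.
move=> [uA qA]; split; first by rewrite unitmx_inv.
by move=> v; rewrite -[in RHS](mulKVmx uA v) qA.
Qed.
Lemma pseudo_unitary1 n : pseudo_unitary (1%:M : 'M[C]_n.+1).
Proof. by split; [exact: unitmx1 | move=> v; rewrite mul1mx]. Qed.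

Section Action.
Variables (n : nat) (M : 'M[C]_n.+1).
Hypothesis puM : pseudo_unitary M.

(** If the denominator vanished, the form would be at most 0 on [M *m homv z], whereas it equals 1 -
    |z|^2 >= 0 there; so that vector would be 0, against invertibility. The sphere is included, as
    boundary values are needed later. *)
Lemma den_neq0 z : nsq z <= 1 -> den M z != 0.
Proof.
move=> z1; apply/eqP => d0; have [uM qM] := puM.
have := qM (homv z); rewrite qf_homv /qf -/(den M z) d0 nrm0 expr0n sub0r => E.
have : nsq (row' ord0 (M *m homv z)) = 0.
  by apply: le_anti; rewrite nsq_ge0 andbT; move: E z1 => /= ; lra.
move=> /nsq_eq0 E'.
have Mz : M *m homv z = 0.
  by apply: col_homvP; [rewrite [RHS]mxE; exact: d0|rewrite E'; apply/colP => i; rewrite !mxE].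
have := congr1 (mulmx (invmx M)) Mz; rewrite mulKmx // mulmx0 => /colP/(_ ord0).
by rewrite homv0 mxE => /eqP; rewrite oner_eq0.
Qed.

(** The source of the invariance of [Lambda]: the power [d] of this factor |den|^2 is the one that
    [tvec d] brings into [qf]. *)
Lemma nsq_act z : nsq z <= 1 ->
  1 - nsq z = nrm (den M z) ^+ 2 * (1 - nsq (act M z)).
Proof.
move=> z1; rewrite -!qf_homv -qfZ -act_homv ?den_neq0 //.
by have [_ ->] := puM.
Qed.

Lemma act_ball z : unit_ball z -> unit_ball (act M z).
Proof.
move=> /unit_ballE z1; apply/unit_ballE.
have := nsq_act (ltW z1).
have : 0 < nrm (den M z) ^+ 2 by rewrite exprn_gt0 // nrm_gt0 den_neq0 // ltW.
by move: z1; nra.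
Qed.

End Action.

Lemma act_comp n (A B : 'M[C]_n.+1) z : pseudo_unitary A -> pseudo_unitary B ->
  unit_ball z -> den (A *m B) z = den B z * den A (act B z) /\
    act (A *m B) z = act A (act B z).
Proof.
move=> pA pB zb; have zb' := act_ball pB zb.
have /unit_ballE/ltW dB := zb; have /unit_ballE/ltW dA := zb'.
apply: homv_eq_act; first by rewrite mulf_neq0 ?den_neq0.
by rewrite -mulmxA (act_homv (den_neq0 pB dB)) -scalemxAr (act_homv (den_neq0 pA dA)) scalerA.
Qed.

Lemma act1 n (z : 'cV[C]_n) : act 1%:M z = z.
Proof. by have [] := @homv_eq_act n 1%:M z 1 z (oner_neq0 _); rewrite ?mul1mx ?scale1r. Qed.

Lemma actK n (M : 'M[C]_n.+1) z : pseudo_unitary M -> unit_ball z ->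
  act (invmx M) (act M z) = z.
Proof.
move=> pM zb; have [_ <-] := act_comp (pseudo_unitary_inv pM) pM zb.
by rewrite mulVmx ?act1 //; case: pM.
Qed.
Lemma actVK n (M : 'M[C]_n.+1) z : pseudo_unitary M -> unit_ball z ->
  act M (act (invmx M) z) = z.
Proof.
move=> pM zb; have [_ <-] := act_comp pM (pseudo_unitary_inv pM) zb.
by rewrite mulmxV ?act1 //; case: pM.
Qed.

End Homogeneous.

Section Transform.
Variables (R : realType) (n : nat).
Local Notation C := (Cplx R).
Implicit Types (p q : cpoly R n) (M : 'M[C]_n.+1).

Definition hompoly (i : 'I_n.+1) : cpoly R n :=
  oapp (fun j => mpolyX C (mnm1 j)) 1 (unlift ord0 i).
Definition linpoly M i : cpoly R n := \sum_j M i j *: hompoly j.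

Lemma peval_linpoly M i z : peval (linpoly M i) z = (M *m homv z) i ord0.
Proof.
rewrite /linpoly peval_sum mxE; apply: eq_bigr => j _.
rewrite pevalZ mxE /hompoly; case: unlift => [k|] /=; first by rewrite pevalX.
by rewrite peval1.
Qed.

Lemma msize_sum_leq (I : Type) (r : seq I) (P : pred I) (F : I -> cpoly R n) k :
  (forall i, P i -> (msize (F i) <= k)%N) -> (msize (\sum_(i <- r | P i) F i) <= k)%N.
Proof.
move=> h; elim/big_ind: _ => [|x y hx hy|i /h //]; first by rewrite msize0.
by apply: leq_trans (msizeD_le _ _) _; rewrite geq_max hx.
Qed.

Lemma msizeM_leq p q a b : (msize p <= a.+1)%N -> (msize q <= b.+1)%N ->
  (msize (p * q) <= (a + b).+1)%N.
Proof.
move=> ha hb; have [->|p0] := eqVneq p 0; first by rewrite mul0r msize0.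
have [->|q0] := eqVneq q 0; first by rewrite mulr0 msize0.
by rewrite msizeM //; move: (msize p) (msize q) ha hb => x y; lia.
Qed.

Lemma msizeX_leq p k : (msize p <= 2)%N -> (msize (p ^+ k) <= k.+1)%N.
Proof.
move=> h; elim: k => [|k IH]; first by rewrite expr0 msize1.
by rewrite exprS; apply: (@msizeM_leq _ _ 1 k).
Qed.

Lemma msize_linpoly M i : (msize (linpoly M i) <= 2)%N.
Proof.
apply: msize_sum_leq => j _; apply: leq_trans (msizeZ_le _ _) _.
by rewrite /hompoly; case: unlift => [k|] /=; rewrite ?msizeX ?mdeg1 ?msize1.
Qed.

(* The polynomial [c^d * (q o (a/c))] for the affine functions [(c, a) = M (1, z)]. *)
Definition ptransf d M q : cpoly R n :=
  \sum_(m <- msupp q) mcoeff m q *: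
    ((\prod_i linpoly M (lift ord0 i) ^+ m i) * linpoly M ord0 ^+ (d - mdeg m)).

Lemma msize_ptransf d M q : (msize q <= d.+1)%N -> (msize (ptransf d M q) <= d.+1)%N.
Proof.
move=> sq; rewrite /ptransf big_seq; apply: msize_sum_leq => m mq.
have md : (mdeg m <= d)%N by rewrite -ltnS; apply: leq_trans (msize_mdeg_lt mq) sq.
apply: leq_trans (msizeZ_le _ _) _; rewrite -[X in (_ <= X.+1)%N](subnKC md).
apply: msizeM_leq; last exact/msizeX_leq/msize_linpoly.
rewrite mdegE; elim/big_rec2: _ => [|i x y _ h]; first by rewrite msize1.
by apply: msizeM_leq h; exact/msizeX_leq/msize_linpoly.
Qed.

Lemma peval_ptransf d M q z : (msize q <= d.+1)%N -> den M z != 0 ->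
  peval (ptransf d M q) z = den M z ^+ d * peval q (act M z).
Proof.
move=> sq d0; rewrite /ptransf peval_sum {2}/peval mevalE mulr_sumr !big_seq.
apply: eq_bigr => m mq.
have md : (mdeg m <= d)%N by rewrite -ltnS; apply: leq_trans (msize_mdeg_lt mq) sq.
rewrite pevalZ pevalM pevalXn peval_linpoly -/(den M z) [RHS]mulrCA; congr (_ * _).
rewrite peval_prod -[in RHS](subnKC md) exprD mulrAC; congr (_ * _).
rewrite mdegE -prodrXr -big_split /=; apply: eq_bigr => i _.
rewrite pevalXn peval_linpoly -exprMn; congr (_ ^+ _).
by rewrite (act_homv d0) [LHS]mxE homvS.
Qed.

Lemma ptransfM d e M p q : pseudo_unitary M -> (msize p <= d.+1)%N ->
  (msize q <= e.+1)%N -> ptransf (d + e) M (p * q) = ptransf d M p * ptransf e M q.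
Proof.
move=> pM sp sq; apply: mpoly_eq_ball => z /unit_ballE/ltW z1.
have d0 := den_neq0 pM z1.
by rewrite pevalM !peval_ptransf ?msizeM_leq // pevalM exprD; ring.
Qed.

End Transform.

(** * Cauchy's theorem and Schwarz' lemma *)

Section RealIntegral.
Variable R : realType.
Implicit Types (f g : R -> R) (a b c t : R).

(** Two-sided continuity at each point of the segment, ends included: [s] may leave the segment. *)
Definition cont_on f a b := forall t, a <= t -> t <= b ->
  forall e, 0 < e -> exists2 d, 0 < d & forall s, `|s - t| < d -> `|f s - f t| < e.

Definition intg f a b : R := \int[@lebesgue_measure R]_(t in `[a, b]) f t.

Lemma cont_on_sub f a b a' b' : a <= a' -> b' <= b -> cont_on f a b -> cont_on f a' b'.
Proof. by move=> aa bb h t t1 t2; apply: h; [exact: le_trans t1|exact: le_trans bb]. Qed.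

Lemma cont_on_within f a b : cont_on f a b -> {within `[a, b], continuous f}.
Proof.
move=> h; apply: continuous_in_subspaceT => t /set_mem /=.
rewrite in_itv /= => /andP[at_ tb].
apply/cvgrPdist_lt => e e0; have [d d0 hd] := h t at_ tb e e0.
apply/nbhs_ballP; exists d => // s; rewrite /ball /= => st.
by rewrite distrC; apply: hd; rewrite distrC.
Qed.

Lemma cont_on_integrable f a b : cont_on f a b ->
  (@lebesgue_measure R).-integrable `[a, b] (EFin \o f).
Proof.
by move=> h; apply: continuous_compact_integrable;
  [exact: segment_compact | exact: cont_on_within].
Qed.

Lemma intg_add f a c b : cont_on f a b -> a <= c -> c <= b ->
  intg f a b = intg f a c + intg f c b.
Proof.
move=> h ac cb; rewrite /intg.
have := @Rintegral_itvB R f (BLeft a) (BRight b) c (cont_on_integrable h).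
rewrite !bnd_simp => /(_ ac cb) E.
have -> : \int[lebesgue_measure]_(t in `[c, b]) f t =
          \int[lebesgue_measure]_(t in `]c, b]) f t.
  rewrite Rintegral_itv_obnd_cbnd //.
  apply: integrableS (cont_on_integrable (cont_on_sub ac (lexx b) h)) => //.
  by apply: subset_itvr; rewrite bnd_simp.
by rewrite -E addrC subrK.
Qed.

Lemma intg_cst k a b : a <= b -> intg (fun=> k) a b = k * (b - a).
Proof.
move=> ab; rewrite /intg Rintegral_cst //.
congr (k * _); etransitivity; first exact: (congr1 fine (lebesgue_measure_itv `[a, b]%R)).
rewrite /= lte_fin; case: ltrP => [_|ba] //=.
by rewrite (le_anti (_ : a <= b <= a)) ?ab ?ba //= subrr.
Qed.

Lemma intg_sub f g a b : cont_on f a b -> cont_on g a b ->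
  intg (fun t => f t - g t) a b = intg f a b - intg g a b.
Proof. by move=> hf hg; rewrite /intg RintegralB //; exact: cont_on_integrable. Qed.

Lemma cont_on_cst k a b : cont_on (fun=> k) a b.
Proof. by move=> t _ _ e e0; exists 1 => // s _; rewrite subrr normr0. Qed.

Lemma cont_onB f g a b : cont_on f a b -> cont_on g a b ->
  cont_on (fun t => f t - g t) a b.
Proof.
move=> hf hg t at_ tb e e0.
have [d1 d10 h1] := hf t at_ tb (e / 2) (divr_gt0 e0 (ltr0Sn _ 1)).
have [d2 d20 h2] := hg t at_ tb (e / 2) (divr_gt0 e0 (ltr0Sn _ 1)).
exists (Num.min d1 d2); first by rewrite lt_min d10.
move=> s; rewrite lt_min => /andP[/h1 + /h2]; rewrite !ltr_norml => /andP[? ?] /andP[? ?].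
by apply/andP; split; lra.
Qed.

Lemma intg_le f k a b : a <= b -> cont_on f a b ->
  (forall t, a <= t -> t <= b -> f t <= k) -> intg f a b <= k * (b - a).
Proof.
move=> ab hf hk; rewrite -intg_cst //; apply: le_Rintegral => //.
- exact: cont_on_integrable.
- by apply: cont_on_integrable; exact: cont_on_cst.
- by move=> x /=; rewrite in_itv /= => /andP[? ?]; exact: hk.
Qed.

Lemma intg_ge f k a b : a <= b -> cont_on f a b ->
  (forall t, a <= t -> t <= b -> k <= f t) -> k * (b - a) <= intg f a b.
Proof.
move=> ab hf hk; rewrite -intg_cst //; apply: le_Rintegral => //.
- by apply: cont_on_integrable; exact: cont_on_cst.
- exact: cont_on_integrable.
- by move=> x /=; rewrite in_itv /= => /andP[? ?]; exact: hk.
Qed.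

Lemma intg_bound f k a b : a <= b -> cont_on f a b ->
  (forall t, a <= t -> t <= b -> `|f t| <= k) -> `|intg f a b| <= k * (b - a).
Proof.
move=> ab hf hk; rewrite ler_norml; apply/andP; split.
  rewrite -mulNr; apply: intg_ge => // t at_ tb.
  by have := hk t at_ tb; rewrite ler_norml => /andP[].
by apply: intg_le => // t at_ tb; apply: le_trans (ler_norm _) (hk t at_ tb).
Qed.

End RealIntegral.

(** * Goursat's lemma on rectangles, in a half-plane *)

Section Goursat.
Variables (R : realType) (X : R).
Local Notation C := (Cplx R).
Variable H : R -> R -> C.

Let disp (dx dy : R) : C := toC dx + imC * toC dy.

(** Holomorphy on the half-plane x < X, which stands for a punctured disc of radius exp X in the
    coordinate exp(x + iy). *)
Hypothesis Hdiff : forall x y, x < X -> exists L : C, forall e, 0 < e ->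
  exists2 d, 0 < d & forall x' y', `|x' - x| < d -> `|y' - y| < d ->
  nrm (H x' y' - H x y - L * disp (x' - x) (y' - y)) <= e * (`|x' - x| + `|y' - y|).

Let u x y := rpart (H x y).
Let v x y := ipart (H x y).

Let Hcont x y : x < X -> forall e, 0 < e -> exists2 d, 0 < d &
  forall x' y', `|x' - x| < d -> `|y' - y| < d -> nrm (H x' y' - H x y) < e.
Proof.
move=> xX e e0; have [L hL] := Hdiff y xX.
have [d d0 hd] := hL 1 ltr01.
have k0 : 0 < 2 * (2 + 2 * nrm L) by have := nrm_ge0 L; lra.
exists (Num.min d (e / (2 * (2 + 2 * nrm L)))); first by rewrite lt_min d0 divr_gt0.
move=> x' y'; rewrite !lt_min => /andP[xd xe] /andP[yd ye].
have := hd x' y' xd yd.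
set D := disp _ _; have nD : nrm D <= `|x' - x| + `|y' - y|.
  apply: le_trans (nrm_le_parts _) _; rewrite /D /disp.
  rewrite rpartD ipartD rpartM ipartM /= !(mul0r, mul1r, subr0, addr0, add0r) //.
rewrite -(subrK (L * D) (H x' y' - H x y)) => hle; rewrite addrK in hle.
apply: le_lt_trans (nrmD _ _) _; rewrite nrmM.
move: xe ye; rewrite !ltr_pdivlMr // => xe ye.
have := nrm_ge0 L; have := nrm_ge0 D; have := normr_ge0 (x' - x); have := normr_ge0 (y' - y).
move: (nrm L) (nrm D) `|x' - x| `|y' - y| hle nD xe ye => l n a b hle nD xe ye b0 a0 n0 l0.
have : l * n <= l * (a + b) by rewrite ler_wpM2l.
by move: xe ye; nra.
Qed.

Let cont_u_h y a b : b < X -> cont_on (fun x => u x y) a b.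
Proof.
move=> bX t at_ tb e e0; have [d d0 hd] := Hcont y (le_lt_trans tb bX) e0.
exists d => // s sd; rewrite -rpartB; apply: le_lt_trans (rpart_le _) _.
by apply: hd => //; rewrite subrr normr0.
Qed.

Lemma cont_vertical x a b : x < X -> cont_on (fun y => ipart (H x y)) a b.
Proof.
move=> xX t at_ tb e e0; have [d d0 hd] := Hcont t xX e0.
exists d => // s sd; rewrite -ipartB; apply: le_lt_trans (ipart_le _) _.
by apply: hd => //; rewrite subrr normr0.
Qed.

(* The real part of the integral of [H] along the boundary of a rectangle. *)
Let J x0 x1 y0 y1 : R :=
  intg (fun x => u x y0) x0 x1 - intg (fun x => u x y1) x0 x1
  - (intg (v x1) y0 y1 - intg (v x0) y0 y1).

Let J_split x0 x1 y0 y1 x y : x1 < X -> x0 <= x -> x <= x1 -> y0 <= y -> y <= y1 ->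
  J x0 x1 y0 y1 = J x0 x y0 y + J x x1 y0 y + J x0 x y y1 + J x x1 y y1.
Proof.
move=> x1X h1 h2 h3 h4; have xX := le_lt_trans h2 x1X; have x0X := le_lt_trans h1 xX.
rewrite /J.
rewrite (@intg_add R (fun x => u x y0) x0 x x1) //; last exact: cont_u_h.
rewrite (@intg_add R (fun x => u x y1) x0 x x1) //; last exact: cont_u_h.
rewrite (@intg_add R (v x1) y0 y y1) //; last exact: cont_vertical.
rewrite (@intg_add R (v x0) y0 y y1) //; last exact: cont_vertical.
ring.
Qed.

(** The affine approximation contributes nothing: opposite sides differ by Im L times the height,
    respectively the width, and the two integrals cancel in [J]. Only the error, at most e times
    width plus height, remains. *)
Let J_small x0 x1 y0 y1 px py (L : C) d e : x1 < X -> x0 <= px -> px <= x1 ->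
  y0 <= py -> py <= y1 -> x1 - x0 < d -> y1 - y0 < d ->
  (forall x' y', `|x' - px| < d -> `|y' - py| < d ->
  nrm (H x' y' - H px py - L * disp (x' - px) (y' - py)) <=
    e * (`|x' - px| + `|y' - py|)) -> 0 < e ->
  `|J x0 x1 y0 y1| <= 4 * e * (x1 - x0 + (y1 - y0)) ^+ 2.
Proof.
move=> x1X x0p px1 y0p py1 wd hd hL e0.
pose w := x1 - x0; pose h := y1 - y0.
have hR x' y' : x0 <= x' -> x' <= x1 -> y0 <= y' -> y' <= y1 ->
    nrm (H x' y' - H px py - L * disp (x' - px) (y' - py)) <= e * (w + h).
  move=> ? ? ? ?; have ax : `|x' - px| <= w by rewrite ler_norml /w; apply/andP; split; lra.
  have ay : `|y' - py| <= h by rewrite ler_norml /h; apply/andP; split; lra.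
  apply: le_trans (hL _ _ _ _) _; [exact: le_lt_trans wd|exact: le_lt_trans hd|].
  by rewrite ler_pM2l // lerD.
have x01 := le_trans x0p px1; have y01 := le_trans y0p py1.
have x0X := le_lt_trans x01 x1X.
have E1 : `|intg (fun x => u x y0 - u x y1 - ipart L * h) x0 x1| <= 2 * (e * (w + h)) * w.
  apply: intg_bound => //.
    by apply: cont_onB; [apply: cont_onB; exact: cont_u_h | exact: cont_on_cst].
  move=> x' ? ?.
  have -> : u x' y0 - u x' y1 - ipart L * h =
     rpart ((H x' y0 - H px py - L * disp (x' - px) (y0 - py)) -
            (H x' y1 - H px py - L * disp (x' - px) (y1 - py))).
    by rewrite /disp !rpartB !rpartM !rpartD !ipartD !rpartM !ipartM /= /h /u; ring.
  rewrite mulr_natl mulr2n; apply: le_trans (rpart_le _) _.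
  apply: le_trans (nrmD _ _) _; rewrite nrmN; apply: lerD; exact: hR.
have E2 : `|intg (fun y => v x1 y - v x0 y - ipart L * w) y0 y1| <= 2 * (e * (w + h)) * h.
  apply: intg_bound => //.
    by apply: cont_onB; [apply: cont_onB; exact: cont_vertical | exact: cont_on_cst].
  move=> y' ? ?.
  have -> : v x1 y' - v x0 y' - ipart L * w =
     ipart ((H x1 y' - H px py - L * disp (x1 - px) (y' - py)) -
            (H x0 y' - H px py - L * disp (x0 - px) (y' - py))).
    by rewrite /disp !ipartB !ipartM !rpartD !ipartD !rpartM !ipartM /= /w /v; ring.
  rewrite mulr_natl mulr2n; apply: le_trans (ipart_le _) _.
  apply: le_trans (nrmD _ _) _; rewrite nrmN; apply: lerD; exact: hR.
have EJ : J x0 x1 y0 y1 =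
    intg (fun x => u x y0 - u x y1 - ipart L * h) x0 x1 -
    intg (fun y => v x1 y - v x0 y - ipart L * w) y0 y1.
  rewrite !intg_sub ?intg_cst //; try exact: cont_on_cst; try exact: cont_u_h;
    try exact: cont_vertical; try (apply: cont_onB; by [exact: cont_u_h|exact: cont_vertical]).
  by rewrite /J /w /h; ring.
rewrite EJ; apply: le_trans (ler_normB _ _) _.
have := lerD E1 E2; rewrite -/w -/h.
have w0 : 0 <= w by rewrite subr_ge0. have h0 : 0 <= h by rewrite subr_ge0.
move=> /le_trans; apply.
have : 0 <= e * (w + h) ^+ 2 by rewrite mulr_ge0 ?sqr_ge0 ?ltW.
by rewrite -/w -/h; move: e w h {e0 w0 h0 E1 E2 EJ hR hL wd hd} => e' w' h'; nra.
Qed.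

Let rect : Type := (R * R * R * R)%type.
Let Jr (q : rect) := let: (x0, x1, y0, y1) := q in J x0 x1 y0 y1.

(** Bisection keeps a quarter carrying at least a fourth of |J|. The last one is the default: if the
    first three carry less than a fourth each, the triangle inequality gives it at least that. *)
Let quarter (q : rect) : rect := let: (x0, x1, y0, y1) := q in
  let x := (x0 + x1) / 2 in let y := (y0 + y1) / 2 in
  let big q' := `|Jr q| <= 4 * `|Jr q'| in
  if big (x0, x, y0, y) then (x0, x, y0, y) else
  if big (x, x1, y0, y) then (x, x1, y0, y) else
  if big (x0, x, y, y1) then (x0, x, y, y1) else (x, x1, y, y1).

Let valid (q : rect) := let: (x0, x1, y0, y1) := q in [/\ x0 <= x1, y0 <= y1 & x1 < X].

Let quarterP q : valid q ->
  let: (x0, x1, y0, y1) := q in let: (x0', x1', y0', y1') := quarter q in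
  [/\ valid (quarter q), x0 <= x0' /\ x1' <= x1, y0 <= y0' /\ y1' <= y1,
      x1' - x0' = (x1 - x0) / 2 /\ y1' - y0' = (y1 - y0) / 2 &
      `|Jr q| <= 4 * `|Jr (quarter q)|].
Proof.
case: q => [[[x0 x1] y0] y1] /= [hx hy hX].
have mid (s t : R) : s <= t -> [/\ s <= (s + t) / 2, (s + t) / 2 <= t,
    (s + t) / 2 - s = (t - s) / 2 & t - (s + t) / 2 = (t - s) / 2].
  by move=> st; split; lra.
have [gx1 gx2 gx3 gx4] := mid _ _ hx; have [gy1 gy2 gy3 gy4] := mid _ _ hy.
have gX := le_lt_trans gx2 hX.
have hs := @J_split x0 x1 y0 y1 ((x0 + x1) / 2) ((y0 + y1) / 2) hX.
have {}hs : J x0 x1 y0 y1 = J x0 ((x0 + x1) / 2) y0 ((y0 + y1) / 2) +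
   J ((x0 + x1) / 2) x1 y0 ((y0 + y1) / 2) +
   J x0 ((x0 + x1) / 2) ((y0 + y1) / 2) y1 +
   J ((x0 + x1) / 2) x1 ((y0 + y1) / 2) y1 by apply: hs; lra.
case: ifPn => [h|/negbTE/negbT h1]; first by split; [split|split|split|split|exact: h].
case: ifPn => [h|/negbTE/negbT h2]; first by split; [split|split|split|split|exact: h].
case: ifPn => [h|/negbTE/negbT h3]; first by split; [split|split|split|split|exact: h].
split; [by split|by split|by split|by split|].
move: h1 h2 h3; rewrite /= -!ltNge hs.
move: (J x0 _ y0 _) (J _ x1 y0 _) (J x0 _ _ y1) (J _ x1 _ y1) => a b c d.
have h : `|a + b + c + d| <= `|a| + `|b| + `|c| + `|d|.
  apply: le_trans (ler_normD _ _) _; rewrite lerD2r.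
  by apply: le_trans (ler_normD _ _) _; rewrite lerD2r ler_normD.
move: h; move: `|a + b + c + d| `|a| `|b| `|c| `|d| => s a' b' c' d'; lra.
Qed.

Lemma nested_intervals (a b : nat -> R) : (forall n, a n <= a n.+1) ->
  (forall n, b n.+1 <= b n) -> (forall n, a n <= b n) ->
  exists c, forall n, a n <= c /\ c <= b n.
Proof.
move=> ha hb hab.
have na : {homo a : m n / (m <= n)%N >-> m <= n}.
  by apply: homo_leq => //; exact: le_trans.
have nb m n : (m <= n)%N -> b n <= b m.
  elim: n => [|n IH]; first by rewrite leqn0 => /eqP ->.
  rewrite leq_eqVlt => /orP[/eqP-> //|/IH]; exact: le_trans.
have ub n : ubound (range a) (b n).
  move=> _ [m _ <-]; have [mn|nm] := leqP m n.
    by apply: le_trans (na _ _ mn) (hab n).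
  by apply: le_trans (hab m) (nb _ _ (ltnW nm)).
have hs : has_sup (range a) by split; [exists (a 0%N); exists 0%N|exists (b 0%N)].
exists (sup (range a)) => n; split.
  by apply: (sup_upper_bound hs); exists n.
by apply: ge_sup; [case: hs|exact: ub].
Qed.

Lemma goursat x0 x1 y0 y1 : x0 <= x1 -> y0 <= y1 -> x1 < X -> J x0 x1 y0 y1 = 0.
Proof.
move=> hx hy hX; pose q0 : rect := (x0, x1, y0, y1).
pose q n := iter n quarter q0.
pose l n := let: (a, b, c, d) := q n in a. pose r n := let: (a, b, c, d) := q n in b.
pose s n := let: (a, b, c, d) := q n in c. pose t n := let: (a, b, c, d) := q n in d.
have qE n : q n = (l n, r n, s n, t n) by rewrite /l /r /s /t; case: (q n) => [[[]]].
have vq n : valid (q n).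
  elim: n => [|n IH]; first by split.
  have := quarterP IH; rewrite -[quarter (q n)]/(q n.+1) (qE n) (qE n.+1).
  by case.
have st n : [/\ l n <= l n.+1 /\ r n.+1 <= r n, s n <= s n.+1 /\ t n.+1 <= t n,
   r n.+1 - l n.+1 = (r n - l n) / 2 /\ t n.+1 - s n.+1 = (t n - s n) / 2 &
   `|Jr (q n)| <= 4 * `|Jr (q n.+1)|].
  have := quarterP (vq n); rewrite -[quarter (q n)]/(q n.+1) (qE n) (qE n.+1).
  by case.
have vn n : [/\ l n <= r n, s n <= t n & r n < X] by have := vq n; rewrite qE.
have [px hpx] : exists c, forall n, l n <= c /\ c <= r n.
  by apply: nested_intervals => n; [case: (st n) => -[]|case: (st n) => -[]|case: (vn n)].
have [py hpy] : exists c, forall n, s n <= c /\ c <= t n.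
  by apply: nested_intervals => n; [case: (st n) => _ []|case: (st n) => _ []|case: (vn n)].
have wn n : r n - l n = (x1 - x0) / 2 ^+ n /\ t n - s n = (y1 - y0) / 2 ^+ n.
  elim: n => [|n [IH1 IH2]]; first by rewrite expr0 !divr1.
  case: (st n) => _ _ [-> ->] _; rewrite IH1 IH2 exprS invfM.
  by split; ring.
have Jn n : `|J x0 x1 y0 y1| <= 4 ^+ n * `|Jr (q n)|.
  elim: n => [|n IH]; first by rewrite expr0 mul1r.
  apply: le_trans IH _; case: (st n) => _ _ _ h.
  by rewrite exprSr -mulrA ler_pM2l // exprn_gt0.
pose D := x1 - x0 + (y1 - y0).
have D0 : 0 <= D by rewrite /D; lra.
(* On the n-th rectangle [J_small] gives 4 e (D / 2^n)^2, and the square of 2^n makes up for the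
   factor 4^n lost in n bisections. *)
suff small e : 0 < e -> `|J x0 x1 y0 y1| <= 4 * e * D ^+ 2.
  apply/eqP; rewrite -normr_le0; apply/ler_addgt0Pr => e e0; rewrite add0r.
  have k0 : 0 < 4 * (D ^+ 2 + 1) by have := sqr_ge0 D; lra.
  apply: le_trans (small (e / (4 * (D ^+ 2 + 1))) (divr_gt0 e0 k0)) _.
  rewrite -subr_ge0.
  have -> : e - 4 * (e / (4 * (D ^+ 2 + 1))) * D ^+ 2 = e / (D ^+ 2 + 1).
    by field; have := sqr_ge0 D; rewrite ?gt_eqF //; lra.
  by rewrite divr_ge0 ?ltW //; have := sqr_ge0 D; lra.
move=> e0.
have pX : px < X by case: (hpx 0%N) => _ h; apply: le_lt_trans h _; case: (vn 0%N).
have [L hL] := Hdiff py pX; have [d d0 hd] := hL e e0.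
have [n hn] : exists n, D / 2 ^+ n < d.
  have [n _ hn] := near_infty_natSinv_expn_lt (PosNum (divr_gt0 d0 (ltr_pwDr ltr01 D0))).
  exists n; have := hn n (leqnn n); rewrite /= div1r.
  rewrite ltr_pdivlMr ?ltr_pwDr // => h; apply: le_lt_trans h.
  by rewrite mulrC ler_wpM2l ?invr_ge0 ?exprn_ge0 // lerDl.
apply: le_trans (Jn n) _; rewrite qE /=.
have [[hx1 hx2] [hy1 hy2]] := (hpx n, hpy n).
have [w1 w2] := wn n; have [v1 v2 v3] := vn n.
have p2 : 0 < (2 : R) ^+ n by rewrite exprn_gt0.
have := @J_small (l n) (r n) (s n) (t n) px py L d e v3 hx1 hx2 hy1 hy2.
rewrite w1 w2 => /(_ _ _ hd e0) hJ.
have {}hJ : `|J (l n) (r n) (s n) (t n)| <= 4 * e * (D / 2 ^+ n) ^+ 2.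
  have -> : D / 2 ^+ n = (x1 - x0) / 2 ^+ n + (y1 - y0) / 2 ^+ n by rewrite /D mulrDl.
  by apply: hJ; apply: le_lt_trans hn; rewrite ler_pM2r ?invr_gt0 // /D; lra.
apply: (@le_trans _ _ (4 ^+ n * (4 * e * (D / 2 ^+ n) ^+ 2))).
  by rewrite ler_pM2l // exprn_gt0.
rewrite le_eqVlt; apply/orP; left; apply/eqP.
have -> : (4 : R) ^+ n = (2 ^+ n) ^+ 2 by rewrite -exprM mulnC exprM; congr (_ ^+ n); ring.
by field; rewrite gt_eqF.
Qed.

(** The horizontal sides cancel by periodicity, so the integral over vertical segments does not
    depend on x. In the coordinate exp(x + iy) this says that circular means do not depend on the
    radius. *)
Lemma goursat_periodic x0 x1 T : 0 < T -> (forall x, H x T = H x 0) ->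
  x0 <= x1 -> x1 < X -> intg (fun y => ipart (H x1 y)) 0 T = intg (fun y => ipart (H x0 y)) 0 T.
Proof.
move=> T0 per x01 x1X; have := @goursat x0 x1 0 T x01 (ltW T0) x1X.
rewrite /J (_ : (fun x => u x T) = (fun x => u x 0)); last by apply/funext => x; rewrite /u per.
by rewrite subrr sub0r => /eqP; rewrite oppr_eq0 subr_eq0 => /eqP.
Qed.

End Goursat.

Section ComplexExp.
Variable R : realType.
Local Notation C := (Cplx R).

Definition cdisp (dx dy : R) : C := toC dx + imC * toC dy.
(** This is exp(x + iy), through which circles become vertical segments. *)
Definition cexp (x y : R) : C := toC (expR x) * cdisp (cos y) (sin y).

Lemma is_derive_eps (f : R -> R) (x f' : R) : is_derive x (1 : R) f f' ->
  forall e, 0 < e -> exists2 d, 0 < d & forall h, `|h| < d ->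
  `|f (x + h) - f x - f' * h| <= e * `|h|.
Proof.
move=> [df Ef] e e0; move: df; rewrite /derivable => /cvgrPdist_le; rewrite -/('D_1 f x) Ef.
move=> /(_ _ e0) [d /= d0 hd]; exists d => // h hh.
have [->|h0] := eqVneq h 0; first by rewrite addr0 subrr mulr0 subr0 normr0 mulr0.
have := hd h; rewrite /= sub0r normrN => /(_ hh h0).
rewrite -(ler_pM2r (_ : 0 < `|h|)) ?normr_gt0 // => le1; apply: le_trans le1.
rewrite le_eqVlt -normrM distrC; apply/orP; left; apply/eqP; congr (`|_|).
by rewrite scaler1 [x + h]addrC mulrBl /GRing.scale /= mulrAC mulVf // mul1r.
Qed.

Lemma nrm_cdisp (dx dy : R) : nrm (cdisp dx dy) ^+ 2 = dx ^+ 2 + dy ^+ 2.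
Proof.
by rewrite nrm_sqr /cdisp rpartD ipartD rpartM ipartM /=; congr (_ ^+ 2 + _ ^+ 2); ring.
Qed.

Lemma nrm_imC : nrm (imC : C) = 1.
Proof.
have := nrm_cdisp 0 1; rewrite /cdisp rmorph0 rmorph1 add0r mulr1 expr0n expr1n add0r.
by move=> /eqP; rewrite sqrf_eq1 => /orP[/eqP //|/eqP h]; have := nrm_ge0 (imC : C); rewrite h; lra.
Qed.

Lemma nrm_cdisp_le (dx dy : R) : nrm (cdisp dx dy) <= `|dx| + `|dy|.
Proof.
rewrite /cdisp; apply: le_trans (nrmD _ _) _; rewrite nrmM !nrm_toC.
by rewrite nrm_imC mul1r.
Qed.

Lemma nrm_cexp x y : nrm (cexp x y) = expR x.
Proof.
rewrite /cexp nrmM nrm_toC ger0_norm ?expR_ge0 //.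
have -> : nrm (cdisp (cos y) (sin y)) = 1; last by rewrite mulr1.
by apply/eqP; rewrite -(@pexpr_eq1 _ _ 2) ?nrm_ge0 // nrm_cdisp cos2Dsin2.
Qed.

Lemma cexpD x y a b : cexp (x + a) (y + b) = cexp x y * cexp a b.
Proof.
by apply: complex_eqP; rewrite /cexp /cdisp !partE expRD cosD sinD; ring.
Qed.

Lemma cexp_diff0 (e : R) : 0 < e -> exists2 d, 0 < d & forall a b,
  `|a| < d -> `|b| < d -> nrm (cexp a b - 1 - cdisp a b) <= e * (`|a| + `|b|).
Proof.
(* The three terms of the decomposition below are at most e'|a|, 2 e'|b| and 3 e'|b|, which the
   constant 6 covers. *)
move=> e0; have [e' [e'0 e'1 e'e]] : exists e' : R, [/\ 0 < e', e' <= 1 & 6 * e' <= e].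
  exists (Num.min 1 (e / 6)); split.
  - by rewrite lt_min ltr01 divr_gt0.
  - by rewrite ge_min lexx.
  - by rewrite mulrC -ler_pdivlMr // ge_min lexx orbT.
have [d1 d10 h1] := is_derive_eps (is_derive_expR 0) e'0.
have [d2 d20 h2] := is_derive_eps (is_derive_cos 0) e'0.
have [d3 d30 h3] := is_derive_eps (is_derive_sin 0) e'0.
exists (Num.min (Num.min d1 d2) (Num.min d3 e')); first by rewrite !lt_min d10 d20 d30 e'0.
move=> a b; rewrite !lt_min => /andP[/andP[a1 _] /andP[_ ae]] /andP[/andP[_ b2] /andP[b3 be]].
have := h1 a a1; have := h2 b b2; have := h3 b b3.
rewrite !(add0r, expR0, cos0, sin0, oppr0, mul0r, addr0, mul1r) => hs hc hE.
pose c := cos b; pose s := sin b; pose E := expR a.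
have -> : cexp a b - 1 - cdisp a b = toC (E - 1 - a) * cdisp c s +
    cdisp (c - 1) (s - b) + toC a * cdisp (c - 1) s.
  by apply: complex_eqP; rewrite /cexp /cdisp /E /c /s !partE; ring.
apply: le_trans (nrmD _ _) _.
apply: le_trans (lerD (nrmD _ _) (lexx _)) _.
rewrite !nrmM !nrm_toC.
have -> : nrm (cdisp c s) = 1.
  by apply/eqP; rewrite -(@pexpr_eq1 _ _ 2) ?nrm_ge0 // nrm_cdisp cos2Dsin2.
rewrite mulr1.
have n1 := nrm_cdisp_le (c - 1) (s - b).
have n2 := nrm_cdisp_le (c - 1) s.
have sb : `|s| <= `|s - b| + `|b| by have := ler_normD (s - b) b; rewrite subrK.
have := normr_ge0 a; have := normr_ge0 b.
move: n1 n2 sb hs hc hE ae be; rewrite -/s -/c -/E.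
move: (nrm _) (nrm _) `|s| `|s - b| `|c - 1| `|E - 1 - a| `|a| `|b| => y x s' sb' c' E' a' b'.
move=> n1 n2 sb hs hc hE ae be b0 a0.

have e'b : e' * b' <= b' by rewrite ler_piMl.

have y0 : y <= 3 * b' by lra.
have ay : a' * y <= a' * (3 * b') by rewrite ler_wpM2l.
have ab : a' * b' <= e' * b' by rewrite ler_wpM2r // ltW.
have : E' + x + a' * y <= 6 * e' * (a' + b') by nra.
by move=> /le_trans; apply; rewrite ler_wpM2r // addr_ge0.
Qed.

Lemma cexp_diff x y (e : R) : 0 < e -> exists2 d, 0 < d & forall x' y',
  `|x' - x| < d -> `|y' - y| < d ->
  nrm (cexp x' y' - cexp x y - cexp x y * cdisp (x' - x) (y' - y)) <=
    e * (`|x' - x| + `|y' - y|).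
Proof.
move=> e0; have [d d0 hd] := cexp_diff0 (divr_gt0 e0 (expR_gt0 x)).
exists d => // x' y' hx hy.
have -> : cexp x' y' = cexp x y * cexp (x' - x) (y' - y).
  by rewrite -cexpD ![_ + (_ - _)]addrC !subrK.
have -> : cexp x y * cexp (x' - x) (y' - y) - cexp x y - cexp x y * cdisp (x' - x) (y' - y) =
  cexp x y * (cexp (x' - x) (y' - y) - 1 - cdisp (x' - x) (y' - y)) by ring.
rewrite nrmM nrm_cexp mulrC -ler_pdivlMr ?expR_gt0 //.
by apply: le_trans (hd _ _ hx hy) _; rewrite mulrAC.
Qed.

Lemma cexp_periodic x : cexp x (pi *+ 2) = cexp x 0.
Proof. by rewrite /cexp cos2pi sin2pi cos0 sin0. Qed.

End ComplexExp.

Section MeanValue.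
Variable R : realType.
Local Notation C := (Cplx R).
Implicit Types (h k : C -> C) (z w : C).

Definition cdiff h z := exists L : C, forall e, 0 < e -> exists2 d, 0 < d &
  forall w, nrm (w - z) < d -> nrm (h w - h z - L * (w - z)) <= e * nrm (w - z).

Definition ccont h z := forall e, 0 < e -> exists2 d, 0 < d &
  forall w, nrm (w - z) < d -> nrm (h w - h z) < e.

Lemma cdiff_ccont h z : cdiff h z -> ccont h z.
Proof.
move=> [L hL] e e0; have [d d0 hd] := hL 1 ltr01.
have k0 : 0 < 1 + nrm L by have := nrm_ge0 L; lra.
exists (Num.min d (e / (1 + nrm L))); first by rewrite lt_min d0 divr_gt0.
move=> w; rewrite lt_min => /andP[/hd + ]; rewrite ltr_pdivlMr // => h1 h2.
rewrite -(subrK (L * (w - z)) (h w - h z)).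
apply: le_lt_trans (nrmD _ _) _; rewrite nrmM; move: h1 h2; lra.
Qed.

Lemma cdiff_comp_cexp k z1 (x y : R) : cdiff k (z1 + cexp x y) ->
  exists L : C, forall e, 0 < e -> exists2 d, 0 < d & forall x' y',
  `|x' - x| < d -> `|y' - y| < d ->
  nrm (k (z1 + cexp x' y') - k (z1 + cexp x y) - L * cdisp (x' - x) (y' - y)) <=
    e * (`|x' - x| + `|y' - y|).
Proof.
move=> [L hL]; pose E := cexp x y; exists (L * E) => e e0.
pose A := nrm L; pose B := nrm E.
have A0 : 0 <= A := nrm_ge0 _. have B0 : 0 <= B := nrm_ge0 _.
pose e1 := Num.min 1 (e / (2 * (1 + A))).
pose e2 := e / (2 * (1 + B)).
have e10 : 0 < e1 by rewrite lt_min ltr01 divr_gt0 //; lra.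
have e11 : e1 <= 1 by rewrite ge_min lexx.
have e12 : e1 * A <= e / 2.
  have : e1 <= e / (2 * (1 + A)) by rewrite ge_min lexx orbT.
  rewrite ler_pdivlMr; last lra; nra.
have e20 : 0 < e2 by rewrite divr_gt0 //; lra.
have e22 : e2 * (1 + B) <= e / 2.
  rewrite le_eqVlt; apply/orP; left; apply/eqP; rewrite /e2; field.
  by rewrite gt_eqF //; lra.
have [d1 d10 h1] := cexp_diff x y e10.
have [d2 d20 h2] := hL e2 e20.
exists (Num.min d1 (d2 / (2 * (1 + B) + 1))).
  by rewrite lt_min d10 divr_gt0 //; lra.
move=> x' y'; rewrite !lt_min => /andP[hx hx2] /andP[hy hy2].
pose D := cdisp (x' - x) (y' - y); pose r := `|x' - x| + `|y' - y|.
have r0 : 0 <= r by rewrite addr_ge0.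
have hD : nrm D <= r := nrm_cdisp_le _ _.
have hE := h1 x' y' hx hy; rewrite -/E -/D -/r in hE.
have hE' : nrm (cexp x' y' - E) <= (1 + B) * r.
  rewrite -(subrK (E * D) (cexp x' y' - E)); apply: le_trans (nrmD _ _) _.
  rewrite nrmM -/B; move: hE hD; move: (nrm D) (nrm _) => n m; nra.
have ez : z1 + cexp x' y' - (z1 + E) = cexp x' y' - E by ring.
have rd : (1 + B) * r < d2.
  move: hx2 hy2; rewrite !ltr_pdivlMr; try lra.
  rewrite /r; move: `|x' - x| `|y' - y| => a b; nra.
have := h2 (z1 + cexp x' y'); rewrite -/E ez => /(_ (le_lt_trans hE' rd)) hk.
have -> : k (z1 + cexp x' y') - k (z1 + E) - L * E * D =
  (k (z1 + cexp x' y') - k (z1 + E) - L * (cexp x' y' - E)) + L * (cexp x' y' - E - E * D).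
  by ring.
apply: le_trans (nrmD _ _) _; rewrite nrmM -/A.
have hk' : e2 * nrm (cexp x' y' - E) <= e2 * ((1 + B) * r) by rewrite ler_pM2l.
have hA : A * nrm (cexp x' y' - E - E * D) <= A * (e1 * r) by rewrite ler_wpM2l.
have e22r : e2 * (1 + B) * r <= e / 2 * r by rewrite ler_wpM2r.
have e12r : e1 * A * r <= e / 2 * r by rewrite ler_wpM2r.
apply: le_trans (lerD (le_trans hk hk') hA) _.
have -> : e2 * ((1 + B) * r) + A * (e1 * r) = e2 * (1 + B) * r + e1 * A * r by ring.
by apply: le_trans (lerD e22r e12r) _; rewrite -mulrDl -splitr.
Qed.

(* [ipart (imC * k)] is the real part of [k]. *)
Lemma mean_value_le k z1 (rho c : R) : 0 < rho ->
  (forall w, 0 < nrm (w - z1) -> nrm (w - z1) < rho -> cdiff k w) -> ccont k z1 ->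
  forall r, 0 < r -> r < rho ->
  (forall w, nrm (w - z1) = r -> rpart (k w) <= c) -> rpart (k z1) <= c.
Proof.
move=> rho0 dk ck r r0 rrho hc.
pose H x y := imC * k (z1 + cexp x y).
have dH x y : x < ln rho -> exists L : C, forall e, 0 < e ->
  exists2 d, 0 < d & forall x' y', `|x' - x| < d -> `|y' - y| < d ->
  nrm (H x' y' - H x y - L * (toC (x' - x) + imC * toC (y' - y))) <= e * (`|x' - x| + `|y' - y|).
  move=> xX; have nE : nrm (z1 + cexp x y - z1) = expR x by rewrite addrC addKr nrm_cexp.
  have [|L hL] := @cdiff_comp_cexp k z1 x y.
    apply: dk; rewrite nE ?expR_gt0 //.
    by rewrite -(@lnK _ rho) ?posrE // ltr_expR.
  exists (imC * L) => e e0; have [d d0 hd] := hL e e0; exists d => // x' y' hx hy.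
  have := hd x' y' hx hy; rewrite -[X in X <= _]mul1r -nrm_imC -nrmM /cdisp /H.
  by apply: le_trans; rewrite le_eqVlt; apply/orP; left; apply/eqP; congr nrm; ring.
have cont_H x : x < ln rho -> cont_on (fun y => ipart (H x y)) 0 (pi *+ 2).
  by move=> xX; apply: cont_vertical xX.
have pi20 : 0 < (pi : R) *+ 2 by rewrite mulrn_wgt0 // pi_gt0.
have iH x y : ipart (H x y) = rpart (k (z1 + cexp x y)).
  by rewrite /H !partE; ring.
apply/ler_addgt0Pr => e e0; have [d d0 hd] := ck e e0.
(* The mean of Re k over the circle of radius [r] equals its mean over a circle of radius at most
   [d / 2], where [k] is within [e] of [k z1]. *)
pose x1 := ln r; pose x0 := Num.min x1 (ln (d / 2)).
have x01 : x0 <= x1 by rewrite ge_min lexx.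
have x1X : x1 < ln rho by rewrite ltr_ln ?posrE.
have per x : H x (pi *+ 2) = H x 0 by rewrite /H cexp_periodic.
have E := goursat_periodic dH pi20 per x01 x1X.
have le1 : intg (fun y => ipart (H x1 y)) 0 (pi *+ 2) <= c * (pi *+ 2 - 0).
  apply: intg_le; [exact: ltW|exact: cont_H|] => y _ _; rewrite iH; apply: hc.
  by rewrite addrC addKr nrm_cexp lnK.
have le0 : (rpart (k z1) - e) * (pi *+ 2 - 0) <= intg (fun y => ipart (H x0 y)) 0 (pi *+ 2).
  apply: intg_ge; [exact: ltW|by apply: cont_H; exact: le_lt_trans x1X|] => y _ _.
  rewrite iH lerBlDr -lerBlDl -rpartB; apply: ltW.
  apply: le_lt_trans (le_trans (ler_norm _) (rpart_le _)) _.
  rewrite nrmB; apply: hd; rewrite addrC addKr nrm_cexp.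
  apply: (@le_lt_trans _ _ (d / 2)); last by rewrite [ltRHS]splitr ltrDl divr_gt0.
  apply: (@le_trans _ _ (expR (ln (d / 2)))); last by rewrite lnK // posrE divr_gt0.
  by rewrite ler_expR ge_min lexx orbT.
have : (rpart (k z1) - e) * (pi *+ 2 - 0) <= c * (pi *+ 2 - 0).
  by apply: le_trans le0 _; rewrite -E.
have pi0 : 0 < pi *+ 2 - 0 :> R by rewrite subr0; exact: pi20.
by rewrite (ler_pM2r pi0) lerBlDr.
Qed.

End MeanValue.

(** * Euclidean neighbourhoods and compactness of closed balls *)

Section Topology.
Variable R : realType.
Local Notation C := (Cplx R).

Lemma nbhs_nsqP n (z : 'cV[C]_n) (A : set 'cV[C]_n) :
  nbhs z A <-> exists2 d : R, 0 < d & forall w, nsq (w - z) < d -> A w.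
Proof.
split.
  move=> /nbhs_ballP[e /= e0 hA].
  have Ee := toC_nneg (ltW e0); have e0' : 0 < nrm e by rewrite nrm_gt0 gt_eqF.
  exists (nrm e ^+ 2); first by rewrite exprn_gt0.
  move=> w hw; apply: hA; split=> // i j.
  rewrite /ball /= normE Ee toC_lt -(@ltr_pXn2r _ 2) ?nnegrE ?nrm_ge0 //.
  apply: le_lt_trans hw; have := nrm_sqr_le_nsq (w - z) i.
  by rewrite !mxE nrmB (ord1 j).
move=> [d d0 hA]; apply/nbhs_ballP.
(* With [n.+1] rather than [n], the sum of the [n] terms stays strictly below [d], also for
   [n = 0]. *)
have dn : 0 < d / n.+1%:R by rewrite divr_gt0.
exists (toC (Num.sqrt (d / n.+1%:R))) => /=.
  by rewrite -[0](rmorph0 (@toC R)) toC_lt sqrtr_gt0.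
move=> w [_ hw]; apply: hA.
apply: (@le_lt_trans _ _ (\sum_(i < n) d / n.+1%:R)); last first.
  rewrite sumr_const card_ord -[X in X < _]mulr_natr -mulrA gtr_pMr // mulrC.
  by rewrite ltr_pdivrMr // mul1r ltr_nat.
apply: ler_sum => i _; have := hw i ord0.
rewrite /ball /= normE toC_lt -(@ltr_pXn2r _ 2) ?nnegrE ?nrm_ge0 ?sqrtr_ge0 //.
by rewrite sqr_sqrtr ?(ltW dn) // => h; rewrite !mxE nrmB ltW.
Qed.

Lemma nbhs_nrmP (z : C) (A : set C) :
  nbhs z A <-> exists2 d : R, 0 < d & forall w, nrm (w - z) < d -> A w.
Proof.
split=> [/nbhs_ballP[e /= e0 hA]|[d d0 hA]].
  have Ee := toC_nneg (ltW e0); have e0' : 0 < nrm e by rewrite nrm_gt0 gt_eqF.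
  exists (nrm e) => // w hw; apply: hA.
  by rewrite /ball /= normE Ee toC_lt nrmB.
apply/nbhs_ballP; exists (toC d) => /=.
  by rewrite -[0](rmorph0 (@toC R)) toC_lt.
by move=> w; rewrite /ball /= normE toC_lt nrmB; exact: hA.
Qed.

(** C^n as real 2n-space, where bounded closed sets are compact. *)
Definition of_real2 n (v : 'rV[R]_(n + n)) : 'cV[C]_n :=
  \col_i (toC (v ord0 (lshift n i)) + imC * toC (v ord0 (rshift n i))).

Lemma nsq_of_real2 n (v : 'rV[R]_(n + n)) :
  nsq (of_real2 v) = \sum_j v ord0 j ^+ 2.
Proof.
rewrite big_split_ord /= -big_split /=; apply: eq_bigr => i _.
by rewrite nrm_sqr mxE !partE; congr (_ ^+ 2 + _ ^+ 2); ring.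
Qed.

Lemma of_real2_surj n (z : 'cV[C]_n) : exists v, of_real2 v = z.
Proof.
exists (\row_j match fintype.split j with inl i => rpart (z i ord0) | inr i => ipart (z i ord0) end).
apply/colP => i; rewrite !mxE.
have -> : fintype.split (lshift n i) = inl i by exact: (unsplitK (inl i)).
have -> : fintype.split (rshift n i) = inr i by exact: (unsplitK (inr i)).
by rewrite -complexE.
Qed.

Lemma of_real2B n (v w : 'rV[R]_(n + n)) : of_real2 (v - w) = of_real2 v - of_real2 w.
Proof. by apply/colP => i; rewrite !mxE !rmorphB /=; ring. Qed.

Lemma continuous_sumr m (T : topologicalType) (f : 'I_m -> T -> R) (x : T) :
  (forall j, {for x, continuous (f j)}) ->
  (fun y => \sum_j f j y) @ x --> \sum_j f j x.
Proof.
move=> h; elim: (index_enum _) => [|j r IH].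
  under eq_fun do rewrite big_nil; rewrite big_nil; exact: cvg_cst.
under eq_fun do rewrite big_cons; rewrite big_cons; apply: cvgD IH; exact: h.
Qed.

Lemma of_real2_continuous n : continuous (@of_real2 n).
Proof.
move=> v A /nbhs_nsqP[d d0 hA].
have hc : (fun w : 'rV[R]_(n + n) => \sum_j (w - v) ord0 j ^+ 2) @ v --> (0 : R).
  rewrite -[X in _ --> X](_ : \sum_j (v - v) ord0 j ^+ 2 = 0); last first.
    by rewrite subrr big1 // => j _; rewrite mxE expr0n.
  apply: (@continuous_sumr _ _ (fun j (w : 'rV[R]_(n + n)) => (w - v) ord0 j ^+ 2) v) => j.
  have h : (fun w : 'rV[R]_(n + n) => (w - v) ord0 j) @ v --> (v - v) ord0 j.
    have E : (fun w : 'rV[R]_(n + n) => (w - v) ord0 j) = (fun w => w ord0 j - v ord0 j).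
      by apply/funext => w; rewrite !mxE.
    rewrite E [(v - v) _ _]mxE [(- v) _ _]mxE.
    have hv : (fun w : 'rV[R]_(n + n) => w ord0 j) @ v --> v ord0 j.
      exact: coord_continuous.
    exact: cvgB hv (cvg_cst _).
  exact: (cvgM h h).
move: hc => /cvgr_dist_lt /(_ _ d0) h; apply: filterS h => w /=.
rewrite distrC subr0 => hw; apply: hA; rewrite -of_real2B nsq_of_real2.
exact: le_lt_trans (ler_norm _) hw.
Qed.

Lemma compact_nsq_le n (rho : R) : compact [set z : 'cV[C]_n | nsq z <= rho].
Proof.
pose A := [set v : 'rV[R]_(n + n) | \sum_j v ord0 j ^+ 2 <= rho].
have -> : [set z : 'cV[C]_n | nsq z <= rho] = @of_real2 n @` A.
  apply/seteqP; split=> [z /= hz|_ [v hv <-]]; last by rewrite /= nsq_of_real2.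
  have [v Ev] := of_real2_surj z; exists v => //.
  by rewrite /A /= -nsq_of_real2 Ev.
apply: continuous_compact.
  by apply: continuous_subspaceT; exact: of_real2_continuous.
apply: bounded_closed_compact.
  exists (rho + 1); split; first exact: num_real.
  move=> M hM v hv /=; rewrite /Num.norm /= mx_normrE.
  have hM0 : 0 <= rho by apply: le_trans hv; apply: sumr_ge0 => j _; exact: sqr_ge0.
  apply/bigmax_leP; split; first by lra.
  move=> [i j] _ /=; rewrite (ord1 i).
  have : v ord0 j ^+ 2 <= rho.
    apply: le_trans hv; rewrite (bigD1 j) //= lerDl; apply: sumr_ge0 => l _; exact: sqr_ge0.
  by rewrite ler_norml => h; apply/andP; split; nra.
apply: (@preimage_closed _ _ (fun v : 'rV[R]_(n + n) => \sum_j v ord0 j ^+ 2) [set x | x <= rho]).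
  move=> v _; apply: continuous_sumr => j.
  have h : (fun w : 'rV[R]_(n + n) => w ord0 j) @ v --> v ord0 j by exact: coord_continuous.
  exact: (cvgM h h).
exact: closed_le.
Qed.

Definition vcont n (F : 'cV[C]_n -> R) z := forall e, 0 < e -> exists2 d, 0 < d &
  forall w, nsq (w - z) < d -> `|F w - F z| < e.

Lemma nsq_ball_min n (F : 'cV[C]_n -> R) rho : 0 <= rho ->
  (forall z, nsq z <= rho -> vcont F z) ->
  exists2 z, nsq z <= rho & forall w, nsq w <= rho -> F z <= F w.
Proof.
move=> rho0 cF.
have [||z /set_mem hz hmin] := @compact_EVT_min _ R F _ _ (@compact_nsq_le n rho).
- by exists 0; rewrite /= nsq0.
- apply: continuous_in_subspaceT => z /set_mem hz.
  move=> A /nbhs_ballP[e e0 hA]; have [d d0 hd] := cF z hz e e0.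
  apply/nbhs_nsqP; exists d => // w /hd hw; apply: hA.
  by rewrite /ball /= distrC.
- by exists z => // w hw; apply: hmin; apply/mem_set.
Qed.

End Topology.

Section Schwarz.
Variable R : realType.
Local Notation C := (Cplx R).
Implicit Types (h k : C -> C) (z w : C).

Lemma cdiffP h z : cdiff h z <-> derivable h z 1.
Proof.
split=> [[L hL]|dh].
  apply/cvg_ex; exists L; apply/cvgrPdist_le => e e0.
  have [e' e0' Ee] : exists2 e' : R, 0 < e' & e = toC e'.
    by exists (nrm e); [rewrite nrm_gt0 gt_eqF|exact: toC_nneg (ltW e0)].
  have [d d0 hd] := hL _ e0'.
  apply/nbhs_nrmP; exists d => // w; rewrite subr0 => hw w0.
  have := hd (w + z); rewrite addrK => /(_ hw) h1; rewrite normE Ee toC_le.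
  rewrite -(ler_pM2r (_ : 0 < nrm w)) ?nrm_gt0 //; apply: le_trans h1.
  rewrite -nrmM nrmB le_eqVlt; apply/orP; left; apply/eqP; congr nrm.
  by rewrite scaler1 /GRing.scale /= mulrBl mulrAC mulVf // mul1r.
move: dh => /cvg_ex[L hL]; exists L => e e0; move/cvgrPdist_le: hL => /(_ (toC e)).
rewrite -[0](rmorph0 (@toC R)) toC_lt => /(_ e0) /nbhs_nrmP [d d0 hd].
exists d => // w hw; have [->|wz] := eqVneq w z.
  by rewrite !subrr mulr0 subr0 nrm0 mulr0.
have wz' : w - z != 0 by rewrite subr_eq0.
have := hd (w - z); rewrite rmorph0 subr0 => /(_ hw wz').
rewrite /= scaler1 subrK /GRing.scale /= normE toC_le => h1.
rewrite -(ler_pM2r (_ : 0 < nrm (w - z))) ?nrm_gt0 // in h1; apply: le_trans h1.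
rewrite -nrmM nrmB le_eqVlt; apply/orP; left; apply/eqP; congr nrm.
by rewrite mulrBl mulrAC mulVf // mul1r opprB addrC.
Qed.

(** The perturbation eta |z|^2 of |k|^2 makes an interior maximum contradict the mean value
    inequality strictly. [k] is only continuous at 0 because it will be the quotient h(w) / w of
    Schwarz' lemma. *)
Lemma max_principle k r (B : R) z0 : 0 < r -> r < 1 ->
  (forall z, nrm z <= r -> ccont k z) ->
  (forall z, z != 0 -> nrm z < 1 -> cdiff k z) ->
  (forall z, nrm z = r -> nrm (k z) <= B) -> 0 <= B ->
  nrm z0 <= r -> nrm (k z0) <= B.
Proof.
move=> r0 r1 ck dk hB B0 z0r; rewrite leNgt; apply/negP => hlt.
have m0 : B ^+ 2 < nrm (k z0) ^+ 2 by rewrite ltr_pXn2r ?nnegrE ?nrm_ge0.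
have [eta [eta0 heta]] : exists eta : R, 0 < eta /\ B ^+ 2 + eta < nrm (k z0) ^+ 2.
  by exists ((nrm (k z0) ^+ 2 - B ^+ 2) / 2); split; lra.
pose Phi z := nrm (k z) ^+ 2 + eta * nrm z ^+ 2.
have sq_cont (a b M e : R) : 0 <= a -> 0 <= b -> 0 <= M -> a <= M + 1 -> b <= M ->
    `|a - b| <= e -> `|a ^+ 2 - b ^+ 2| <= (2 * M + 1) * e.
  move=> a0 b0 M0 aM bM; rewrite subr_sqr normrM => h.
  have hab : `|a + b| <= 2 * M + 1 by rewrite ger0_norm ?addr_ge0 //; lra.
  by rewrite mulrC ler_pM.
have nrm_dist z w : `|nrm z - nrm w| <= nrm (z - w).
  rewrite ler_norml; apply/andP; split; last exact: nrm_le_sub.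
  by rewrite lerNl opprB nrmB nrm_le_sub.
have Phi_cont z : nrm z <= r -> forall e, 0 < e -> exists2 d, 0 < d &
    forall w, nrm (w - z) < d -> `|Phi w - Phi z| < e.
  move=> zr e e0.
  pose M := nrm (k z); have M0 : 0 <= M := nrm_ge0 _.
  pose M' := nrm z; have M'0 : 0 <= M' := nrm_ge0 _.
  pose e1 := Num.min 1 (e / 4 / (2 * M + 1)).
  have e10 : 0 < e1 by rewrite lt_min ltr01 !divr_gt0 //; lra.
  have e11 : e1 <= 1 by rewrite ge_min lexx.
  have e1e : (2 * M + 1) * e1 <= e / 4.
    by rewrite mulrC -ler_pdivlMr ?ge_min ?lexx ?orbT //; lra.
  have [d d0 hd] := ck z zr e1 e10.
  pose d2 := Num.min 1 (e / 4 / (eta * (2 * M' + 1))).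
  have d20 : 0 < d2 by rewrite lt_min ltr01 !divr_gt0 ?mulr_gt0 //; lra.
  have d21 : d2 <= 1 by rewrite ge_min lexx.
  have d2e : eta * (2 * M' + 1) * d2 <= e / 4.
    by rewrite mulrC -ler_pdivlMr ?ge_min ?lexx ?orbT // mulr_gt0 //; lra.
  exists (Num.min d d2); first by rewrite lt_min d0.
  move=> w; rewrite lt_min => /andP[/hd kw wd].
  have h1 : `|nrm (k w) ^+ 2 - nrm (k z) ^+ 2| <= (2 * M + 1) * e1.
    have := le_trans (nrm_dist (k w) (k z)) (ltW kw).
    apply: sq_cont; rewrite ?nrm_ge0 //.
    by have := le_trans (nrm_le_sub (k w) (k z)) (ltW kw); rewrite /M; lra.
  have h2 : `|nrm w ^+ 2 - nrm z ^+ 2| <= (2 * M' + 1) * d2.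
    have := le_trans (nrm_dist w z) (ltW wd).
    apply: sq_cont; rewrite ?nrm_ge0 //.
    by have := le_trans (nrm_le_sub w z) (ltW wd); rewrite /M'; lra.
  have -> : Phi w - Phi z = (nrm (k w) ^+ 2 - nrm (k z) ^+ 2) + eta * (nrm w ^+ 2 - nrm z ^+ 2).
    by rewrite /Phi; ring.
  apply: le_lt_trans (ler_normD _ _) _; rewrite normrM (gtr0_norm eta0).
  have : eta * `|nrm w ^+ 2 - nrm z ^+ 2| <= eta * ((2 * M' + 1) * d2) by rewrite ler_pM2l.
  by rewrite mulrA; lra.
pose F (v : 'cV[C]_1) := Phi (v ord0 ord0).
have nsq1 (v : 'cV[C]_1) : nsq v = nrm (v ord0 ord0) ^+ 2 by rewrite /nsq big_ord1.
have sq_le (a b : R) : 0 <= a -> 0 <= b -> (a ^+ 2 <= b ^+ 2) = (a <= b).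
  by move=> a0 b0; rewrite ler_pXn2r.
have [z1 z1r z1max] : exists2 z1, nrm z1 <= r & forall w, nrm w <= r -> Phi w <= Phi z1.
  have [||v hv vmin] := @nsq_ball_min R 1 (fun v => - F v) (r ^+ 2).
  - exact: sqr_ge0.
  - move=> v; rewrite nsq1 sq_le ?nrm_ge0 ?(ltW r0) // => vr e e0.
    have [d d0 hd] := Phi_cont _ vr e e0; exists (d ^+ 2); first by rewrite exprn_gt0.
    move=> w; rewrite nsq1 !mxE ltr_pXn2r ?nnegrE ?nrm_ge0 ?(ltW d0) // => /hd hh.
    have -> : - F w - - F v = - (Phi (w ord0 ord0) - Phi (v ord0 ord0)) by rewrite /F; ring.
    by rewrite normrN.
  - exists (v ord0 ord0); first by rewrite -sq_le ?nrm_ge0 ?(ltW r0) // -nsq1.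
    move=> w wr; have := vmin (\col_i w); rewrite /F nsq1 !mxE lerN2; apply.
    by rewrite sq_le ?nrm_ge0 ?(ltW r0).
have z1lt : nrm z1 < r.
  rewrite lt_neqAle z1r andbT; apply/eqP => E.
  have := z1max z0 z0r; rewrite /Phi.
  have : nrm (k z1) ^+ 2 <= B ^+ 2 by rewrite sq_le ?nrm_ge0 ?hB.
  have : eta * nrm z1 ^+ 2 <= eta by rewrite E ger_pMr //; nra.
  have : 0 <= eta * nrm z0 ^+ 2 by rewrite mulr_ge0 ?sqr_ge0 ?ltW.
  by move: heta; lra.
(* Re K(z1) = 2 Phi(z1). For |w - z1| = rho / 2, the inequality 2 Re(a conj b) <= |a|^2 + |b|^2 on
   the [k] term, and its exact form with defect |w - z1|^2 on the other, give Re K(w) <= Phi(z1) +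
   Phi(w) - eta (rho / 2)^2. *)
pose K z := (2 * (k z1)^*) * k z + (toC (2 * eta) * z1^*) * z.
(* If [z1] is not 0, the open disc of radius [rho] around it avoids 0; if [z1 = 0], only the centre
   is exempt from differentiability, as [mean_value_le] allows. *)
have [rho [rho0 rhor rhoz]] : exists rho, [/\ 0 < rho, rho <= r - nrm z1 &
    z1 != 0 -> rho <= nrm z1].
  have [->|z10] := eqVneq z1 0; first by exists r; split=> //; rewrite nrm0 subr0.
  exists (Num.min (r - nrm z1) (nrm z1)); split.
  - by rewrite lt_min subr_gt0 z1lt nrm_gt0.
  - by rewrite ge_min lexx.
  - by rewrite ge_min lexx orbT.
have in_disc w : nrm (w - z1) < rho -> nrm w <= r.
  move=> h; rewrite -(subrK z1 w); apply: le_trans (nrmD _ _) _; lra.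
have rpartK z : rpart (K z) = nrm (k z1 + k z) ^+ 2 - nrm (k z1) ^+ 2 - nrm (k z) ^+ 2
    + eta * (nrm (z1 + z) ^+ 2 - nrm z1 ^+ 2 - nrm z ^+ 2).
  rewrite /K !nrm_sqrD !partE; ring.
have t0 : 0 < rho / 2 by lra. have t1 : rho / 2 < rho by lra.
have := @mean_value_le R K z1 rho (rpart (K z1) - eta * (rho / 2) ^+ 2) rho0 _ _ _ t0 t1 _.
have : 0 < eta * (rho / 2) ^+ 2 by rewrite mulr_gt0 // exprn_gt0.
move=> pos H; suff : rpart (K z1) <= rpart (K z1) - eta * (rho / 2) ^+ 2 by lra.
apply: H.
- move=> w w0 wr.
  have w0' : w != 0.
    apply/eqP => E; have z10 : z1 != 0.
      by apply/eqP => E'; move: w0; rewrite E E' subrr nrm0 ltxx.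
    by have := rhoz z10; move: wr; rewrite E sub0r nrmN; lra.
  have w1 : nrm w < 1 by apply: le_lt_trans (in_disc _ wr) r1.
  apply/cdiffP; apply: derivableD; apply: derivableM => //.
  + exact/cdiffP/dk.
- move=> e e0.
  have e2 : 0 < e / (2 * (2 * nrm (k z1) + 1)) by rewrite divr_gt0 //; have := nrm_ge0 (k z1); lra.
  have [d d0 hd] := ck z1 z1r _ e2.
  have c2 : 0 < 2 * (2 * eta * nrm z1 + 1) by have := mulr_ge0 (ltW eta0) (nrm_ge0 z1); lra.
  exists (Num.min d (e / (2 * (2 * eta * nrm z1 + 1)))); first by rewrite lt_min d0 divr_gt0.
  move=> w; rewrite lt_min => /andP[/hd h1]; rewrite ltr_pdivlMr // => h2.
  have -> : K w - K z1 = 2 * (k z1)^* * (k w - k z1) + toC (2 * eta) * z1^* * (w - z1).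
    by rewrite /K; ring.
  apply: le_lt_trans (nrmD _ _) _; rewrite !nrmM !nrm_conj nrm_toC.
  have n2 : nrm (2 : C) = 2.
    by rewrite -[2 : C](rmorph_nat (@toC R)) nrm_toC ger0_norm.
  rewrite n2 (gtr0_norm (_ : 0 < 2 * eta)); last lra.
  move: h1; rewrite ltr_pdivlMr; last by have := nrm_ge0 (k z1); lra.
  move: h2; have := nrm_ge0 (k w - k z1); have := nrm_ge0 (w - z1).
  by move: (nrm (k w - k z1)) (nrm (w - z1)) => a b; lra.
- move=> w hw; have wr : nrm w <= r by apply: in_disc; rewrite hw.
  have := z1max w wr; rewrite /Phi !rpartK.
  have h1 : nrm (k z1 + k w) ^+ 2 <= 2 * nrm (k z1) ^+ 2 + 2 * nrm (k w) ^+ 2.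
    have := sqr_ge0 (nrm (k z1 - k w)); rewrite nrm_sqrD nrm_sqrD rmorphN mulrN rpartN nrmN; lra.
  have h2 : nrm (z1 + w) ^+ 2 = 2 * nrm z1 ^+ 2 + 2 * nrm w ^+ 2 - (rho / 2) ^+ 2.
    rewrite -hw nrmB !nrm_sqrD rmorphN mulrN rpartN nrmN; ring.
  rewrite h2 -!mulr2n.
  have e1 (a : C) : nrm (a *+ 2) ^+ 2 = 4 * nrm a ^+ 2.
    by rewrite mulr2n nrm_sqrD mulCconj rpart_toC; ring.
  rewrite !e1; move: h1; move: (nrm (k z1 + k w) ^+ 2) (nrm (k z1) ^+ 2) (nrm (k w) ^+ 2).
  move: (nrm z1 ^+ 2) (nrm w ^+ 2) ((rho / 2) ^+ 2) => x y u a b c.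
  nra.
Qed.

End Schwarz.

Section SchwarzLemma.
Variable R : realType.
Local Notation C := (Cplx R).
Implicit Types (h k : C -> C) (z w : C).

Lemma cdiff_near h k z d : 0 < d -> (forall w, nrm (w - z) < d -> k w = h w) ->
  cdiff h z -> cdiff k z.
Proof.
move=> d0 E [L hL]; exists L => e e0; have [d' d'0 hd'] := hL e e0.
exists (Num.min d d'); first by rewrite lt_min d0.
move=> w; rewrite lt_min => /andP[/E -> /hd']; rewrite E // subrr nrm0 //.
Qed.

Lemma schwarz_disc h z : (forall w, nrm w < 1 -> cdiff h w) -> h 0 = 0 ->
  (forall w, nrm w < 1 -> nrm (h w) <= 1) -> nrm z < 1 -> nrm (h z) <= nrm z.
Proof.
move=> dh h0 bh z1; have [->|z0] := eqVneq z 0; first by rewrite h0.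
have n01 : nrm (0 : C) < 1 by rewrite nrm0.
have [L hL] := dh 0 n01.
pose k w := if w == 0 then L else h w / w.
have kn w : w != 0 -> nrm (k w) = nrm (h w) / nrm w.
  by rewrite /k => /negPf ->; rewrite nrmM nrmV.
have dk w : w != 0 -> nrm w < 1 -> cdiff k w.
  move=> w0 w1; have wp : 0 < nrm w by rewrite nrm_gt0.
  apply: (@cdiff_near (fun u => h u * u^-1) k w (nrm w)) => // [u hu|].
    rewrite /k; case: eqP => // u0; move: hu; rewrite u0 sub0r nrmN ltxx //.
  apply/cdiffP; apply: derivableM; first exact/cdiffP/dh.
  by apply: derivableV => //; exact: derivable_id.
have ck w : nrm w < 1 -> ccont k w.
  move=> w1; have [->|w0] := eqVneq w 0; last exact/cdiff_ccont/dk.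
  move=> e e0; have [d d0 hd] := hL (e / 2) (divr_gt0 e0 (ltr0Sn _ 1)).
  exists d => // u; have -> : k 0 = L by rewrite /k eqxx.
  rewrite /=; have [->|u0] := eqVneq u 0.
    by have -> : k 0 = L; rewrite ?subrr ?nrm0 // /k eqxx.
  move=> /hd; rewrite h0 !subr0 => hu.
  have up : 0 < nrm u by rewrite nrm_gt0.
  have -> : k u - L = (h u - L * u) / u.
    by rewrite /k (negPf u0) mulrBl mulfK.
  rewrite nrmM nrmV ltr_pdivrMr //; apply: le_lt_trans hu _.
  by rewrite ltr_pM2r //; lra.
have zp : 0 < nrm z by rewrite nrm_gt0.
have kz : forall r, nrm z < r -> r < 1 -> nrm (h z) * r <= nrm z.
  move=> r zr r1; have r0 := lt_trans zp zr.
  suff : nrm (k z) <= r^-1 by rewrite kn // ler_pdivrMr // [r^-1 * _]mulrC ler_pdivlMr.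
  apply: (@max_principle R k r (r^-1) z r0 r1 _ dk _ _ (ltW zr)).
  - by move=> w wr; apply: ck; exact: le_lt_trans r1.
  - move=> w wr; have w0 : w != 0 by rewrite -nrm_gt0 wr.
    by rewrite kn // wr ler_piMl ?invr_ge0 ?(ltW r0) // bh // wr.
  - by rewrite invr_ge0 ltW.
rewrite leNgt; apply/negP => hlt.
have hp : 0 < nrm (h z) := lt_trans zp hlt.
pose r := (nrm z / nrm (h z) + 1) / 2.
have q1 : nrm z / nrm (h z) < 1 by rewrite ltr_pdivrMr // mul1r.
pose r' := Num.max r ((nrm z + 1) / 2).
have r'1 : r' < 1 by rewrite gt_max /r; apply/andP; split; lra.
have zr' : nrm z < r' by rewrite lt_max; apply/orP; right; lra.
have := kz r' zr' r'1.
have : r * nrm (h z) <= r' * nrm (h z) by rewrite ler_pM2r // le_max lexx.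
have : nrm z < r * nrm (h z) by rewrite -ltr_pdivrMr // /r; lra.
lra.
Qed.

(** Restriction to the line through [z] and pairing with the direction of [chi z] reduce this to
    [schwarz_disc]; by Cauchy-Schwarz the scalar function is bounded by 1. *)
Lemma schwarz_ball n m (chi : 'cV[C]_n -> 'cV[C]_m) (z : 'cV[C]_n) : maps_ball chi ->
  holomorphic_on_ball chi -> chi 0 = 0 -> nsq z < 1 -> nsq (chi z) <= nsq z.
Proof.
move=> mc hc c0 z1; have [z0|z0] := eqVneq (nsq z) 0.
  by rewrite (nsq_eq0 z0) c0 !nsq0.
have zp : 0 < nsq z by rewrite lt_def z0 nsq_ge0.
have [w0|w0] := eqVneq (nsq (chi z)) 0; first by rewrite w0 ltW.
have wp : 0 < nsq (chi z) by rewrite lt_def w0 nsq_ge0.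
pose s := Num.sqrt (nsq z); pose t := Num.sqrt (nsq (chi z)).
have sp : 0 < s by rewrite sqrtr_gt0. have tp : 0 < t by rewrite sqrtr_gt0.
have s2 : s ^+ 2 = nsq z by rewrite sqr_sqrtr ?nsq_ge0.
have t2 : t ^+ 2 = nsq (chi z) by rewrite sqr_sqrtr ?nsq_ge0.
have sC : toC s != 0 by rewrite toC_eq0 gt_eqF.
pose v := (toC s)^-1 *: z.
have v1 : nsq v = 1.
  by rewrite nsqZ nrmV nrm_toC gtr0_norm // -s2 -exprMn mulVf ?expr1n ?gt_eqF.
pose h (zeta : C) : C := dot (chi (zeta *: v)) (chi z) * toC t^-1.
have in_ball zeta : nrm zeta < 1 -> unit_ball (zeta *: v).
  by move=> zz; apply/unit_ballE; rewrite nsqZ v1 mulr1 expr_lt1 // nrm_ge0.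
have bh zeta : nrm zeta < 1 -> nrm (h zeta) <= 1.
  move=> zz; rewrite -(@ler_pXn2r _ 2) ?nnegrE ?nrm_ge0 // expr1n.
  rewrite /h nrmM exprMn nrm_toC ger0_norm ?invr_ge0 ?(ltW tp) // exprVn t2.
  rewrite ler_pdivrMr // mul1r; apply: le_trans (cauchy_schwarz _ _) _.
  by rewrite ger_pMl //; have /mc/unit_ballE/ltW := in_ball _ zz.
have dh zeta : nrm zeta < 1 -> cdiff h zeta.
  move=> zz; apply/cdiffP/derivable1_diffP.
  have -> : h = fun zeta => \sum_(i < m) (fun i (u : C) => chi (u *: v) i ord0 *
       (((chi z i ord0)^*) * toC t^-1)) i zeta.
    apply/funext => u; rewrite /h /dot mulr_suml; apply: eq_bigr => i _ /=.
    by rewrite mulrA.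
  rewrite -fct_sumE; apply: differentiable_sum => i.
  apply: differentiableM; last exact: differentiable_cst.
  have h1 : differentiable (fun u : C => u *: v) zeta.
    by apply: differentiableZl; exact: ex_diff.
  have h2 : differentiable (fun u : C => chi (u *: v)) zeta.
    exact: (differentiable_comp h1 (hc _ (in_ball _ zz))).
  exact: (differentiable_comp h2 (differentiable_coord _ _ _)).
have h0 : h 0 = 0 by rewrite /h scale0r c0 dot0l mul0r.
have s1 : nrm (toC s) < 1.
  rewrite nrm_toC gtr0_norm // -(@ltr_pXn2r _ 2) ?nnegrE ?ltW // s2 expr1n //.
have := schwarz_disc dh h0 bh s1.
rewrite /h /v scalerA divff // scale1r dotzz -rmorphM !nrm_toC (gtr0_norm sp) -t2.
rewrite expr2 mulfK ?gt_eqF // gtr0_norm // => ts.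
by rewrite -s2 expr2 ler_pM ?(ltW tp).
Qed.

End SchwarzLemma.

(** * Automorphisms of the ball *)

Section UnitaryMatrices.
Variable R : realType.
Local Notation C := (Cplx R).

Lemma col_linear_mx n m (f : 'cV[C]_n -> 'cV[C]_m) :
  (forall u v, f (u + v) = f u + f v) -> (forall a u, f (a *: u) = a *: f u) ->
  forall v, (\matrix_(i, j) f (delta_mx j ord0) i ord0) *m v = f v.
Proof.
move=> fD fZ v.
have f0 : f 0 = 0 by rewrite -(scale0r (0 : 'cV[C]_n)) fZ scale0r.
have -> : v = \sum_j v j ord0 *: delta_mx j ord0.
  apply/colP => i; rewrite summxE (bigD1 i) //= big1 => [|j ji].
    by rewrite !mxE !eqxx mulr1 addr0.
  by rewrite !mxE eq_sym (negPf ji) mulr0.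
rewrite (big_morph f fD f0) mulmx_sumr; apply: eq_bigr => j _.
rewrite fZ -scalemxAr; congr (_ *: _); apply/colP => i; rewrite mxE (bigD1 j) //= big1.
  by rewrite !mxE !eqxx mulr1 addr0.
by move=> k kj; rewrite !mxE (negPf kj) mulr0.
Qed.

Lemma nsq_pres_dot n m (U : 'M[C]_(m, n)) : (forall v, nsq (U *m v) = nsq v) ->
  forall v w, dot (U *m v) (U *m w) = dot v w.
Proof.
move=> hU v w.
have hr a b : rpart (dot (U *m a) (U *m b)) = rpart (dot a b).
  have := hU (a + b); rewrite mulmxDr !nsqD !hU; lra.
apply: complex_eqP; first exact: hr.
have := hr v (imC *: w); rewrite -scalemxAr !dotZr conj_imC !partE; lra.
Qed.

Lemma dot_deltar n (v : 'cV[C]_n) j : dot v (delta_mx j ord0) = v j ord0.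
Proof.
rewrite /dot (bigD1 j) //= big1 => [|k kj]; first by rewrite mxE !eqxx rmorph1 mulr1 addr0.
by rewrite mxE (negPf kj) rmorph0 mulr0.
Qed.

Lemma mul_delta_col n m (U : 'M[C]_(m, n)) j i :
  (U *m delta_mx j (ord0 : 'I_1)) i ord0 = U i j.
Proof.
rewrite mxE (bigD1 j) //= big1 => [|k kj]; first by rewrite mxE !eqxx mulr1 addr0.
by rewrite mxE (negPf kj) mulr0.
Qed.

Lemma isometry_adjoint n m (U : 'M[C]_(m, n)) : (forall v, nsq (U *m v) = nsq v) ->
  (map_mx Num.conj U^T) *m U = 1%:M.
Proof.
move=> hU; apply/matrixP => j k.
have := nsq_pres_dot hU (delta_mx k ord0) (delta_mx j ord0).
rewrite dot_deltar !mxE !eqxx andbT => <-; apply: eq_bigr => i _.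
by rewrite !mul_delta_col !mxE mulrC.
Qed.

Lemma isometry_unitary n (U : 'M[C]_n) : (forall v, nsq (U *m v) = nsq v) ->
  U \is unitarymx.
Proof.
move=> /isometry_adjoint/mulmx1C h; apply/unitarymxP; rewrite -[RHS]h.
by congr (_ *m _); apply/matrixP => i j; rewrite !mxE.
Qed.

Lemma nsq_unitary n (U : 'M[C]_n) v : U \is unitarymx -> nsq (U *m v) = nsq v.
Proof.
move=> /unitarymxP /mulmx1C hU; apply: toC_inj; rewrite -!dotzz.
have E (w : 'cV[C]_n) : dot w w = ((map_mx Num.conj w^T) *m w) ord0 ord0.
  by rewrite /dot mxE; apply: eq_bigr => i _; rewrite !mxE mulrC.
have {}hU : map_mx Num.conj U^T *m U = 1%:M.
  by rewrite -[RHS]hU; congr (_ *m _); apply/matrixP => i j; rewrite !mxE.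
by rewrite !E trmx_mul map_mxM -mulmxA [(map_mx _ U^T) *m (U *m v)]mulmxA hU mul1mx.
Qed.

End UnitaryMatrices.

Section PseudoUnitary.
Variable R : realType.
Local Notation C := (Cplx R).

Lemma row'D n (v w : 'cV[C]_n.+1) : row' ord0 (v + w) = row' ord0 v + row' ord0 w.
Proof. by apply/colP => i; rewrite !mxE. Qed.

Definition consv n (a : C) (w : 'cV[C]_n) : 'cV[C]_n.+1 :=
  \col_i oapp (fun j => w j ord0) a (unlift ord0 i).
Lemma consv0 n a (w : 'cV[C]_n) : consv a w ord0 ord0 = a.
Proof. by rewrite mxE unlift_none. Qed.
Lemma row'_consv n a (w : 'cV[C]_n) : row' ord0 (consv a w) = w.
Proof. by apply/colP => i; rewrite !mxE liftK. Qed.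

(** A kernel vector u is null for the form, and so is its reflection w = (u_0, -u'). Since M (w + u)
    = M w, the vector w + u = (2 u_0, 0) is null too, so u_0 = 0 and then u = 0. *)
Lemma qf_pres_pseudo_unitary n (M : 'M[C]_n.+1) :
  (forall v, qf (M *m v) = qf v) -> pseudo_unitary M.
Proof.
move=> hM; split=> //; rewrite -unitmx_tr -row_free_unit -kermx_eq0; apply/eqP/row_matrixP => i.
rewrite row0; set u := row i _.
have uM : M *m u^T = 0.
  by rewrite -[M]trmxK -trmx_mul -row_mul mulmx_ker row0 trmx0.
have q0 : qf u^T = 0.
  by rewrite -hM uM /qf [X in nrm X]mxE nrm0 expr0n sub0r (_ : row' _ _ = 0) ?nsq0 ?oppr0 //;
    apply/colP => j; rewrite !mxE.
pose w := consv (u^T ord0 ord0) (- row' ord0 u^T).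
have qw : qf w = 0 by rewrite -q0 /qf consv0 row'_consv nsqN.
have := hM (w + u^T); rewrite mulmxDr uM addr0 hM qw /qf row'D row'_consv addNr nsq0.
rewrite [X in nrm X]mxE consv0 -mulr2n => /esym/eqP; rewrite subr0 sqrf_eq0 nrm_eq0 mulrn_eq0 /= => /eqP u0.
have : nsq (row' ord0 u^T) = 0 by have := q0; rewrite /qf u0 nrm0 expr0n /=; lra.
move=> /nsq_eq0 u'0; apply: trmx_inj; rewrite trmx0; apply: col_homvP; first by rewrite u0 mxE.
by rewrite u'0; apply/colP => j; rewrite !mxE.
Qed.

Lemma unitary_pseudo_unitary n (U : 'M[C]_n) : U \is unitarymx ->
  exists M : 'M[C]_n.+1, pseudo_unitary M /\ forall z, den M z = 1 /\ act M z = U *m z.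
Proof.
move=> uU; pose f (v : 'cV[C]_n.+1) := consv (v ord0 ord0) (U *m row' ord0 v).
have fE := @col_linear_mx R _ _ f; set M := \matrix_(i, j) _ in fE.
have {}fE v : M *m v = f v.
  apply: fE => [u w|a u]; apply: col_homvP; rewrite ?consv0 ?row'_consv.
  - by rewrite [RHS]mxE !consv0 mxE.
  - by rewrite !row'D !row'_consv mulmxDr.
  - by rewrite [RHS]mxE !consv0 mxE.
  - by rewrite !row'Z !row'_consv scalemxAr.
exists M; split.
  by apply: qf_pres_pseudo_unitary => v; rewrite fE /qf consv0 row'_consv nsq_unitary.
move=> z; apply: homv_eq_act; first exact: oner_neq0.
by rewrite fE scale1r; apply: col_homvP; rewrite ?consv0 ?homv0 ?row'_consv ?row'_homv.
Qed.

(** A Lorentz boost, with [g] the usual gamma factor. The constant k = g^2 / (g + 1) is the solution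
    of k |b|^2 = g - 1, which gives a formula free of division by |b|^2 and valid at b = 0. *)
Lemma boost_exists n (b : 'cV[C]_n) : nsq b < 1 ->
  exists M : 'M[C]_n.+1, [/\ pseudo_unitary M, act M b = 0 &
    forall a, nrm (den M a) ^+ 2 = nrm (1 - dot a b) ^+ 2 / (1 - nsq b)].
Proof.
move=> b1; pose A := nsq b; have A1 : 0 < 1 - A by rewrite subr_gt0.
pose g := Num.sqrt (1 - A)^-1.
have g0 : 0 < g by rewrite sqrtr_gt0 invr_gt0.
have g2 : g ^+ 2 = (1 - A)^-1 by rewrite sqr_sqrtr // invr_ge0 ltW.
have gA : g ^+ 2 * A = g ^+ 2 - 1.
  have : g ^+ 2 * (1 - A) = 1 by rewrite g2 mulVf // gt_eqF.
  lra.
have g1 : g + 1 != 0 by rewrite gt_eqF //; lra.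
have [k kE] : exists k : R, k * (g + 1) = g ^+ 2 by exists (g ^+ 2 / (g + 1)); rewrite divfK.
have kA : k * A = g - 1.
  by apply: (mulIf g1); rewrite mulrAC kE gA; ring.
pose s (v : 'cV[C]_n.+1) := dot (row' ord0 v) b.
pose f (v : 'cV[C]_n.+1) := consv (toC g * (v ord0 ord0 - s v))
  (row' ord0 v - (toC g * v ord0 ord0 - toC k * s v) *: b).
have sD u v : s (u + v) = s u + s v by rewrite /s row'D dotDl.
have sZ c v : s (c *: v) = c * s v by rewrite /s row'Z dotZl.
have fE := @col_linear_mx R _ _ f; set M := \matrix_(i, j) _ in fE.
have {}fE v : M *m v = f v.
  apply: fE => [u w|c u]; apply: col_homvP.
  - by rewrite consv0 [RHS]mxE !consv0 sD mxE; ring.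
  - rewrite row'D !row'_consv row'D sD [(u + w) _ _]mxE; apply/colP => i; rewrite !mxE; ring.
  - by rewrite consv0 [RHS]mxE !consv0 sZ mxE; ring.
  - rewrite row'Z !row'_consv row'Z sZ [(c *: u) _ _]mxE; apply/colP => i; rewrite !mxE; ring.
exists M; split.
- apply: qf_pres_pseudo_unitary => v; rewrite fE /qf consv0 row'_consv.
  set x := v ord0 ord0; set t := s v.
  rewrite nsqD nsqN nsqZ dotNr dotZr -/(s v) -/t -/A nrmM nrm_toC (gtr0_norm g0).
  rewrite !exprMn !nrm_sqr !partE.
  move: (rpart x) (ipart x) (rpart t) (ipart t) (nsq _) => x1 x2 t1 t2 B.
  have e1 : (g * x1 - k * t1) ^+ 2 * A = (g ^+ 2 * A) * x1 ^+ 2 - 2 * g * (k * A) * x1 * t1 + k * (k * A) * t1 ^+ 2.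
    ring.
  have e2 : (g * x2 - k * t2) ^+ 2 * A = (g ^+ 2 * A) * x2 ^+ 2 - 2 * g * (k * A) * x2 * t2 + k * (k * A) * t2 ^+ 2.
    ring.
  have kE' : k * g = g ^+ 2 - k by rewrite -kE; ring.
  transitivity (x1 ^+ 2 + x2 ^+ 2 - B + (g ^+ 2 - 1 - g ^+ 2 * A) * (x1 ^+ 2 + x2 ^+ 2)
    + 2 * g * (k * A - (g - 1)) * (x1 * t1 + x2 * t2)
    + (g ^+ 2 - 2 * k - k * (k * A)) * (t1 ^+ 2 + t2 ^+ 2)); first by ring.
  rewrite kA gA (_ : g ^+ 2 - 2 * k - k * (g - 1) = 0); first by ring.
  by rewrite mulrBr kE'; ring.
- have E : M *m homv b = toC (g * (1 - A)) *: homv 0.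
    rewrite fE; apply: col_homvP.
      rewrite consv0 [RHS]mxE !homv0 /s row'_homv dotzz -/A mulr1 rmorphM rmorphB rmorph1 //.
    rewrite row'_consv row'Z !row'_homv scaler0 homv0 /s row'_homv dotzz -/A mulr1.
    rewrite -rmorphM kA -rmorphB /= (_ : g - (g - 1) = 1); last by ring.
    by rewrite rmorph1 scale1r subrr.
  have nz : toC (g * (1 - A)) != 0 by rewrite toC_eq0 mulf_neq0 ?gt_eqF.
  by have [_ ->] := homv_eq_act nz E.
- move=> a; rewrite /den fE consv0 /s row'_homv homv0 nrmM nrm_toC (gtr0_norm g0) exprMn g2.
  by rewrite mulrC.
Qed.

Lemma act_differentiable n (M : 'M[C]_n.+1) z : den M z != 0 -> differentiable (act M) z.
Proof.
move=> d0.
pose c j : 'cV[C]_n := row' ord0 (col j M).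
have crd (j : 'I_n) (w : 'cV[C]_n) : differentiable (fun w : 'cV[C]_n => w j ord0) w.
  exact: differentiable_coord.
have dlin (a : 'I_n -> C) : differentiable (fun w : 'cV[C]_n => \sum_j (fun j (w : 'cV[C]_n) => w j ord0 * a j) j w) z.
  rewrite -fct_sumE; apply: differentiable_sum => j.
  by apply: differentiableM => //; exact: differentiable_cst.
have dden : differentiable (den M) z.
  have -> : den M = (fun w : 'cV[C]_n => M ord0 ord0 + \sum_j w j ord0 * M ord0 (lift ord0 j)).
    apply/funext => w; rewrite /den mxE big_ord_recl homv0 mulr1; congr (_ + _).
    by apply: eq_bigr => j _; rewrite homvS mulrC.
  by apply: differentiableD => //; exact: dlin.
have dinv : differentiable (fun w => (den M w)^-1) z by apply: differentiableV.
have -> : act M = (fun w => (den M w)^-1 *: c ord0 +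
    \sum_j (fun j (w : 'cV[C]_n) => ((den M w)^-1 * w j ord0) *: c (lift ord0 j)) j w).
  apply/funext => w; rewrite /act.
  have -> : row' ord0 (M *m homv w) = c ord0 + \sum_j w j ord0 *: c (lift ord0 j).
    apply/colP => i; rewrite [LHS]mxE mxE big_ord_recl homv0 mulr1 [RHS]mxE summxE.
    rewrite 2!mxE; congr (_ + _); apply: eq_bigr => j _.
    by rewrite homvS !mxE mulrC.
  rewrite scalerDr scaler_sumr; congr (_ + _); apply: eq_bigr => j _.
  by rewrite scalerA.
apply: differentiableD; first exact: differentiableZl.
rewrite -fct_sumE; apply: differentiable_sum => j; apply: differentiableZl.
by apply: differentiableM.
Qed.

Lemma act_automorphism n (M : 'M[C]_n.+1) : pseudo_unitary M -> ball_automorphism (act M).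
Proof.
move=> pM; have pM' := pseudo_unitary_inv pM.
have hol M' : pseudo_unitary M' -> holomorphic_on_ball (@act R n M').
  by move=> p z /unit_ballE/ltW z1; apply: act_differentiable; exact: den_neq0.
split; [by move=> z; exact: act_ball|exact: hol|].
exists (act (invmx M)); split; [by move=> z; exact: act_ball|exact: hol| |].
- by move=> z; exact: actK.
- by move=> z; exact: actVK.
Qed.

Lemma automorphism_comp n (f g : 'cV[C]_n -> 'cV[C]_n) :
  ball_automorphism f -> ball_automorphism g -> ball_automorphism (f \o g).
Proof.
move=> [mf hf [f' [mf' hf' fK f'K]]] [mg hg [g' [mg' hg' gK g'K]]].
split; first by move=> z /mg/mf.
  by move=> z zb; apply: differentiable_comp; [exact: hg|exact/hf/mg].
exists (g' \o f'); split.
- by move=> z /mf'/mg'.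
- by move=> z zb; apply: differentiable_comp; [exact: hf'|exact/hg'/mf'].
- by move=> z zb /=; rewrite fK ?gK //; exact: mg.
- by move=> z zb /=; rewrite g'K ?f'K //; exact: mf'.
Qed.

Lemma automorphism_fix0_nsq n (psi : 'cV[C]_n -> 'cV[C]_n) z :
  ball_automorphism psi -> psi 0 = 0 -> nsq z < 1 -> nsq (psi z) = nsq z.
Proof.
move=> [mp hp [phi [mq hq pK qK]]] p0 z1.
have q0 : phi 0 = 0 by rewrite -[in LHS]p0 pK //; exact: unit_ball0.
apply: le_anti; rewrite (schwarz_ball mp hp p0 z1) /=.
have /mp/unit_ballE p1 : unit_ball z by apply/unit_ballE.
rewrite -[in X in X <= _](pK z); last exact/unit_ballE.
exact: schwarz_ball.
Qed.

(** Schwarz' lemma based at v, by boosts on both sides, gives |1 - <psi(tv), psi(v)>| <= 1 - t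
    |v|^2, hence Re <psi(tv), psi(v)> >= t |v|^2. As [psi] preserves norms, expanding |psi(tv) - t
    psi(v)|^2 shows that it is at most 0. *)
Lemma automorphism_fix0_homog n (psi : 'cV[C]_n -> 'cV[C]_n) v t :
  ball_automorphism psi -> psi 0 = 0 -> nsq v < 1 -> 0 < t -> t < 1 ->
  psi (toC t *: v) = toC t *: psi v.
Proof.
move=> ap p0 v1 t0 t1; have [mp hp _] := ap.
have nP := automorphism_fix0_nsq ap p0.
have nt : nsq (toC t *: v) = t ^+ 2 * nsq v by rewrite nsqZ nrm_toC gtr0_norm.
have nv0 := nsq_ge0 v.
have tv1 : nsq (toC t *: v) < 1 by rewrite nt; nra.
have pv1 : nsq (psi v) < 1 by rewrite nP.
have [L [pL Lv dL]] := boost_exists v1.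
have [L' [pL' Lpv dL']] := boost_exists pv1.
pose chi := act L' \o (psi \o act (invmx L)).
have vb : unit_ball v by apply/unit_ballE.
have act0 : act (invmx L) 0 = v by rewrite -Lv actK.
have [mc hc _] : ball_automorphism chi.
  apply: automorphism_comp; first exact: act_automorphism.
  by apply: automorphism_comp => //; apply: act_automorphism; exact: pseudo_unitary_inv.
have c0 : chi 0 = 0 by rewrite /chi /= act0 Lpv.
have tvb : unit_ball (toC t *: v) by apply/unit_ballE.
have /unit_ballE aL := act_ball pL tvb.
have := schwarz_ball mc hc c0 aL; rewrite /chi /= actK //.
have := nsq_act pL (ltW tv1); rewrite dL.
have ptv : nsq (psi (toC t *: v)) <= 1 by rewrite nP // ltW.
have oneB (x : R) : (1 : C) - toC x = toC (1 - x) by rewrite rmorphB rmorph1.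
have := nsq_act pL' ptv; rewrite dL' !nP // dotZl dotzz -rmorphM oneB nrm_toC.
set w := dot _ _; set P := nsq (act L' _); set P0 := nsq (act L _) => e2 e1 leP.
have d0 : 0 < 1 - nsq v by lra.
have tv : t * nsq v < 1 by nra.
have le1 : nrm (1 - w) <= 1 - t * nsq v.
  have nw : 0 < 1 - nsq (toC t *: v) by lra.
  move: e1 e2; rewrite gtr0_norm; last by lra.
  have P01 : 0 < 1 - P0 by move/unit_ballE: (act_ball pL tvb); rewrite -/P0; lra.
  move=> e1 e2.
  have {}e1 : (1 - nsq (toC t *: v)) * (1 - nsq v) = (1 - t * nsq v) ^+ 2 * (1 - P0).
    by rewrite e1; field; rewrite gt_eqF.
  have {}e2 : (1 - nsq (toC t *: v)) * (1 - nsq v) = nrm (1 - w) ^+ 2 * (1 - P).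
    by rewrite e2; field; rewrite gt_eqF.
  have le2 : nrm (1 - w) ^+ 2 * (1 - P0) <= (1 - t * nsq v) ^+ 2 * (1 - P0).
    rewrite -e1 e2; apply: ler_wpM2l; [exact: sqr_ge0|lra].
  by move: le2; rewrite ler_pM2r // ler_pXn2r ?nnegrE ?nrm_ge0 //; lra.
have re : t * nsq v <= rpart w.
  have := rpart_le (1 - w); rewrite !partE ler_norml => /andP[_ h]; lra.
apply/eqP; rewrite -subr_eq0; apply/eqP/nsq_eq0/le_anti; rewrite nsq_ge0 andbT.
rewrite nsqD nsqN dotNr dotZr conj_toC !partE /= -/w nP // !nsqZ nrm_toC gtr0_norm // nP //; nra.
Qed.

(** By the homogeneity just proved, the difference quotients at 0 in direction v along small
    positive t are all equal to psi(v), so [psi] agrees on the ball with its differential at 0. *)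
Lemma automorphism_fix0 n (psi : 'cV[C]_n -> 'cV[C]_n) :
  ball_automorphism psi -> psi 0 = 0 ->
  exists2 U : 'M[C]_n, U \is unitarymx & forall z, unit_ball z -> psi z = U *m z.
Proof.
move=> ap p0; have [mp hp _] := ap.
have dp : differentiable psi 0 by apply: hp; exact: unit_ball0.
have Dv v : unit_ball v -> 'd psi 0 v = psi v.
  move=> vb; have /unit_ballE v1 := vb.
  rewrite -deriveE //.
  have : (fun h : C => h^-1 *: ((psi \o shift 0) (h *: v) - psi 0)) @ 0^' --> 'D_v psi 0.
    exact: (diff_derivable dp).
  set L := 'D_v psi 0 => hL.
  apply/esym/eqP; rewrite -subr_eq0; apply/eqP/nsq_eq0/le_anti; rewrite nsq_ge0 andbT.
  rewrite leNgt; apply/negP => eps0.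
  have : nbhs L [set w | nsq (w - L) < nsq (psi v - L)].
    by apply/nbhs_nsqP; exists (nsq (psi v - L)).
  move=> /hL /nbhs_nrmP[d d0 /= hd].
  pose t := Num.min (d / 2) (1 / 2).
  have t0 : 0 < t by rewrite lt_min !divr_gt0.
  have t1 : t < 1 by rewrite gt_min; apply/orP; right; lra.
  have td : t < d by rewrite gt_min; apply/orP; left; lra.
  have tC : toC t != 0 by rewrite toC_eq0 gt_eqF.
  have := hd (toC t); rewrite subr0 nrm_toC gtr0_norm // => /(_ td tC).
  rewrite addr0 p0 subr0 (automorphism_fix0_homog ap p0) // scalerA mulVf // scale1r.
  by rewrite ltxx.
pose U : 'M[C]_n := \matrix_(i, j) ('d psi 0 (delta_mx j ord0)) i ord0.
have UE v : U *m v = 'd psi 0 v.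
  by apply: col_linear_mx => [u w|a u]; rewrite ?linearD ?linearZ.
exists U; last by move=> z zb; rewrite UE Dv.
apply: isometry_unitary => v.
pose e := (1 + nsq v)^-1; have e0 : 0 < e by rewrite invr_gt0 ltr_pwDl ?nsq_ge0.
have ev : unit_ball (toC e *: v).
  apply/unit_ballE; rewrite nsqZ nrm_toC gtr0_norm // /e expr2 -mulrA.
  rewrite ltr_pdivrMl ?ltr_pwDl ?nsq_ge0 // mulr1 ltr_pdivrMl ?ltr_pwDl ?nsq_ge0 //.
  have := nsq_ge0 v; nra.
have := Dv _ ev; rewrite -UE -scalemxAr => /(congr1 (@nsq R n)).
rewrite (automorphism_fix0_nsq ap p0); last exact/unit_ballE.
rewrite !nsqZ => /mulfI; apply; rewrite expf_neq0 // nrm_eq0 toC_eq0 gt_eqF //.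
Qed.

(** A boost sending [psi 0] to 0 leaves a unitary map. *)
Lemma automorphism_act n (psi : 'cV[C]_n -> 'cV[C]_n) : ball_automorphism psi ->
  exists2 M : 'M[C]_n.+1, pseudo_unitary M & forall z, unit_ball z -> psi z = act M z.
Proof.
move=> ap; have [mp _ _] := ap.
have /mp p0b := unit_ball0 R n; have /unit_ballE p01 := p0b.
have [L [pL L0 _]] := boost_exists p01.
have [|U uU hU] := @automorphism_fix0 n (act L \o psi) _ L0.
  by apply: automorphism_comp => //; exact: act_automorphism.
have [B [pB hB]] := unitary_pseudo_unitary uU.
have pL' := pseudo_unitary_inv pL.
exists (invmx L *m B); first exact: pseudo_unitary_mul.
move=> z zb; have [_ ->] := act_comp pL' pB zb.
by have [_ ->] := hB z; rewrite -hU //= actK //; exact: mp.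
Qed.

End PseudoUnitary.

(** * Numerator and denominator as a vector *)

Section PolyContinuity.
Variable R : realType.
Local Notation C := (Cplx R).

Lemma cdiff_horner (p : {poly C}) z : cdiff (fun w => p.[w]) z.
Proof.
apply/cdiffP; elim/poly_ind: p => [|p c IH].
  by under eq_fun do rewrite horner0; exact: derivable_cst.
under eq_fun do rewrite hornerMXaddC.
apply: derivableD; last exact: derivable_cst.
by apply: derivableM; [exact: IH|exact: derivable_id].
Qed.

Lemma horner_ccont (p : {poly C}) z : ccont (fun w => p.[w]) z.
Proof. exact/cdiff_ccont/cdiff_horner. Qed.

(** On the real axis |p|^2 is the polynomial [p * conjp p]; this turns identities between squared
    norms into identities of polynomials. *)
Definition conjp (p : {poly C}) : {poly C} := map_poly (@Num.conj C) p.

Lemma conjp_real (p : {poly C}) (r : R) : (conjp p).[toC r] = (p.[toC r])^*.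
Proof. by rewrite /conjp -horner_map /= conj_toC. Qed.

Lemma nrm_horner_real (p : {poly C}) (r : R) :
  (p * conjp p).[toC r] = toC (nrm p.[toC r] ^+ 2).
Proof. by rewrite hornerM conjp_real mulCconj. Qed.

End PolyContinuity.

Section PolyVectors.
Variables (R : realType) (n N : nat).
Local Notation C := (Cplx R).
Implicit Types (V : 'I_N.+1 -> cpoly R n) (z : 'cV[C]_n).

Definition vecp (P : 'I_N -> cpoly R n) (G : cpoly R n) : 'I_N.+1 -> cpoly R n :=
  fun i => oapp P G (unlift ord0 i).
Definition pv V z : 'cV[C]_N.+1 := \col_i peval (V i) z.

(** The algebraic trace of properness. Stated on the vector, the boundary condition makes sense even
    where the denominator vanishes, which is excluded only by [ball_vector_sphere_neq0]. *)
Definition ball_vector V := (forall z, nsq z < 1 -> 0 < qf (pv V z)) /\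
  (forall z, nsq z = 1 -> qf (pv V z) = 0).

(** The common factor is sought symmetrically among all entries, since matrices mix numerators and
    denominator. *)
Definition vlowest V := V ord0 != 0 /\
  forall h, (forall i, pdvd h (V i)) -> pdeg h = 0%N.

Definition vdeg d V := (forall i, (msize (V i) <= d.+1)%N) /\
  exists i, (d < msize (V i))%N.

Lemma vecp0 P G : vecp P G ord0 = G. Proof. by rewrite /vecp unlift_none. Qed.
Lemma vecpS P G i : vecp P G (lift ord0 i) = P i. Proof. by rewrite /vecp liftK. Qed.

Lemma ord0_or_lift m (i : 'I_m.+1) : i = ord0 \/ exists j, i = lift ord0 j.
Proof. by case: (unliftP ord0 i) => [j|] ->; [right; exists j|left]. Qed.

Lemma vlowestP V : vlowest V <-> lowest_terms (fun i => V (lift ord0 i)) (V ord0).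
Proof.
split=> -[V0 h]; split=> // q.
  by move=> q0 qS; apply: h => i; case: (ord0_or_lift i) => [->|[j ->]].
by move=> hq; apply: h.
Qed.

Lemma vdegP d V : V ord0 != 0 ->
  vdeg d V <-> fraction_deg (fun i => V (lift ord0 i)) (V ord0) = d.
Proof.
move=> V0; have s0 : (0 < msize (V ord0))%N by rewrite lt0n msize_poly_eq0.
split=> [[le [i lt]]|<-].
  apply/eqP; rewrite eqn_leq; apply/andP; split.
    rewrite geq_max; apply/andP; split; last by have := le ord0; rewrite /pdeg; lia.
    by apply/bigmax_leqP => j _; have := le (lift ord0 j); rewrite /pdeg; lia.
  rewrite leq_max; case: (ord0_or_lift i) lt => [->|[j ->]] lt.
    by apply/orP; right; rewrite /pdeg; lia.
  apply/orP; left; apply: leq_trans (leq_bigmax j); rewrite /pdeg; lia.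
split=> [i|].
  case: (ord0_or_lift i) => [->|[j ->]].
    apply: (@leq_trans (pdeg (V ord0)).+1); first by rewrite /pdeg; lia.
    by rewrite ltnS leq_maxr.
  apply: (@leq_trans (pdeg (V (lift ord0 j))).+1); first by rewrite /pdeg; lia.
  by rewrite ltnS leq_max (leq_bigmax j).
rewrite /fraction_deg; case: (leqP (pdeg (V ord0)) (\max_(i < N) pdeg (V (lift ord0 i)))) => [le|lt].
  case: N V V0 s0 le => [|N'] V V0 s0 le.
    by exists ord0; rewrite big_ord0.
  have N0 : (0 < #|'I_N'.+1|)%N by rewrite card_ord.
  have [j ->] := @bigop.eq_bigmax _ (fun i => pdeg (V (lift ord0 i))) N0.
  have [z|nz] := posnP (pdeg (V (lift ord0 j))); first by exists ord0; rewrite z.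
  by exists (lift ord0 j); move: nz; rewrite /pdeg; lia.
by exists ord0; rewrite /pdeg; lia.
Qed.

Lemma pv_neq0 V z : 0 < qf (pv V z) -> peval (V ord0) z != 0.
Proof.
rewrite /qf mxE => h; apply/eqP => E; move: h; rewrite E nrm0 expr0n /=.
by have := nsq_ge0 (row' ord0 (pv V z)); lra.
Qed.

Lemma is_fraction_pv (f : 'cV[C]_n -> 'cV[C]_N) V :
  is_fraction f (fun i => V (lift ord0 i)) (V ord0) <->
  forall z, nsq z < 1 -> peval (V ord0) z != 0 /\ pv V z = peval (V ord0) z *: homv (f z).
Proof.
split=> h z zb.
  have [g0 Ef] := h z (proj2 (unit_ballE z) zb); split=> //.
  apply: col_homvP; first by rewrite [RHS]mxE homv0 mulr1 mxE.
  rewrite row'Z row'_homv Ef; apply/colP => i; rewrite !mxE.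
  by rewrite mulrC divfK.
have /unit_ballE z1 := zb; have [g0 E] := h z z1; split=> //.
apply/colP => i; have /(congr1 (fun v : 'cV[C]_N.+1 => v (lift ord0 i) ord0)) := E.
by rewrite [LHS]mxE [RHS]mxE homvS => E'; rewrite mxE E' mulrC mulKf.
Qed.

Lemma vlowest_unique V V' (f : 'cV[C]_n -> 'cV[C]_N) : vlowest V -> vlowest V' ->
  is_fraction f (fun i => V (lift ord0 i)) (V ord0) ->
  is_fraction f (fun i => V' (lift ord0 i)) (V' ord0) ->
  exists2 c : C, c != 0 & forall i, V' i = c *: V i.
Proof.
move=> /vlowestP l /vlowestP l' hf hf'.
have [i|c [c0 e0 eS]] := lowest_terms_unique l l'.
  apply: mpoly_eq_ball => z zb; have [g0 E] := hf z zb; have [g0' E'] := hf' z zb.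
  have := E'; rewrite E => /colP/(_ i); rewrite !mxE => /eqP.
  by rewrite !pevalM eqr_div // => /eqP ->; rewrite mulrC.
by exists c => // i; case: (ord0_or_lift i) => [->|[j ->]].
Qed.

(** The action of [M] on the source and of [T] on the target, for vectors homogenized to degree [d];
    see [pv_tvec]. *)
Definition tvec d (T : 'M[C]_N.+1) (M : 'M[C]_n.+1) V : 'I_N.+1 -> cpoly R n :=
  fun i => \sum_j T i j *: ptransf d M (V j).

Lemma pv_tvec d T M V z : (forall i, (msize (V i) <= d.+1)%N) -> den M z != 0 ->
  pv (tvec d T M V) z = den M z ^+ d *: (T *m pv V (act M z)).
Proof.
move=> sV d0; apply/colP => i; rewrite !mxE peval_sum mulr_sumr; apply: eq_bigr => j _.
by rewrite pevalZ peval_ptransf // mxE mulrCA.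
Qed.

Lemma msize_tvec d T M V : (forall i, (msize (V i) <= d.+1)%N) ->
  forall i, (msize (tvec d T M V i) <= d.+1)%N.
Proof.
move=> sV i; apply: msize_sum_leq => j _.
by apply: leq_trans (msizeZ_le _ _) _; exact: msize_ptransf.
Qed.

Lemma nsq_act_le1 (M : 'M[C]_n.+1) z : pseudo_unitary M -> nsq z = 1 -> nsq (act M z) = 1.
Proof.
move=> pM z1; have z1' : nsq z <= 1 by rewrite z1.
have := nsq_act pM z1'; rewrite z1 subrr => /esym/eqP.
rewrite mulf_eq0 expf_eq0 /= nrm_eq0 (negPf (den_neq0 pM z1')) /= subr_eq0 => /eqP ->//.
Qed.

Lemma ball_vector_tvec d T M V : pseudo_unitary T -> pseudo_unitary M ->
  (forall i, (msize (V i) <= d.+1)%N) -> ball_vector V -> ball_vector (tvec d T M V).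
Proof.
move=> [_ qT] pM sV [b1 b2].
have E z : nsq z <= 1 -> qf (pv (tvec d T M V) z) = nrm (den M z ^+ d) ^+ 2 * qf (pv V (act M z)).
  by move=> z1; rewrite pv_tvec ?den_neq0 // qfZ qT.
split=> z hz.
  rewrite E ?ltW // mulr_gt0 //.
    by rewrite exprn_gt0 // nrm_gt0 expf_neq0 // den_neq0 // ltW.
  by apply: b1; apply/unit_ballE/act_ball => //; apply/unit_ballE.
by rewrite E ?hz // b2 ?mulr0 //; exact: nsq_act_le1.
Qed.

Lemma tvec_inv d T M V : T \in unitmx -> pseudo_unitary M ->
  (forall i, (msize (V i) <= d.+1)%N) ->
  tvec d (invmx T) (invmx M) (tvec d T M V) =1 V.
Proof.
move=> uT pM sV i; have pM' := pseudo_unitary_inv pM.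
apply: mpoly_eq_ball => z zb; have /unit_ballE/ltW z1 := zb.
have zb' := act_ball pM' zb; have /unit_ballE/ltW z1' := zb'.
have : pv (tvec d (invmx T) (invmx M) (tvec d T M V)) z = pv V z.
  rewrite pv_tvec ?den_neq0 //; last exact: msize_tvec.
  rewrite pv_tvec ?den_neq0 // -scalemxAr mulKmx // scalerA -exprMn.
  have [<- <-] := act_comp pM pM' zb.
  by have [uM _] := pM; rewrite mulmxV // act1 /den mul1mx homv0 expr1n scale1r.
by move=> /colP/(_ i); rewrite !mxE.
Qed.

(** If [V] is the transform of a vector with common factor [h], counted with degree [e], then the
    transform of [h] divides every entry of [V] and is constant by lowest terms; so the degree of
    [V] is at most [d - e], which is absurd. *)
Lemma tvec_factor d e T M V h : pseudo_unitary M -> (0 < e)%N -> (e <= d)%N ->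
  vlowest V -> vdeg d V -> (msize h <= e.+1)%N ->
  (exists k : 'I_N.+1 -> cpoly R n, forall i, V i = tvec d T M (fun i => h * k i) i /\
     (msize (k i) <= (d - e).+1)%N) -> False.
Proof.
move=> pM e0 ed [V0 lV] [sV [i0 di0]] sh [k hk].
have Ek i : ptransf d M (h * k i) = ptransf e M h * ptransf (d - e) M (k i).
  by rewrite -[in LHS](subnKC ed) ptransfM //; case: (hk i).
pose w i := \sum_j T i j *: ptransf (d - e) M (k j).
have EV i : V i = ptransf e M h * w i.
  have [-> _] := hk i; rewrite /tvec /w mulr_sumr; apply: eq_bigr => j _.
  by rewrite Ek scalerAr.
have sw i : (msize (w i) <= (d - e).+1)%N.
  by apply: msize_tvec => j; case: (hk j).
have p0 : pdeg (ptransf e M h) = 0%N by apply: lV => i; exists (w i); rewrite EV mulrC.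
have : (msize (V i0) <= (0 + (d - e)).+1)%N.
  by rewrite EV; apply: msizeM_leq => //; move: p0; rewrite /pdeg; lia.
by move: di0 e0 ed; lia.
Qed.

Lemma vlowest_tvec d T M V : T \in unitmx -> pseudo_unitary M ->
  vlowest V -> vdeg d V -> tvec d T M V ord0 != 0 ->
  vlowest (tvec d T M V) /\ vdeg d (tvec d T M V).
Proof.
move=> uT pM lV dV V'0; have [sV _] := dV; have pM' := pseudo_unitary_inv pM.
have iV := tvec_inv uT pM sV; set V' := tvec d T M V in V'0 iV *.
have sV' := @msize_tvec d T M V sV; rewrite -/V' in sV'.
split.
  split=> // h hdv; apply/eqP; rewrite -leqn0 leqNgt; apply/negP => e0.
  have [k hk] := choice hdv.
  have h0 : h != 0 by apply: contraNneq V'0 => h0; rewrite hk h0 mulr0.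
  have sh : msize h = (pdeg h).+1 by move: e0; rewrite /pdeg; lia.
  have sk i : k i != 0 -> (msize (k i) + pdeg h <= d.+1)%N.
    move=> k0; have := sV' i; rewrite hk msizeM // sh.
    by move: (msize (k i)) (pdeg h) => a b; lia.
  have ed : (pdeg h <= d)%N.
    have k0 : k ord0 != 0 by apply: contraNneq V'0 => k0; rewrite hk k0 mul0r.
    have := sk _ k0; have : (0 < msize (k ord0))%N by rewrite lt0n msize_poly_eq0.
    lia.
  apply: (@tvec_factor d (pdeg h) (invmx T) (invmx M) V h) => //; first by rewrite sh.
  exists k => i; split.
    by rewrite -iV /tvec; apply: eq_bigr => j _; rewrite [V' j]hk mulrC.
  have [->|k0] := eqVneq (k i) 0; first by rewrite msize0.
  by have := sk _ k0; lia.
split=> //; apply: contrapT => H.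
have sV2 i : (msize (V' i) <= d)%N.
  by rewrite leqNgt; apply/negP => h; apply: H; exists i.
have d0 : (0 < d)%N by apply: leq_trans (sV2 ord0); rewrite lt0n msize_poly_eq0.
(* A drop of degree is a common factor at infinity: [h = 1] counted with degree 1, whose transform
   is the denominator of the inverse map. *)
apply: (@tvec_factor d 1 (invmx T) (invmx M) V 1) => //; first by rewrite msize1.
exists V' => i; split; last by have := sV2 i; lia.
by rewrite -[LHS]iV /tvec; apply: eq_bigr => j _; rewrite mul1r.
Qed.

Lemma qf_line_poly V z : exists L : {poly C},
  forall r : R, L.[toC r] = toC (qf (pv V (toC r *: z))).
Proof.
pose A i := on_line 0 z (V i).
exists (A ord0 * conjp (A ord0) - \sum_(i < N) A (lift ord0 i) * conjp (A (lift ord0 i))) => r.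
have EA i : (A i).[toC r] = peval (V i) (toC r *: z) by rewrite on_lineE add0r.
rewrite hornerD hornerN horner_sum nrm_horner_real EA.
rewrite /qf rmorphB mxE /nsq rmorph_sum /=; congr (_ - _); apply: eq_bigr => i _.
by rewrite nrm_horner_real EA !mxE.
Qed.

(** Inside, the form equals |V_0|^2 (1 - |f|^2). Along the radius to a boundary point |f| tends to 1
    while V_0 stays bounded, so the form tends to 0; along that radius it is a polynomial, hence
    continuous. *)
Lemma proper_ball_vector (f : 'cV[C]_n -> 'cV[C]_N) V : proper_ball_map f ->
  is_fraction f (fun i => V (lift ord0 i)) (V ord0) -> ball_vector V.
Proof.
move=> [mf pf] /is_fraction_pv hf.
have qE z : nsq z < 1 -> qf (pv V z) = nrm (peval (V ord0) z) ^+ 2 * (1 - nsq (f z)).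
  by move=> z1; have [_ ->] := hf z z1; rewrite qfZ qf_homv.
split=> z hz.
  have [g0 _] := hf z hz; rewrite qE // mulr_gt0 ?exprn_gt0 ?nrm_gt0 // subr_gt0.
  by apply/unit_ballE/mf/unit_ballE.
apply/eqP/negPn/negP => c0; set c := qf _ in c0.
(* Properness: the preimage of |w|^2 <= 1 - delta is compact, hence closed, so it misses a
   neighbourhood of the boundary point [z]. *)
have near1 (delta : R) : 0 < delta -> exists2 d, 0 < d & forall r : R, 0 < r -> r < 1 -> 1 - r < d ->
    1 - delta < nsq (f (toC r *: z)).
  move=> d0; pose K := [set w : 'cV[C]_N | nsq w <= 1 - delta].
  have KB : K `<=` @unit_ball R N by move=> w hw; apply/unit_ballE; apply: le_lt_trans hw _; lra.
  have cS := pf K KB (@compact_nsq_le R N (1 - delta)).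
  have clS := compact_closed (@norm_hausdorff _ _) cS.
  have zS : (~` (@unit_ball R n `&` f @^-1` K)) z by move=> [/unit_ballE]; rewrite hz ltxx.
  have := open_nbhs_nbhs (conj (closed_openC clS) zS).
  move=> /nbhs_nsqP[e e0 he]; exists (Num.min 1 e); first by rewrite lt_min ltr01.
  move=> r r0 r1; rewrite lt_min => /andP[_ re].
  have rz1 : nsq (toC r *: z) < 1 by rewrite nsqZ hz mulr1 nrm_toC gtr0_norm //; nra.
  have := he (toC r *: z); rewrite -[X in _ - X](scale1r z) -scalerBl.
  rewrite -(rmorph1 (@toC R)) -rmorphB nsqZ hz mulr1 nrm_toC ltr0_norm ?subr_lt0 // opprB.
  have hee : (1 - r) ^+ 2 < e by nra.
  move=> /(_ hee) h; rewrite ltNge; apply/negP => hK.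
  apply: h; split; last exact: hK.
  exact/unit_ballE.
have [L hL] := qf_line_poly V z.
have hL1 : L.[1] = toC c by have := hL 1; rewrite rmorph1 scale1r.
pose A := on_line 0 z (V ord0).
have EA r : A.[r] = peval (V ord0) (r *: z) by rewrite on_lineE add0r.
pose K := (nrm A.[1] + 1) ^+ 2.
have a0 := nrm_ge0 A.[1].
have K0 : 0 < K by rewrite exprn_gt0 //; lra.
have c2 : 0 < `|c| / 2 by rewrite divr_gt0 // normr_gt0.
have cK : 0 < `|c| / (2 * K) by rewrite divr_gt0 ?normr_gt0 // mulr_gt0.
have [d1 d10 h1] := horner_ccont L 1 c2.
have [d2 d20 h2] := horner_ccont A 1 ltr01.
have [d3 d30 h3] := near1 _ cK.
pose e := Num.min (Num.min d1 d2) (Num.min d3 1) / 2.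
have m0 : 0 < Num.min (Num.min d1 d2) (Num.min d3 1) by rewrite !lt_min d10 d20 d30 ltr01.
have [e0 e1 e2 e3 e4] : [/\ 0 < e, e < d1, e < d2, e < d3 & e < 1].
  have : e < Num.min (Num.min d1 d2) (Num.min d3 1) by rewrite /e; lra.
  by rewrite !lt_min => /andP[/andP[? ?] /andP[? ?]]; split=> //; rewrite /e; lra.
pose r := 1 - e.
have re : nrm (toC r - 1) = e.
  by rewrite -(rmorph1 (@toC R)) -rmorphB nrm_toC /r (_ : 1 - e - 1 = - e) ?normrN ?gtr0_norm //; ring.
have r0 : 0 < r by rewrite /r; lra. have r1 : r < 1 by rewrite /r; lra.
have := h1 (toC r); rewrite re => /(_ e1); rewrite hL hL1 -rmorphB nrm_toC => hc.
have := h2 (toC r); rewrite re => /(_ e2) hA.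
have hr : 1 - `|c| / (2 * K) < nsq (f (toC r *: z)) by apply: h3 => //; rewrite /r; lra.
have rz1 : nsq (toC r *: z) < 1 by rewrite nsqZ hz mulr1 nrm_toC gtr0_norm //; nra.
move: hc; rewrite qE // -EA.
have hA2 : nrm A.[toC r] ^+ 2 <= K.
  have := nrm_le_sub A.[toC r] A.[1]; have := nrm_ge0 A.[toC r]; rewrite /K; nra.
have f1 : 0 <= 1 - nsq (f (toC r *: z)).
  by rewrite subr_ge0 ltW //; apply/unit_ballE/mf/unit_ballE.
set q := _ * (1 - _).
have q0 : 0 <= q by rewrite mulr_ge0 ?sqr_ge0.
have q1 : q <= `|c| / 2.
  apply: (@le_trans _ _ (K * (`|c| / (2 * K)))); first by rewrite ler_pM ?sqr_ge0 //; lra.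
  by rewrite le_eqVlt; apply/orP; left; apply/eqP; field; rewrite gt_eqF.
rewrite distrC => hc; have : `|c| <= `|c - q| + `|q| by rewrite -{1}(subrK q c) ler_normD.
rewrite (ger0_norm q0); lra.
Qed.

End PolyVectors.

(** * Polynomials without zeros in the disc *)

Section DiscPolynomials.
Variable R : realType.
Local Notation C := (Cplx R).
Implicit Types (a : seq C) (A : {poly C}).

Lemma prod_XsubC_inv a : (forall x, x \in a -> x != 0) ->
  \prod_(x <- a) ('X - x%:P) = (\prod_(x <- a) - x) *: \prod_(x <- a) (1 - x^-1 *: 'X).
Proof.
elim: a => [|x a IH] h; first by rewrite !big_nil scale1r.
rewrite !big_cons IH; last by move=> y ya; apply: h; rewrite inE ya orbT.
have x0 : x != 0 by apply: h; rewrite mem_head.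
have -> : 'X - x%:P = (- x) *: (1 - x^-1 *: 'X).
  by rewrite scalerBr scalerA mulNr divff // scaleN1r opprK [RHS]addrC scaleNr alg_polyC.
by rewrite -scalerAl -scalerAr scalerA.
Qed.

(** Inverse roots are listed because A(0) = 1; zeros pad the list to length [m], so that later
    estimates have exactly [m] factors. *)
Lemma poly_factor_unit A m : A`_0 = 1 -> (size A <= m.+1)%N ->
  exists a, [/\ size a = m, A = \prod_(x <- a) (1 - x *: 'X) &
    forall x, x \in a -> x != 0 -> A.[x^-1] = 0].
Proof.
move=> A0 sA; have [r Er] := closed_field_poly_normal A.
have An : A != 0 by apply: contra_eq_neq A0 => ->; rewrite coef0 eq_sym oner_eq0.
have rA x : x \in r -> A.[x] = 0.
  move=> xr; apply/rootP; rewrite Er rootZ ?lead_coef_eq0 // root_prod_XsubC //.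
have r0 x : x \in r -> x != 0.
  move=> /rA xr; apply/eqP => x0; move: A0; rewrite -horner_coef0 -x0 xr => /esym/eqP.
  by rewrite oner_eq0.
have sr : (size r <= m)%N.
  by rewrite -ltnS -(size_prod_XsubC r id); move: sA; rewrite {1}Er size_scale ?lead_coef_eq0.
have EA : A = \prod_(x <- r) (1 - x^-1 *: 'X).
  move: Er; rewrite prod_XsubC_inv // scalerA; set c := _ * _ => Er.
  have : A.[0] = 1 by rewrite horner_coef0.
  rewrite Er hornerZ horner_prod big1_seq ?mulr1 => [c1|x _]; first by rewrite c1 scale1r.
  by rewrite hornerD hornerN hornerZ hornerX hornerC mulr0 subr0.
exists ([seq x^-1 | x <- r] ++ nseq (m - size r) 0); split.
- by rewrite size_cat size_map size_nseq subnKC.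
- rewrite big_cat big_map /= [X in _ * X]big1_seq ?mulr1 // => x /andP[_ /nseqP[-> _]].
  by rewrite scale0r subr0.
- move=> x; rewrite mem_cat => /orP[/mapP[y yr ->]|/nseqP[-> _]]; last by rewrite eqxx.
  by rewrite invrK => _; exact: rA.
Qed.

Lemma coef12_prod a (A := \prod_(x <- a) (1 - x *: 'X)) :
  [/\ A`_0 = 1, A`_1 = - \sum_(x <- a) x &
    2 * A`_2 = (\sum_(x <- a) x) ^+ 2 - \sum_(x <- a) x ^+ 2].
Proof.
rewrite {}/A; elim: a => [|x a [IH0 IH1 IH2]].
  rewrite !big_nil !coef1; split=> //=; first by rewrite oppr0.
  by rewrite ?mulr0n mulr0 expr0n /= subr0.
rewrite !big_cons; set B := \prod_(_ <- _) _ in IH0 IH1 IH2 *.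
have E i : ((1 - x *: 'X) * B)`_i.+1 = B`_i.+1 - x * B`_i.
  by rewrite mulrBl mul1r coefB -scalerAl coefZ coefXM.
have E0 : ((1 - x *: 'X) * B)`_0 = B`_0.
  by rewrite mulrBl mul1r coefB -scalerAl coefZ coefXM mulr0 subr0.
rewrite !E E0 IH0; split=> //; first by rewrite IH1; ring.
by rewrite mulrBr IH2 IH1; ring.
Qed.

Lemma sumr_const_seq (T : Type) (s : seq T) : \sum_(x <- s) (1 : R) = (size s)%:R.
Proof. by rewrite big_const_seq count_predT -Monoid.iteropE. Qed.

Lemma nrm_nat (k : nat) : nrm (k%:R : C) = k%:R.
Proof. by rewrite -(rmorph_nat (@toC R)) nrm_toC ger0_norm. Qed.

Lemma coef2_bound A m : A`_0 = 1 -> A`_1 = 0 -> (size A <= m.+1)%N ->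
  (forall z, nrm z < 1 -> A.[z] != 0) -> nrm A`_2 <= m%:R / 2.
Proof.
move=> A0 A1 sA nz; have [a [sa EA ra]] := poly_factor_unit A0 sA.
have a1 x : x \in a -> nrm x <= 1.
  move=> xa; rewrite leNgt; apply/negP => x1.
  have x0 : x != 0 by rewrite -nrm_gt0; exact: lt_trans x1.
  have := nz x^-1; rewrite ra // eqxx nrmV => h.
  have x2 : (nrm x)^-1 < 1 by rewrite invf_lt1 // (lt_trans ltr01).
  by have := h x2.
have [_ c1 c2] := coef12_prod a; rewrite -EA A1 in c1 c2.
have s0 : \sum_(x <- a) x = 0 by apply/eqP; rewrite -oppr_eq0 -c1.
rewrite s0 expr0n sub0r in c2.
rewrite ler_pdivlMr // -nrm_nat -nrmM mulrC c2 nrmN.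
apply: le_trans (nrm_sum _ _ _) _.
rewrite -sa -sumr_const_seq big_seq [X in _ <= X]big_seq; apply: ler_sum => x xa.
by rewrite nrmX exprn_ile1 ?nrm_ge0 ?a1.
Qed.

Lemma lt_ln1 (y : R) : 0 < y -> y != 1 -> ln y < y - 1.
Proof.
move=> y0 y1; have l0 : ln y != 0 by rewrite ln_eq0.
by have := expR_gt1Dx l0; rewrite lnK ?posrE //; lra.
Qed.

(** Weighted AM-GM for 1 + r and 1 - r with weights (1 - al) / 2 and (1 + al) / 2, whose mean is 1 -
    r al. The exponent is affine in Re x, so over [m] numbers of sum 0 the product of the left sides
    is (1 - r^2)^m. *)
Lemma factor_gt (x : C) (r : R) : 0 < r -> r < 1 -> nrm x < 1 ->
  expR (ln (1 + r) + ln (1 - r) - rpart x * (ln (1 + r) - ln (1 - r))) < nrm (1 - toC r * x) ^+ 2.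
Proof.
move=> r0 r1 x1; pose al := rpart x.
have /andP[al1 al2] : -1 < al < 1.
  by rewrite -ltr_norml; apply: le_lt_trans x1; exact: rpart_le.
have A0 : 0 < 1 - r * al by nra.
apply: (@lt_le_trans _ _ ((1 - r * al) ^+ 2)); last first.
  by rewrite nrm_sqr !partE mul0r subr0 lerDl sqr_ge0.
have l1 : ln ((1 + r) / (1 - r * al)) < (1 + r) / (1 - r * al) - 1.
  apply: lt_ln1; first by rewrite divr_gt0 //; lra.
  rewrite -subr_eq0 (_ : _ - 1 = r * (1 + al) / (1 - r * al)); last by field; rewrite gt_eqF.
  by rewrite !mulf_neq0 ?invr_eq0 ?gt_eqF //; lra.
have l2 : ln ((1 - r) / (1 - r * al)) < (1 - r) / (1 - r * al) - 1.
  apply: lt_ln1; first by rewrite divr_gt0 //; lra.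
  rewrite -subr_eq0 (_ : _ - 1 = - (r * (1 - al) / (1 - r * al))); last by field; rewrite gt_eqF.
  by rewrite oppr_eq0 !mulf_neq0 ?invr_eq0 ?gt_eqF //; lra.
rewrite -ltr_ln ?posrE ?expR_gt0 ?exprn_gt0 // expRK lnXn // -/al.
move: l1 l2; rewrite !ln_div ?posrE //; try lra.
have : (1 - al) * ((1 + r) / (1 - r * al) - 1) + (1 + al) * ((1 - r) / (1 - r * al) - 1) = 0.
  by field; rewrite gt_eqF.
move: ((1 + r) / _) ((1 - r) / _) (ln (1 + r)) (ln (1 - r)) (ln (1 - r * al)) => p q u v w.
rewrite mulr2n; nra.
Qed.

Lemma prod_factor_gt a (r : R) : 0 < r -> r < 1 -> (forall x, x \in a -> nrm x < 1) ->
  (0 < size a)%N -> \sum_(x <- a) x = 0 ->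
  (1 - r ^+ 2) ^+ (size a) < nrm (\prod_(x <- a) (1 - x *: 'X)).[toC r] ^+ 2.
Proof.
move=> r0 r1 a1 a0 s0.
pose D := ln (1 + r) - ln (1 - r); pose L := ln (1 + r) + ln (1 - r).
have fE x : (1 - x *: 'X).[toC r] = 1 - toC r * x.
  by rewrite hornerD hornerN hornerZ hornerX hornerC mulrC.
suff : expR ((size a)%:R * L - rpart (\sum_(x <- a) x) * D) <
    nrm (\prod_(x <- a) (1 - x *: 'X)).[toC r] ^+ 2.
  rewrite s0 mul0r subr0 expRM_natl; apply: le_lt_trans.
  rewrite /L expRD !lnK ?posrE; try lra.
  by rewrite le_eqVlt; apply/orP; left; apply/eqP; congr (_ ^+ _); ring.
have le b : (forall x, x \in b -> nrm x < 1) ->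
    expR ((size b)%:R * L - rpart (\sum_(x <- b) x) * D) <=
    nrm (\prod_(x <- b) (1 - x *: 'X)).[toC r] ^+ 2.
  elim: b => [|x b IH] b1; first by rewrite !big_nil /= mul0r mul0r subr0 expR0 hornerC nrm1 expr1n.
  rewrite !big_cons hornerM nrmM exprMn fE rpartD /= -[(size b).+1]add1n natrD.
  rewrite (_ : (1 + _) * L - _ = (L - rpart x * D) + ((size b)%:R * L - rpart (\sum_(j <- b) j) * D)); last by ring.
  rewrite expRD ler_pM ?expR_ge0 //; last by apply: IH => y yb; apply: b1; rewrite inE yb orbT.
  by apply/ltW/factor_gt => //; apply: b1; rewrite mem_head.
(* One strict factor is enough; the others are compared by [le]. *)
case: a a1 a0 {s0} => // x b b1 _.
rewrite !big_cons hornerM nrmM exprMn fE rpartD /= -[(size b).+1]add1n natrD.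
rewrite (_ : (1 + _) * L - _ = (L - rpart x * D) + ((size b)%:R * L - rpart (\sum_(j <- b) j) * D)); last by ring.
rewrite expRD; have h1 := @factor_gt x r r0 r1 (b1 x (mem_head _ _)).
have h2 := le b (fun y yb => b1 y (mem_behead (s := x :: b) yb)).
apply: (@le_lt_trans _ _ (expR (L - rpart x * D) * nrm (\prod_(x <- b) (1 - x *: 'X)).[toC r] ^+ 2)).
  by rewrite ler_pM2l ?expR_gt0.
rewrite ltr_pM2r //; apply: lt_le_trans h2; exact: expR_gt0.
Qed.

Lemma disc_poly_gt A m r : (0 < m)%N -> A`_0 = 1 -> A`_1 = 0 -> (size A <= m.+1)%N ->
  (forall z, nrm z <= 1 -> A.[z] != 0) -> 0 < r -> r < 1 ->
  (1 - r ^+ 2) ^+ m < nrm A.[toC r] ^+ 2.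
Proof.
move=> m0 A0 A1 sA nz r0 r1; have [a [sa EA ra]] := poly_factor_unit A0 sA.
have [_ c1 _] := coef12_prod a; rewrite -EA A1 in c1.
rewrite -sa EA; apply: prod_factor_gt => //; last by apply/eqP; rewrite -oppr_eq0 -c1.
  move=> x xa; rewrite ltNge; apply/negP => x1.
  have x0 : x != 0 by rewrite -nrm_gt0; exact: lt_le_trans x1.
  have := nz x^-1; rewrite ra // eqxx nrmV => h.
  have x2 : (nrm x)^-1 <= 1 by rewrite invf_le1 // (lt_le_trans ltr01).
  by have := h x2.
by rewrite sa.
Qed.

End DiscPolynomials.

(** * Takagi factorization *)

Section Takagi.
Variable R : realType.
Local Notation C := (Cplx R).

Local Open Scope sesquilinear_scope.

Lemma unitary_extend m n (V : 'M[C]_(m, n)) : V \is unitarymx ->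
  exists k (W : 'M[C]_(k, n)), (m + k)%N = n /\ col_mx V W \is unitarymx.
Proof.
move=> uV; set Vo := orthomx Num.Def.conjC (hermitian1mx n) V.
exists (\rank Vo), (schmidt (row_base Vo)); split.
  by rewrite -[in LHS](mxrank_unitary uV) add_rank_ortho.
have uW : schmidt (row_base Vo) \is unitarymx.
  by apply: schmidt_unitarymx; exact: rank_leq_col.
have WV : (schmidt (row_base Vo)) *m V ^t* = 0.
  by apply/orthomx1P; rewrite (eqmx_schmidt_free (row_base_free _)) eq_row_base.
apply/unitarymxP; rewrite tr_col_mx map_row_mx mul_col_row (unitarymxP uV) (unitarymxP uW) WV.
have -> : V *m (schmidt (row_base Vo)) ^t* = 0.
  by rewrite -[LHS]trmxCK trmx_mul map_mxM /= trmxCK WV trmx0 map_mx0.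
by rewrite -scalar_mx_block.
Qed.

Lemma unitary_conj_mul n (V : 'M[C]_n) : V \is unitarymx ->
  map_mx Num.conj V *m V^T = 1%:M.
Proof.
move=> /unitarymxP h; have := congr1 (map_mx Num.conj) h.
rewrite map_mxM map_mx1 => <-; congr (_ *m _); apply/matrixP => i j.
by rewrite !mxE /= conjCK.
Qed.

(* A row vector [u] with [u S = s conj(u)]: from an eigenvector [u] of [S conj(S)] one
   passes to [conj(u S) + s u], or to [i u] if that vanishes. *)
Lemma con_eigenvector n (S : 'M[C]_n) : (0 < n)%N -> S^T = S ->
  exists (u : 'rV[C]_n) (s : R), [/\ u *m u ^t* = 1%:M, 0 <= s &
    u *m S = toC s *: map_mx Num.conj u].
Proof.
move=> n0 symS; pose S' := map_mx Num.conj S.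
have [mu /eigenvalueP[u Eu u0]] := eigenvalue_closed (S *m S') n0.
have dotE (v : 'rV[C]_n) : v *m v ^t* = (toC (\sum_i nrm (v ord0 i) ^+ 2))%:M.
  apply/matrixP => i j; rewrite (ord1 i) (ord1 j) mxE [RHS]mxE eqxx mulr1n rmorph_sum /=.
  by apply: eq_bigr => k _; rewrite !mxE mulCconj.
have nv0 (v : 'rV[C]_n) : v != 0 -> 0 < \sum_i nrm (v ord0 i) ^+ 2.
  move=> v0; rewrite lt_def sumr_ge0 ?andbT => [|i _]; last exact: sqr_ge0.
  apply: contraNneq v0 => /eqP; rewrite psumr_eq0 => [/allP h|i _]; last exact: sqr_ge0.
  apply/eqP/rowP => i; have := h i (mem_index_enum i).
  by rewrite /= expf_eq0 /= nrm_eq0 mxE => /eqP.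
(* Symmetry makes [S'] the adjoint of [S], so mu |u|^2 = |u S|^2. *)
have [m mE m0] : exists2 m : R, mu = toC m & 0 <= m.
  pose a := \sum_i nrm (u ord0 i) ^+ 2; pose b := \sum_i nrm ((u *m S) ord0 i) ^+ 2.
  have a0 : 0 < a by exact: nv0.
  have E : mu * toC a = toC b.
    have : (mu *: u) *m u ^t* = (u *m S) *m (u *m S) ^t*.
      rewrite -Eu trmx_mul symS map_mxM /= -/S' !mulmxA //.
    by rewrite -scalemxAl !dotE => /matrixP/(_ ord0 ord0); rewrite !mxE eqxx !mulr1n.
  exists (b / a); last by apply: divr_ge0 (ltW a0); apply: sumr_ge0 => i _; exact: sqr_ge0.
  by rewrite rmorphM fmorphV /= -E mulfK // toC_eq0 gt_eqF.
pose s := Num.sqrt m; have s0 : 0 <= s := sqrtr_ge0 _.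
have s2 : s * s = m by rewrite -expr2 sqr_sqrtr.
suff [y y0 Ey] : exists2 y : 'rV[C]_n, y != 0 & y *m S = toC s *: map_mx Num.conj y.
  pose t := (Num.sqrt (\sum_i nrm (y ord0 i) ^+ 2))^-1.
  have y0' := nv0 _ y0.
  exists (toC t *: y), s; split=> //.
    rewrite linearZ /= map_mxZ /= conj_toC -scalemxAl -scalemxAr scalerA -rmorphM /=.
    rewrite dotE scale_scalar_mx -rmorphM /= -expr2 /t exprVn sqr_sqrtr ?(ltW y0') //.
    by rewrite mulVf ?gt_eqF // rmorph1.
  by rewrite -scalemxAl Ey map_mxZ /= conj_toC !scalerA mulrC.
pose y := map_mx Num.conj (u *m S) + toC s *: u.
have [y0|y0] := eqVneq y 0; last first.
  exists y => //; rewrite /y mulmxDl map_mxD map_mxZ /= conj_toC scalerDr scalerA -rmorphM /= s2 -mE.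
  have -> : map_mx Num.conj (u *m S) *m S = mu^* *: map_mx Num.conj u.
    rewrite -map_mxZ -Eu mulmxA [RHS]map_mxM; congr (_ *m _).
    by rewrite /S' -map_mx_comp map_mx_id // => x /=; rewrite conjCK.
  rewrite -scalemxAl mE conj_toC addrC; congr (_ + _).
  by rewrite -map_mx_comp map_mx_id // => x /=; rewrite conjCK.
exists (imC *: u).
  by rewrite scaler_eq0 (negPf u0) orbF -nrm_gt0 nrm_imC.
have uS : u *m S = - (toC s *: map_mx Num.conj u).
  have := congr1 (map_mx Num.conj) y0; rewrite /y map_mxD map_mxZ /= conj_toC map_mx0.
  rewrite -map_mx_comp map_mx_id => [h|x /=]; last by rewrite conjCK.
  by apply/eqP; rewrite -subr_eq0 opprK h.
have key (a b : C) (w : 'rV[C]_n) : a *: (- (b *: w)) = b *: (- a *: w).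
  by rewrite scalerN scaleNr scalerN !scalerA mulrC.
have E2 : map_mx Num.conj (imC *: u) = - imC *: map_mx Num.conj u.
  by apply/rowP => i; rewrite mxE !mxE rmorphM -[X in _ = X * _]conj_imC.
rewrite -scalemxAl uS E2.
exact: key.
Qed.

(** Deflation: with the vector [u] of [con_eigenvector] as first row of a unitary [V0], the first
    row of V0 S V0^T is s conj(u) V0^T, that is s e_1 by orthonormality; the symmetric block [S']
    remains. *)
Lemma takagi_unsorted n (S : 'M[C]_n) : S^T = S ->
  exists (V : 'M[C]_n) (s : 'rV[R]_n), [/\ V \is unitarymx, forall i, 0 <= s ord0 i &
    V *m S *m V^T = diag_mx (map_mx (@toC R) s)].
Proof.
elim: n S => [|n IH] S symS.
  exists 1%:M, 0; split; [by apply/unitarymxP/matrixP => -[]|by case|by apply/matrixP => -[]].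
have [u [s [uu s0 Eu]]] := con_eigenvector (ltn0Sn n) symS.
have uU : u \is unitarymx by apply/unitarymxP.
have [k [W [kn uW]]] := unitary_extend uU.
have {}kn : k = n by move: kn; lia.
subst k.
pose V0 : 'M[C]_(1 + n) := col_mx u W; pose S' := W *m S *m W^T.
have symS' : S'^T = S' by rewrite /S' !trmx_mul trmxK symS mulmxA.
have [V1 [s1 [uV1 s10 E1]]] := IH S' symS'.
pose B : 'M[C]_(1 + n) := block_mx 1%:M 0 0 V1.
have uB : B \is unitarymx.
  apply/unitarymxP; rewrite tr_block_mx map_block_mx !trmx0 !map_mx0 trmx1 map_mx1.
  rewrite mulmx_block !mul0mx !mulmx0 !mul1mx !addr0 !add0r (unitarymxP uV1).
  by rewrite -scalar_mx_block.
have E0 : V0 *m S *m V0^T = block_mx (toC s)%:M 0 0 S'.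
  rewrite /V0 mul_col_mx tr_col_mx mul_col_row.
  have conjV0 := unitary_conj_mul uW.
  rewrite map_col_mx tr_col_mx mul_col_row in conjV0.
  have := conjV0; rewrite (scalar_mx_block 1 n 1) => /eq_block_mx[c1 c2 _ _].
  have uSu : u *m S *m u^T = (toC s)%:M by rewrite Eu -scalemxAl c1 scale_scalar_mx mulr1.
  have uSW : u *m S *m W^T = 0 by rewrite Eu -scalemxAl c2 scaler0.
  rewrite uSu uSW; congr block_mx.
  have -> : W *m S *m u^T = (u *m S *m W^T)^T by rewrite !trmx_mul !trmxK symS mulmxA.
  by rewrite uSW trmx0.
exists (B *m V0), (row_mx s%:M s1 : 'rV[R]_(1 + n)); split.
- exact: (mul_unitarymx uB uW).
- by move=> i; rewrite mxE; case: fintype.split => j; rewrite ?mxE ?(ord1 j) ?eqxx ?mulr1n.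
- have -> : B *m V0 *m S *m (B *m V0)^T = B *m (V0 *m S *m V0^T) *m B^T.
    by rewrite trmx_mul !mulmxA.
  rewrite E0 tr_block_mx !trmx0 trmx1 !mulmx_block !mul0mx !mulmx0 !mul1mx !mulmx1 !addr0 !add0r.
  rewrite ?mulmx0 ?mul0mx E1.
  transitivity (diag_mx (row_mx (map_mx (@toC R) s%:M) (map_mx (@toC R) s1))).
    have Es : diag_mx (map_mx (@toC R) s%:M) = (toC s)%:M :> 'M[C]_1.
      by apply/matrixP => i j; rewrite !mxE (ord1 i) (ord1 j) !eqxx.
    by rewrite diag_mx_row Es.
  congr diag_mx; apply/rowP => i; rewrite !mxE.
  by case: fintype.split => j; rewrite !mxE.
Qed.

Lemma sort_row n (s : 'rV[R]_n) : exists p : 'S_n,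
  forall i j : 'I_n, (i <= j)%N -> s ord0 (p i) <= s ord0 (p j).
Proof.
pose t := [tuple s ord0 i | i < n].
have /tuple_permP[p Ep] : perm_eq (sort <=%O t) t by rewrite perm_sort.
exists p => i j ij.
have E (k : 'I_n) : s ord0 (p k) = nth 0 (sort <=%O t) k.
  by rewrite Ep -tnth_nth !tnth_mktuple.
have hs : sorted <=%O (sort <=%O t) by apply: sort_sorted; exact: le_total.
rewrite !E; apply: (sorted_leq_nth le_trans lexx) hs _ _ _ _ ij => //;
  by rewrite inE size_sort size_tuple.
Qed.

Lemma takagi n (S : 'M[C]_n) : S^T = S ->
  exists (V : 'M[C]_n) (s : 'I_n -> R), [/\ V \is unitarymx, forall i, 0 <= s i,
    forall i j : 'I_n, (i <= j)%N -> s i <= s j &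
    V^T *m S *m V = diag_mx (\row_i toC (s i))].
Proof.
move=> /takagi_unsorted[V [s [uV s0 E]]]; have [p hp] := sort_row s.
exists (row_perm p V)^T, (fun i => s ord0 (p i)); split; [|by move=> i; exact: s0|exact: hp|].
  rewrite trmx_unitary row_permE; apply: mul_unitarymx; last exact: uV.
  apply/unitarymxP/matrixP => i j; rewrite !mxE (bigD1 (p i)) //= big1 => [|k kp].
    by rewrite !mxE eqxx mul1r addr0 (inj_eq perm_inj) eq_sym rmorph_nat.
  by rewrite !mxE eq_sym (negPf kp) mul0r.
rewrite trmxK; apply/matrixP => i j.
transitivity ((V *m S *m V^T) (p i) (p j)); last by rewrite E !mxE (inj_eq perm_inj).
rewrite mxE [RHS]mxE; apply: eq_bigr => k _; rewrite !mxE; congr (_ * _).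
by apply: eq_bigr => l _; rewrite !mxE.
Qed.

(** Multiplied by its conjugate, the relation becomes D_t^2 = V^-1 D_s^2 V, so the squares have the
    same characteristic polynomial; positivity and sorting then identify the families. *)
Lemma takagi_unique n (s t : 'I_n -> R) (V : 'M[C]_n) : V \is unitarymx ->
  (forall i, 0 <= s i) -> (forall i, 0 <= t i) ->
  (forall i j : 'I_n, (i <= j)%N -> s i <= s j) ->
  (forall i j : 'I_n, (i <= j)%N -> t i <= t j) ->
  V^T *m diag_mx (\row_i toC (s i)) *m V = diag_mx (\row_i toC (t i)) ->
  s =1 t.
Proof.
move=> uV s0 t0 ss st E.
pose D (r : 'I_n -> R) : 'M[C]_n := diag_mx (\row_i toC (r i)).
have D2 r : D r *m D r = diag_mx (\row_i toC (r i ^+ 2)).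
  rewrite /D mulmx_diag; congr diag_mx; apply/rowP => i; rewrite !mxE -rmorphM -expr2 //.
have Dc r : map_mx Num.conj (D r) = D r.
  apply/matrixP => i j; rewrite !mxE; case: eqP => _; rewrite ?mulr1n ?mulr0n ?rmorph0 //.
  by rewrite conj_toC.
have DT r : (D r)^T = D r by rewrite /D tr_diag_mx.
have VV : map_mx Num.conj V *m V^T = 1%:M by exact: unitary_conj_mul.
have VaV : V ^t* *m V = 1%:M by exact: mulmx1C (unitarymxP uV).
have E2 : D t *m D t = V ^t* *m (D s *m D s) *m V.
  have Et : D t = V ^t* *m D s *m map_mx Num.conj V.
    by rewrite -[LHS]Dc -[D t]E !map_mxM Dc; congr (_ *m _ *m _); rewrite map_trmx.
  have E' : V^T *m D s *m V = D t := E.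
  rewrite {1}Et -E'.
  transitivity (V ^t* *m (D s *m (map_mx Num.conj V *m V^T *m D s *m V))); first by rewrite !mulmxA.
  by rewrite VV mul1mx !mulmxA.
have pE : \prod_i ('X - (toC (t i ^+ 2))%:P) = \prod_i ('X - (toC (s i ^+ 2))%:P) :> {poly C}.
  apply/subr0_eq/(@poly_eq0_near0 R _ 1) => // x _ _.
  have ev (r : 'I_n -> R) : (\prod_i ('X - (toC (r i ^+ 2))%:P)).[toC x] =
      \det ((toC x)%:M - D r *m D r).
    rewrite horner_prod -diag_const_mx D2 -linearB det_diag; apply: eq_bigr => i _.
    by rewrite hornerXsubC !mxE.
  rewrite hornerD hornerN !ev E2.
  have -> : (toC x)%:M - V ^t* *m (D s *m D s) *m V = V ^t* *m ((toC x)%:M - D s *m D s) *m V.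
    by rewrite mulmxBr mulmxBl mul_mx_scalar -scalemxAl VaV scalemx1.
  by rewrite !det_mulmx mulrAC -det_mulmx VaV det1 mul1r subrr.
pose l (r : 'I_n -> R) := [seq toC (r i ^+ 2) | i <- enum 'I_n].
have le r : \prod_(x <- l r) ('X - x%:P) = \prod_i ('X - (toC (r i ^+ 2))%:P) :> {poly C}.
  by rewrite big_map big_enum.
have pl : perm_eq (l t) (l s) by apply: prod_XsubC_eq; rewrite !le pE.
pose m (r : 'I_n -> R) := [seq r i | i <- enum 'I_n].
have lm r : (forall i, 0 <= r i) -> m r = map (fun z : C => Num.sqrt (rpart z)) (l r).
  move=> r0; rewrite /m /l -map_comp; apply: eq_map => i; change (r i = Num.sqrt (rpart (toC (r i ^+ 2)))).
  by rewrite rpart_toC sqrtr_sqr ger0_norm.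
have pm : perm_eq (m t) (m s) by rewrite !lm //; exact: perm_map.
have sm r : (forall i j : 'I_n, (i <= j)%N -> r i <= r j) -> sorted <=%O (m r).
  move=> h.
  have hr : subrel (relpre val leq) (relpre r <=%O) by move=> i j; exact: (h i j).
  have hs : sorted (relpre val leq) (enum 'I_n) by rewrite -sorted_map val_enum_ord iota_sorted.
  by rewrite /m sorted_map; exact: (sub_sorted hr).
have /eq_in_map h : m t = m s by apply: (sorted_eq le_trans le_anti (sm _ st) (sm _ ss) pm).
by move=> i; rewrite h ?mem_enum.
Qed.

End Takagi.

(** * The denominator does not vanish on the sphere *)

Section CirclePolynomials.
Variable R : realType.
Local Notation C := (Cplx R).
Implicit Types (p q : {poly C}).

Lemma circle_conjV (w : C) : nrm w = 1 -> w^* = w^-1.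
Proof.
move=> w1; have w0 : w != 0 by rewrite -nrm_eq0 w1 oner_eq0.
by apply: (mulfI w0); rewrite mulCconj w1 expr1n rmorph1 divff.
Qed.

(* Comparing Fourier coefficients of [|A|^2 = sum |B_i|^2] on the unit circle. *)
Lemma circle_coef N (A : {poly C}) (B : 'I_N -> {poly C}) D l :
  (size A <= D.+1)%N -> (forall i, (size (B i) <= D.+1)%N) ->
  (forall w, nrm w = 1 -> nrm A.[w] ^+ 2 = \sum_i nrm (B i).[w] ^+ 2) -> (l <= D)%N ->
  \sum_(j < (D - l).+1) A`_j * (A`_(j + l))^* =
  \sum_i \sum_(j < (D - l).+1) (B i)`_j * ((B i)`_(j + l))^*.
Proof.
(* On the unit circle [rv p] takes the value w^D conj(p(w)), so that w^D |p|^2 becomes a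
   polynomial. *)
move=> sA sB h lD; pose rv p := \poly_(i < D.+1) (p`_(D - i))^*.
have rvE p w : (size p <= D.+1)%N -> nrm w = 1 -> (rv p).[w] = w ^+ D * (p.[w])^*.
  move=> sp w1; have w0 : w != 0 by rewrite -nrm_eq0 w1 oner_eq0.
  rewrite (horner_coef_wide w sp) horner_poly rmorph_sum /= mulr_sumr.
  rewrite (reindex_inj rev_ord_inj) /=; apply: eq_bigr => i _.
  rewrite rmorphM rmorphXn /= (circle_conjV w1) subSS mulrCA; congr (_^* * _).
    by congr (_`_ _); rewrite subKn // -ltnS.
  have iD : (i <= D)%N by rewrite -ltnS.
  have <- : w ^+ (D - i) * w ^+ i = w ^+ D by rewrite -exprD subnK.
  by rewrite exprVn mulfK // expf_neq0.
have key : A * rv A = \sum_i B i * rv (B i).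
  apply/subr0_eq/poly_eq0_circle => w w1.
  have sqE p : (size p <= D.+1)%N -> p.[w] * (rv p).[w] = w ^+ D * toC (nrm p.[w] ^+ 2).
    by move=> sp; rewrite rvE // mulrCA mulCconj.
  rewrite hornerD hornerN horner_sum hornerM sqE // h // rmorph_sum /= mulr_sumr.
  by apply/eqP; rewrite subr_eq0; apply/eqP/eq_bigr => i _; rewrite hornerM sqE.
have coefE p : (p * rv p)`_(D - l) = \sum_(j < (D - l).+1) p`_j * (p`_(j + l))^*.
  rewrite coefM; apply: eq_bigr => j _; rewrite coef_poly.
  have jl : (j <= D - l)%N by rewrite -ltnS.
  have -> : (D - l - j < D.+1)%N by lia.
  by congr (_ * (_`_ _)^*); lia.
have := congr1 (fun p : {poly C} => p`_(D - l)) key; rewrite coefE => ->.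
by rewrite coef_sum; apply: eq_bigr => i _; rewrite coefE.
Qed.

Lemma circle_near1 (g : {poly C}) (e : R) : g != 0 -> 0 < e ->
  exists y : C, [/\ nrm y = 1, nrm (y - 1) < e & g.[y] != 0].
Proof.
move=> g0 e0.
pose d := Num.min (e / 2) 1; have d0 : 0 < d by rewrite lt_min divr_gt0 ?ltr01.
pose t k : R := d / k.+2%:R.
have t0 k : 0 < t k by rewrite divr_gt0.
have td k : t k < d by rewrite ltr_pdivrMr // ltr_pMr // ltr1n.
have t1 k : t k < 1 by rewrite (lt_le_trans (td k)) // ge_min lexx orbT.
have t2 k : t k ^+ 2 <= 1 by rewrite expr_le1 ?(ltW (t0 k)) ?(ltW (t1 k)).
pose y k : C := toC (Num.sqrt (1 - t k ^+ 2)) + imC * toC (t k).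
have yR k : rpart (y k) = Num.sqrt (1 - t k ^+ 2).
  by rewrite /y rpartD rpartM rpart_imC /= mulr0 mul0r subr0 addr0.
have yI k : ipart (y k) = t k.
  by rewrite /y ipartD ipartM rpart_imC /= !mul0r mul1r !add0r.
have [k yk] : exists k, g.[y k] != 0.
  apply: contrapT => h; move/eqP: g0; apply.
  pose s := [seq y k | k <- iota 0 (size g)].
  apply: (@roots_geq_poly_eq0 _ _ s); last by rewrite size_map size_iota.
    apply/allP => z /mapP[k _ ->]; apply/rootP/eqP; apply: contrapT => /negP hk.
    by apply: h; exists k.
  rewrite map_inj_uniq ?iota_uniq // => k l /(congr1 (@ipart R)); rewrite !yI /t.
  move=> /(mulfI (lt0r_neq0 d0)) /invr_inj /eqP.
  by rewrite eqr_nat => /eqP [].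
exists (y k); split=> //.
  have : nrm (y k) ^+ 2 = 1 by rewrite nrm_sqr yR yI sqr_sqrtr ?subrK // subr_ge0.
  by move=> /eqP; rewrite sqrf_eq1 => /orP[/eqP //|/eqP h]; have := nrm_ge0 (y k); rewrite h; lra.
apply: le_lt_trans (nrm_le_parts _) _.
rewrite rpartB ipartB yR yI.
have -> : rpart (1 : C) = 1 by [].
have -> : ipart (1 : C) = 0 by [].
have hs : 1 - t k <= Num.sqrt (1 - t k ^+ 2).
  rewrite -[leLHS]ger0_norm ?subr_ge0 ?(ltW (t1 k)) // -sqrtr_sqr; apply: ler_wsqrtr.
  by have := t0 k; have := t1 k; move: (t k) => a; nra.
have hs1 : Num.sqrt (1 - t k ^+ 2) <= 1.
  by rewrite -[leRHS]sqrtr1; apply: ler_wsqrtr; rewrite lerBlDr lerDl sqr_ge0.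
rewrite subr0 (ger0_norm (ltW (t0 k))) ler0_norm ?subr_le0 //.
have : d <= e / 2 by rewrite ge_min lexx.
by have := td k; lra.
Qed.

(** The order of vanishing at 1 is read off from the growth along the circle. The zeros of [g] are
    the exceptional points; each division by X - 1 adds the point 1 to them. *)
Lemma dvdp_circle (g B : {poly C}) M (K : R) : g != 0 ->
  (forall y, nrm y = 1 -> g.[y] != 0 -> nrm B.[y] ^+ 2 <= K * nrm (y - 1) ^+ (2 * M)) ->
  ('X - 1%:P) ^+ M %| B.
Proof.
move=> g0; elim: M B g g0 => [|M IH] B g g0 h; first exact: dvd1p.
have B1 : B.[1] = 0.
  apply: contrapT => /eqP; rewrite -nrm_gt0 => b0.
  pose b := nrm B.[1] / 2; have b1 : 0 < b by rewrite divr_gt0.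
  have [d d0 hd] := horner_ccont B (1 : C) b1.
  pose e := Num.min d (Num.min 1 (b ^+ 2 / (`|K| + 1))).
  have K1 : 0 < `|K| + 1 by rewrite ltr_wpDl.
  have e0 : 0 < e by rewrite !lt_min d0 ltr01 divr_gt0 ?exprn_gt0.
  have [y [y1 ye gy]] := circle_near1 g0 e0.
  have := h y y1 gy; move: ye; rewrite !lt_min => /and3P[yd ye1 yb].
  have {}hd := hd y yd; apply/negP; rewrite -ltNge.
  have lb : b < nrm B.[y].
    have := nrmD B.[y] (B.[1] - B.[y]); rewrite addrC subrK nrmB => h1.
    have b2 : nrm B.[1] = b * 2 by rewrite /b divfK // pnatr_eq0.
    by move: hd h1; rewrite b2; lra.
  apply: (@lt_trans _ _ (b ^+ 2)); last by rewrite ltr_pXn2r ?nnegrE ?(ltW b1) ?nrm_ge0.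
  apply: (@le_lt_trans _ _ ((`|K| + 1) * nrm (y - 1))); last by rewrite mulrC -ltr_pdivlMr.
  have n0 := nrm_ge0 (y - 1).
  apply: (@le_trans _ _ ((`|K| + 1) * nrm (y - 1) ^+ (2 * M.+1))).
    by apply: ler_wpM2r; [exact: exprn_ge0|rewrite (le_trans (ler_norm K)) // lerDl].
  apply: ler_wpM2l; first exact: ltW.
  rewrite mulnS exprD expr2 -mulrA ler_piMr // mulr_ile1 ?exprn_ge0 ?(ltW ye1) //.
  by rewrite exprn_ile1 // (ltW ye1).
have /factor_theorem[B' EB] : root B 1 by apply/rootP.
rewrite EB exprSr dvdp_mul //; apply: (IH B' (g * ('X - 1%:P))) => [|y y1].
  by rewrite mulf_neq0 // polyXsubC_eq0.
rewrite hornerM hornerXsubC mulf_eq0 negb_or => /andP[gy]; rewrite -nrm_gt0 => yy.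
have := h y y1 gy; rewrite EB hornerM hornerXsubC nrmM mulnS exprD mulrA [K * _ * _]mulrAC exprMn.
by rewrite ler_pM2r // exprn_gt0.
Qed.

Implicit Types (u v : {poly R}).

(** Domination of coefficients survives ring operations, conjugation and rotations X -> y X, which
    makes the resulting bounds uniform in [y] on the circle. *)
Definition majorized p (q : {poly R}) := forall i, nrm p`_i <= q`_i.

Lemma majorizedD p p' u u' : majorized p u -> majorized p' u' -> majorized (p + p') (u + u').
Proof. by move=> h h' i; rewrite !coefD (le_trans (nrmD _ _)) // lerD. Qed.

Lemma majorizedN p u : majorized p u -> majorized (- p) u.
Proof. by move=> h i; rewrite coefN nrmN. Qed.

Lemma majorizedM p p' u u' : majorized p u -> majorized p' u' -> majorized (p * p') (u * u').
Proof.
move=> h h' i; rewrite !coefM (le_trans (nrm_sum _ _ _)) //; apply: ler_sum => j _.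
by rewrite nrmM ler_pM ?nrm_ge0.
Qed.

Lemma majorized1 : majorized 1 1.
Proof. by move=> i; rewrite !coef1; case: eqP => _ /=; rewrite ?nrm1 ?nrm0. Qed.

Lemma majorizedX p u k : majorized p u -> majorized (p ^+ k) (u ^+ k).
Proof.
by move=> h; elim: k => [|k IH]; [exact: majorized1|rewrite !exprS; exact: majorizedM].
Qed.

Lemma majorized_sum (I : Type) (r : seq I) (P : pred I) (F : I -> {poly C}) G :
  (forall i, majorized (F i) (G i)) ->
  majorized (\sum_(i <- r | P i) F i) (\sum_(i <- r | P i) G i).
Proof.
move=> h; apply: (big_ind2 majorized) => [i|p1 q1 p2 q2|i _]; first by rewrite !coef0 nrm0.
  exact: majorizedD.
exact: h.
Qed.

(** Division by 1 - X replaces coefficients by their partial sums, which [q] still controls; so the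
    bound depends on [q] and [r] alone. *)
Lemma majorized_div1 (q : {poly R}) r :
  exists K : R, forall p, majorized ((1 - 'X) ^+ r * p) q -> nrm p.[1] <= K.
Proof.
elim: r q => [|r IH] q.
  exists q.[1] => p; rewrite expr0 mul1r => h.
  have sp : (size p <= size q)%N.
    apply/leq_sizeP => j hj; apply/eqP; rewrite -nrm_eq0 eq_le nrm_ge0 andbT.
    by have := h j; rewrite (nth_default 0 hj).
  rewrite (horner_coef_wide 1 sp) horner_coef (le_trans (nrm_sum _ _ _)) //.
  by apply: ler_sum => i _; rewrite !expr1n !mulr1.
have [K hK] := IH (\poly_(i < size q) q.[1]); exists K => p.
rewrite exprS -mulrA => h; apply: hK; move: h.
set p' := _ * p; move=> h.
have q0 i : 0 <= q`_i by apply: le_trans (h i); exact: nrm_ge0.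
have hp k : nrm p'`_k <= \sum_(i < k.+1) q`_i.
  elim: k => [|k IHk].
    have := h 0%N; rewrite mulrBl mul1r coefB mulrC coefMX subr0 => h0.
    by rewrite big_ord_recl big_ord0 addr0.
  have := h k.+1; rewrite mulrBl mul1r coefB mulrC coefMX /= => h1.
  rewrite big_ord_recr /=; have := nrmD (p'`_k.+1 - p'`_k) p'`_k; rewrite subrK.
  by move: h1 IHk; lra.
move=> k; rewrite coef_poly; case: ltnP => hk.
  apply: le_trans (hp k) _; rewrite horner_coef.
  rewrite (big_ord_widen _ (fun i => q`_i) hk) big_mkcond /=; apply: ler_sum => i _.
  by rewrite expr1n mulr1; case: ifP.
have sq : (size ((1 - 'X) * p')%R <= size q)%N.
  apply/leq_sizeP => j hj; apply/eqP; rewrite -nrm_eq0 eq_le nrm_ge0 andbT.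
  by have := h j; rewrite (nth_default 0 hj).
have [->|p0] := eqVneq p' 0; first by rewrite coef0 nrm0.
have sX : size (1 - 'X : {poly C}) = 2%N by rewrite -opprB size_polyN size_XsubC.
have X0 : (1 - 'X : {poly C}) != 0 by rewrite -size_poly_eq0 sX.
move: sq; rewrite size_mul // sX /= => sq.
by rewrite (nth_default 0) ?nrm0 //; apply: leq_trans hk; apply: leq_trans sq; rewrite leqnSn.
Qed.

Lemma majorized_self p : majorized p (\poly_(i < size p) nrm p`_i).
Proof. by move=> i; rewrite coef_poly; case: ltnP => // h; rewrite (nth_default 0 h) nrm0. Qed.

Lemma coef_comp_scaleX (K : comRingType) (f : {poly K}) (a : K) k :
  (f \Po (a *: 'X))`_k = a ^+ k * f`_k.
Proof.
rewrite coef_comp_poly; under eq_bigr => i _ do rewrite exprZn coefZ coefXn.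
have [hk|hk] := ltnP k (size f).
  rewrite (bigD1 (Ordinal hk)) //= eqxx mulr1 big1 ?addr0 => [|i /eqP hi]; first exact: mulrC.
  by case: eqP => [E|]; rewrite ?mulr0 //; case: hi; apply: val_inj.
rewrite (nth_default 0 hk) mulr0 big1 // => i _.
by have := ltn_ord i; case: eqP => [<-|]; rewrite ?mulr0 // ltnNge hk.
Qed.

Lemma majorized_scaleX p u (y : C) : nrm y = 1 -> majorized p u -> majorized (p \Po (y *: 'X)) u.
Proof.
by move=> y1 h i; rewrite coef_comp_scaleX nrmM nrmX y1 expr1n mul1r; exact: h.
Qed.

Lemma majorized_conj p u : majorized p u -> majorized (conjp p) u.
Proof. by move=> h i; rewrite coef_map nrm_conj; exact: h. Qed.

End CirclePolynomials.

(** * Generating functions in two variables and their diagonal coefficients *)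

Section DiagonalSeries.
Variable K : comRingType.
Implicit Types (u w : nat -> K) (a h : nat -> nat -> K).

(** The coefficients of u(s) w(t) A(s, t), where [a] lists those of A; [shift2] is multiplication by
    st. *)
Definition conv2 u w a j k := \sum_(i < j.+1) \sum_(l < k.+1) u i * w l * a (j - i)%N (k - l)%N.

Definition shift2 h j k := if j is j'.+1 then if k is k'.+1 then h j' k' else 0 else 0.

Lemma conv2_shift2 u w h j k : conv2 u w (shift2 h) j k = shift2 (conv2 u w h) j k.
Proof.
case: j k => [|j] [|k] /=; rewrite /conv2.
- by rewrite !big_ord1 mulr0.
- by apply: big1 => i _; apply: big1 => l _; case: (0 - i)%N (sub0n i) => // _; rewrite mulr0.
- apply: big1 => i _; rewrite big_ord1 subnn; case: (j.+1 - i)%N => [|?] /=; exact: mulr0.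
rewrite big_ord_recr /= [X in _ + X]big1 ?addr0 => [|l _]; last by rewrite subnn mulr0.
apply: eq_bigr => i _; rewrite big_ord_recr /= subnn.
have ij : (i <= j)%N by rewrite -ltnS.
rewrite subSn //= mulr0 addr0; apply: eq_bigr => l _.
by rewrite subSn // -ltnS.
Qed.

(* In generating functions: [A(s,t) = (E - c s t) H(s,t)] persists after multiplication by
   [u(s) w(t)], and the diagonal coefficients of such a product telescope. *)
Lemma diagonal_telescope u w a h (E c : K) r :
  (forall j k, a j k = E * h j k - c * shift2 h j k) ->
  \sum_(j < r.+1) E ^+ j * c ^+ (r - j) * conv2 u w a j j = E ^+ r.+1 * conv2 u w h r r.
Proof.
move=> ha.
have conva j k : conv2 u w a j k = E * conv2 u w h j k - c * shift2 (conv2 u w h) j k.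
  rewrite -conv2_shift2 /conv2 !mulr_sumr -sumrB; apply: eq_bigr => i _.
  by rewrite !mulr_sumr -sumrB; apply: eq_bigr => l _; rewrite ha; ring.
elim: r => [|r IH]; first by rewrite big_ord1 conva subn0 /=; ring.
rewrite big_ord_recr /= subnn conva /=.
have -> : \sum_(j < r.+1) E ^+ j * c ^+ (r.+1 - j) * conv2 u w a j j =
    c * \sum_(j < r.+1) E ^+ j * c ^+ (r - j) * conv2 u w a j j.
  rewrite mulr_sumr; apply: eq_bigr => j _.
  have jr : (j <= r)%N by rewrite -ltnS.
  by rewrite subSn // exprS; ring.
by rewrite IH !exprS; ring.
Qed.

Lemma conv2_mul u w (f g : nat -> K) j k :
  conv2 u w (fun j k => f j * g k) j k =
  (\sum_(i < j.+1) u i * f (j - i)%N) * (\sum_(l < k.+1) w l * g (k - l)%N).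
Proof.
by rewrite /conv2 mulr_suml; apply: eq_bigr => i _; rewrite mulr_sumr; apply: eq_bigr => l _; ring.
Qed.

Lemma conv2_sub u w a h j k : conv2 u w (fun j k => a j k - h j k) j k =
  conv2 u w a j k - conv2 u w h j k.
Proof.
rewrite /conv2 -sumrB; apply: eq_bigr => i _; rewrite -sumrB; apply: eq_bigr => l _.
exact: mulrBr.
Qed.

Lemma conv2_sum u w N (a : 'I_N -> nat -> nat -> K) j k :
  conv2 u w (fun j k => \sum_n a n j k) j k = \sum_n conv2 u w (a n) j k.
Proof.
rewrite /conv2 [RHS]exchange_big /=; apply: eq_bigr => i _; rewrite [RHS]exchange_big /=.
by apply: eq_bigr => l _; rewrite mulr_sumr.
Qed.

Lemma inverse_series (f : {poly K}) J : f`_0 = 1 ->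
  exists u w : {poly K}, f * u = 1 + w * 'X^(J.+1).
Proof.
move=> f0; exists (\sum_(i < J.+1) (1 - f) ^+ i).
have -> : f * (\sum_(i < J.+1) (1 - f) ^+ i) = 1 - (1 - f) ^+ J.+1.
  have := subrXX (1 : {poly K}) (1 - f) J.+1.
  rewrite expr1n subKr => ->; congr (_ * _).
  by apply: eq_bigr => i _; rewrite expr1n mul1r.
have [v ->] : exists v, 1 - f = v * 'X.
  exists (drop_poly 1 (1 - f)); rewrite -[LHS](poly_take_drop 1) expr1 addrC.
  rewrite [X in _ + X](_ : _ = 0) ?addr0 //; apply/polyP => -[|i].
    by rewrite coef_take_poly coefB coef1 f0 subrr coef0.
  by rewrite coef_take_poly coef0.
by exists (- v ^+ J.+1); rewrite exprMn mulNr.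
Qed.

End DiagonalSeries.

Section ConjPoly.
Variable R : realType.
Local Notation C := (Cplx R).
Implicit Types p q : {poly C}.

Lemma conjpB p q : conjp (p - q) = conjp p - conjp q. Proof. exact: rmorphB. Qed.
Lemma conjpM p q : conjp (p * q) = conjp p * conjp q. Proof. exact: rmorphM. Qed.
Lemma conjpXn p k : conjp (p ^+ k) = conjp p ^+ k. Proof. exact: rmorphXn. Qed.
Lemma conjp1 : conjp (1 : {poly C}) = 1. Proof. exact: rmorph1. Qed.
Lemma conjp0 : conjp (0 : {poly C}) = 0. Proof. exact: rmorph0. Qed.
Lemma conjp_sum (I : Type) (r : seq I) (P : pred I) (F : I -> {poly C}) :
  conjp (\sum_(i <- r | P i) F i) = \sum_(i <- r | P i) conjp (F i).
Proof. exact: rmorph_sum. Qed.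
Lemma conjpK p : conjp (conjp p) = p.
Proof. by apply/polyP => i; rewrite !coef_map /= conjCK. Qed.
Lemma conjpX : conjp ('X : {poly C}) = 'X. Proof. exact: map_polyX. Qed.

End ConjPoly.

Section SphereSeries.
Variables (R : realType) (N : nat).
Local Notation C := (Cplx R).
Variables (g : {poly {poly C}}) (p : 'I_N -> {poly {poly C}}) (D : nat).
Hypotheses (sg : (size g <= D.+1)%N) (sp : forall i, (size (p i) <= D.+1)%N).
(** The restriction of a map to a complex plane: the outer variable of [g] and [p i] is [s], and
    their coefficients are polynomials in [x]. *)
Hypothesis sphere : forall x s : C, nrm x ^+ 2 + nrm s ^+ 2 = 1 ->
  nrm g.[s%:P].[x] ^+ 2 = \sum_i nrm (p i).[s%:P].[x] ^+ 2.

(** For x = y t with |y| = 1 and t real, the value of [E] at t is |s|^2 on the sphere. *)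
Let E : {poly C} := 1 - 'X ^+ 2.

Let conjp_E : conjp E = E.
Proof. by rewrite /E conjpB conjpXn conjp1 conjpX. Qed.

Section Circle.
Variable y : C.
Hypothesis y1 : nrm y = 1.

Local Notation kap := (comp_poly (y *: 'X)).

Let hornerk (q : {poly C}) t : (kap q).[t] = q.[y * t].
Proof. by rewrite horner_comp hornerZ hornerX. Qed.

(** The coefficient of s^j conj(s)^k in |g|^2 - sum |p_i|^2 at x = y t, as a polynomial in the real
    variable t; [kap] performs the rotation by [y]. *)
Let a0 j k := kap g`_j * conjp (kap g`_k) - \sum_i kap (p i)`_j * conjp (kap (p i)`_k).

Let a0_conj j k : conjp (a0 j k) = a0 k j.
Proof.
rewrite /a0 conjpB conjpM conjpK mulrC conjp_sum; congr (_ - _).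
by apply: eq_bigr => i _; rewrite conjpM conjpK mulrC.
Qed.

Let a0_high j k : (D < j)%N -> a0 j k = 0.
Proof.
move=> h; have z (q : {poly {poly C}}) : (size q <= D.+1)%N -> q`_j = 0.
  by move=> sq; rewrite nth_default // (leq_trans sq).
by rewrite /a0 z // comp_poly0 mul0r big1 ?subr0 // => i _; rewrite z // comp_poly0 mul0r.
Qed.

(** For fixed t the sphere leaves the argument of s free, and these are the Fourier coefficients in
    it, up to a power of |s|. The last term of the range is 0; it lets [step] in [sphere_diagonal]
    peel off the first one. *)
Let toeplitz l : \sum_(i < D.+2) E ^+ i * a0 i (i + l) = 0.
Proof.
have [lD|lD] := leqP l D; last first.
  apply: big1 => i _; rewrite -a0_conj a0_high ?conjp0 ?mulr0 //.
  by rewrite (leq_trans lD) // leq_addl.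
have lt2 : ((D - l).+1 <= D.+2)%N by rewrite ltnS (leq_trans (leq_subr _ _)).
have -> : \sum_(i < D.+2) E ^+ i * a0 i (i + l) = \sum_(i < (D - l).+1) E ^+ i * a0 i (i + l).
  rewrite (big_ord_widen _ (fun i => E ^+ i * a0 i (i + l)%N) lt2) [RHS]big_mkcond /=.
  apply: eq_bigr => i _; case: ltnP => // hi.
  rewrite -a0_conj a0_high ?conjp0 ?mulr0 //; lia.
apply: (@poly_eq0_near0 _ _ 1) => // t t0 t1.
pose d := Num.sqrt (1 - t ^+ 2).
have d2 : d ^+ 2 = 1 - t ^+ 2 by rewrite sqr_sqrtr // subr_ge0 expr_le1 ?ltW.
have d0 : toC d != 0.
  rewrite toC_eq0 -sqrf_eq0 d2 subr_eq0 eq_sym sqrf_eq1 negb_or (lt_eqF t1) /=.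
  by rewrite gt_eqF // (lt_trans _ t0) // ltrN10.
pose ev (q : {poly {poly C}}) : {poly C} :=
  map_poly (horner_eval (y * toC t)) q \Po (toC d *: 'X).
have ev_coef q k : (ev q)`_k = toC d ^+ k * (kap q`_k).[toC t].
  by rewrite coef_comp_scaleX coef_map_id0 ?horner_evalE ?horner0 ?hornerk.
have ev_size (q : {poly {poly C}}) : (size q <= D.+1)%N -> (size (ev q) <= D.+1)%N.
  move=> sq; apply/leq_sizeP => j hj; rewrite ev_coef (nth_default 0) ?comp_poly0 ?horner0 ?mulr0 //.
  exact: leq_trans hj.
have ev_horner (q : {poly {poly C}}) w : (ev q).[w] = q.[(toC d * w)%:P].[y * toC t].
  rewrite horner_comp hornerZ hornerX.
  have := horner_map (horner_eval (y * toC t)) q (toC d * w)%:P.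
  by rewrite /= /horner_eval hornerC.
have key := circle_coef (ev_size _ sg) (fun i => ev_size _ (sp i)) _ lD.
have {key} : \sum_(j < (D - l).+1) (ev g)`_j * ((ev g)`_(j + l))^* =
    \sum_i \sum_(j < (D - l).+1) (ev (p i))`_j * ((ev (p i))`_(j + l))^*.
  apply: key => w w1; rewrite ev_horner sphere; first by apply: eq_bigr => i _; rewrite ev_horner.
  rewrite !nrmM y1 w1 !nrm_toC mul1r mulr1 !ger0_norm ?sqrtr_ge0 ?ltW //.
  by rewrite -/d d2 addrC subrK.
have term (q : {poly {poly C}}) j : (ev q)`_j * ((ev q)`_(j + l))^* =
    toC d ^+ l * ((E ^+ j).[toC t] * (kap q`_j * conjp (kap q`_(j + l))).[toC t]).
  rewrite !ev_coef hornerM conjp_real rmorphM rmorphXn /= conj_toC horner_exp.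
  have -> : E.[toC t] = toC d ^+ 2.
    by rewrite -rmorphXn /= d2 /E !hornerE rmorphB rmorph1 rmorphXn.
  by rewrite exprD -exprM mul2n -addnn exprD; ring.
under eq_bigr => j _ do rewrite term.
under [RHS]eq_bigr => i _ do (under eq_bigr => j _ do rewrite term; rewrite -mulr_sumr).
rewrite -!mulr_sumr => /(mulfI (expf_neq0 l d0)) key.
rewrite horner_sum; under eq_bigr => j _ do rewrite hornerM /a0 hornerD hornerN horner_sum mulrDr mulrN mulr_sumr.
by rewrite big_split /= sumrN key exchange_big /= subrr.
Qed.

(** |g|^2 - |p|^2 is divisible by E - s conj(s). Multiplication by the inverse series of [g] and its
    conjugate leaves 1 - |p / g|^2 with the same divisibility, and [diagonal_telescope] extracts its
    diagonal coefficients, the powers of [c] clearing denominators. *)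
Lemma sphere_diagonal (gam : {poly C}) (u : {poly {poly C}}) J :
  (forall j, (j <= J)%N -> (u * (g \Po (gam *: 'X)))`_j = gam *+ (j == 0%N)) ->
  let c := kap gam * conjp (kap gam) in
  let B i := u * (p i \Po (gam *: 'X)) in
  forall r, (r <= J)%N -> exists H : {poly C},
    c ^+ r.+1 - \sum_(j < r.+1) E ^+ j * c ^+ (r - j) *
       \sum_i kap (B i)`_j * conjp (kap (B i)`_j) = E ^+ r.+1 * H.
Proof.
move=> hu c B r rJ.
(* The quotient of [a0] by E - s conj(s), computed from the top degree down; [toeplitz] says that
   there is no remainder. *)
pose h0 j k := - \sum_(i < D.+1) E ^+ i * a0 (j.+1 + i)%N (k.+1 + i)%N.
have a0E j k : a0 j k = E * h0 j k - shift2 h0 j k.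
  have step m l : \sum_(i < D.+2) E ^+ i * a0 (m + i)%N (l + i)%N = a0 m l - E * h0 m l.
    rewrite big_ord_recl expr0 mul1r !addn0 mulrN opprK mulr_sumr; congr (_ + _).
    by apply: eq_bigr => i _; rewrite /= exprS -mulrA /bump /= !add1n !addnS !addSn.
  have edge l : a0 0 l = E * h0 0%N l.
    apply/eqP; rewrite -subr_eq0 -step -[X in _ == X](toeplitz l); apply/eqP/eq_bigr => i _.
    by rewrite add0n addnC.
  case: j k => [|j] [|k] /=; rewrite ?subr0 ?edge //.
    rewrite -a0_conj edge conjpM conjp_E; congr (_ * _).
    rewrite /h0 -[LHS]addr0 -sub0r addr0 conjpB conjp0 sub0r conjp_sum; congr (- _).
    by apply: eq_bigr => i _; rewrite conjpM conjpXn conjp_E a0_conj.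
  have -> : h0 j k = - (a0 j.+1 k.+1 - E * h0 j.+1 k.+1).
    rewrite -step big_ord_recr /= a0_high; last by lia.
    by rewrite mulr0 addr0.
  by rewrite opprK addrC subrK.
pose sc j k := kap gam ^+ j * conjp (kap gam) ^+ k.
pose ah j k := sc j k * a0 j k; pose hh j k := sc j k * h0 j k.
have ahE j k : ah j k = E * hh j k - c * shift2 hh j k.
  have gen (a b e x z : {poly C}) m l : a ^+ m.+1 * b ^+ l.+1 * (e * x - z) =
      e * (a ^+ m.+1 * b ^+ l.+1 * x) - a * b * (a ^+ m * b ^+ l * z).
    by rewrite !exprS; ring.
  rewrite /ah a0E /hh; case: j k => [|j] [|k] /=; try by rewrite mulr0 !subr0 mulrCA.
  exact: gen.
exists (conv2 (fun i => kap u`_i) (fun i => conjp (kap u`_i)) hh r r).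
rewrite -(diagonal_telescope _ _ _ ahE).
have kapmul (q : {poly {poly C}}) j :
    \sum_(i < j.+1) kap u`_i * (kap gam ^+ (j - i) * kap q`_(j - i)) =
    kap (u * (q \Po (gam *: 'X)))`_j.
  rewrite coefM rmorph_sum /=; apply: eq_bigr => i _.
  by rewrite coef_comp_scaleX !rmorphM /= rmorphXn.
have kapmulc (q : {poly {poly C}}) j :
    \sum_(i < j.+1) conjp (kap u`_i) * (conjp (kap gam) ^+ (j - i) * conjp (kap q`_(j - i))) =
    conjp (kap (u * (q \Po (gam *: 'X)))`_j).
  by rewrite -kapmul conjp_sum; apply: eq_bigr => i _; rewrite !conjpM conjpXn.
have convE j : (j <= J)%N -> conv2 (fun i => kap u`_i) (fun i => conjp (kap u`_i)) ah j j =
    c *+ (j == 0%N) - \sum_i kap (B i)`_j * conjp (kap (B i)`_j).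
  move=> jJ; pose fq (q : {poly {poly C}}) j := kap gam ^+ j * kap q`_j.
  pose gq (q : {poly {poly C}}) j := conjp (kap gam) ^+ j * conjp (kap q`_j).
  have -> : ah = fun j k => fq g j * gq g k - \sum_i fq (p i) j * gq (p i) k.
    apply/funext => m; apply/funext => l; rewrite /ah /a0 /sc /fq /gq mulrBr mulr_sumr.
    by congr (_ - _); [ring|apply: eq_bigr => i _; ring].
  rewrite conv2_sub conv2_mul conv2_sum kapmul kapmulc hu //; congr (_ - _).
    case: (j == 0%N); first by rewrite !mulr1n.
    by rewrite !mulr0n comp_poly0 mul0r.
  by apply: eq_bigr => i _; rewrite conv2_mul kapmul kapmulc.
rewrite [RHS](eq_bigr (fun j : 'I_r.+1 => E ^+ j * c ^+ (r - j) * (c *+ (j == 0%N :> nat)) -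
  E ^+ j * c ^+ (r - j) * \sum_i kap (B i)`_j * conjp (kap (B i)`_j))) => [|j _].
  rewrite sumrB; congr (_ - _); rewrite big_ord_recl big1 ?addr0 => [|j _].
    by rewrite /= subn0 mulr1n expr0 mul1r exprSr.
  by rewrite /= mulr0n mulr0.
by rewrite convE ?mulrBr // (leq_trans _ rJ) // -ltnS.
Qed.

End Circle.
End SphereSeries.

Section SphereNoPole.
Variables (R : realType) (N : nat).
Local Notation C := (Cplx R).
Variables (g : {poly {poly C}}) (p : 'I_N -> {poly {poly C}}) (D : nat).
Hypotheses (sg : (size g <= D.+1)%N) (sp : forall i, (size (p i) <= D.+1)%N).
Hypothesis sphere : forall x s : C, nrm x ^+ 2 + nrm s ^+ 2 = 1 ->
  nrm g.[s%:P].[x] ^+ 2 = \sum_i nrm (p i).[s%:P].[x] ^+ 2.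

(* [(u * p i(g_0 s))_r = g_0 ^+ r.+1 C_r] where [C_r] is the [r]-th Taylor coefficient in [s] of
   [p i / g]: no [C_r] has a pole at [1], because [sphere_diagonal] bounds it on the circle. *)
Lemma sphere_no_pole (e : {poly C}) (u : {poly {poly C}}) m J :
  g`_0 = ('X - 1%:P) ^+ m * e ->
  (forall j, (j <= J)%N -> (u * (g \Po (g`_0 *: 'X)))`_j = g`_0 *+ (j == 0%N)) ->
  forall r i, (r <= J)%N -> ('X - 1%:P) ^+ (m * r.+1) %| (u * (p i \Po (g`_0 *: 'X)))`_r.
Proof.
move=> g0E hu; set gam := g`_0 in g0E hu *; set q := ('X - 1%:P) ^+ m in g0E.
pose B i j := (u * (p i \Po (gam *: 'X)))`_j.
elim/ltn_ind => r IH i0 rJ; pose Q i j := B i j %/ q ^+ j.+1.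
have BQ i j : (j < r)%N -> B i j = Q i j * q ^+ j.+1.
  by move=> jr; rewrite divpK // -exprM; apply: IH => //; exact: (leq_trans (ltnW jr)).
pose E : {poly C} := 1 - 'X ^+ 2.
pose ee y := (e \Po (y *: 'X)) * conjp (e \Po (y *: 'X)).
have mulQ (w q' : {poly C}) k y :
    ((w * q' ^+ k) \Po (y *: 'X)) * conjp ((w * q' ^+ k) \Po (y *: 'X)) =
    ((q' \Po (y *: 'X)) * conjp (q' \Po (y *: 'X))) ^+ k *
      ((w \Po (y *: 'X)) * conjp (w \Po (y *: 'X))).
  by rewrite comp_polyM rmorphXn conjpM conjpXn exprMn /=; ring.
pose nn y j := \sum_i (Q i j \Po (y *: 'X)) * conjp (Q i j \Po (y *: 'X)).
pose Phi y := ee y ^+ r.+1 - \sum_(j < r) E ^+ j * ee y ^+ (r - j) * nn y j.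
(* One majorant serves all [y], because [ee y] and [nn y] arise by rotation from fixed
   polynomials. *)
have [v hv] : exists v : {poly R}, forall y, nrm y = 1 -> majorized (Phi y) v.
  pose s (w : {poly C}) : {poly R} := \poly_(i < size w) nrm w`_i.
  exists ((s e * s e) ^+ r.+1 +
          \sum_(j < r) s E ^+ j * (s e * s e) ^+ (r - j) * \sum_i s (Q i j) * s (Q i j)) => y y1.
  have hs w : majorized (w \Po (y *: 'X)) (s w).
    by apply: majorized_scaleX => //; exact: majorized_self.
  have hss w : majorized ((w \Po (y *: 'X)) * conjp (w \Po (y *: 'X))) (s w * s w).
    by apply: majorizedM => //; exact: majorized_conj.
  apply: majorizedD; first exact/majorizedX/hss.
  apply/majorizedN/majorized_sum => j; apply: majorizedM; last exact: majorized_sum.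
  by apply: majorizedM; apply: majorizedX; [exact: majorized_self|exact: hss].
have [K hK] := majorized_div1 v r.
rewrite -[X in _ %| X]/(B i0 r).
apply: (@dvdp_circle _ ('X - 1%:P) _ _ (K / 2 ^+ r)); first by rewrite polyXsubC_eq0.
move=> y y1; rewrite hornerXsubC => y0.
have [H] := sphere_diagonal sg sp sphere y1 hu rJ.
rewrite -/gam -[1 - 'X ^+ 2]/E.
set c := (gam \Po _) * _; pose rho := (q \Po (y *: 'X)) * conjp (q \Po (y *: 'X)).
have cE : c = rho * ee y.
  by rewrite /c g0E rmorphM /= conjpM /rho /ee mulrACA.
rewrite big_ord_recr /= subnn expr0 mulr1.
pose b := \sum_i (B i r \Po (y *: 'X)) * conjp (B i r \Po (y *: 'X)).
rewrite -[X in _ + E ^+ r * X]/b => key.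
(* The variable is t. At t = 1, [E] has a simple zero while [rho] is |y - 1|^(2m), not 0; so (1 -
   t)^r divides [Phi y]. The quotient Psi at t = 1 yields 2^r sum |B_r(y)|^2 = |y - 1|^(2m(r+1))
   |Psi(1)|, where |Psi(1)| <= K uniformly in [y]. *)
have {}key : rho ^+ r.+1 * Phi y = E ^+ r * (b + E * H).
  have -> : rho ^+ r.+1 * Phi y = c ^+ r.+1 - \sum_(j < r) E ^+ j * c ^+ (r - j) *
      \sum_i (B i j \Po (y *: 'X)) * conjp (B i j \Po (y *: 'X)).
    rewrite mulrBr -exprMn -cE mulr_sumr; congr (_ - _); apply: eq_bigr => j _.
    have -> : \sum_i (B i j \Po (y *: 'X)) * conjp (B i j \Po (y *: 'X)) = rho ^+ j.+1 * nn y j.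
      rewrite /nn mulr_sumr; apply: eq_bigr => i _.
      by rewrite BQ // mulQ.
    have -> : rho ^+ r.+1 = rho ^+ (r - j) * rho ^+ j.+1.
      by rewrite -exprD addnS subnK // ltnW.
    rewrite cE [(rho * ee y) ^+ _]exprMn.
    by move: (E ^+ j) (rho ^+ (r - j)) (ee y ^+ (r - j)) (rho ^+ j.+1) (nn y j) => *; ring.
  by rewrite mulrDr mulrA -exprSr -key opprD [RHS]addrC [in RHS]addrA subrK.
have EE : E = (1 - 'X) * (1 + 'X) by rewrite /E; ring.
have rho1 : rho.[toC 1] = toC (nrm (y - 1) ^+ (2 * m)).
  rewrite /rho nrm_horner_real horner_comp hornerZ hornerX rmorph1 mulr1 /q.
  by rewrite horner_exp hornerXsubC nrmX -exprM mulnC.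
have X1 : 1 - 'X = (-1) *: ('X - 1%:P) :> {poly C} by rewrite scaleN1r opprB.
have cop : coprimep ((1 - 'X) ^+ r) (rho ^+ r.+1).
  apply/coprimep_expl/coprimep_expr; rewrite X1 coprimepZl ?oppr_eq0 ?oner_eq0 //.
  rewrite coprimep_sym coprimep_XsubC; apply/rootP; rewrite -[1](rmorph1 (@toC R)) /= rho1.
  by apply/eqP; rewrite toC_eq0 expf_neq0 // nrm_eq0.
have /dvdpP[Psi PsiE] : (1 - 'X) ^+ r %| Phi y.
  by rewrite -(Gauss_dvdpr _ cop) key EE exprMn -mulrA dvdp_mulr.
have X0 : (1 - 'X : {poly C}) ^+ r != 0.
  by rewrite expf_neq0 // X1 scaler_eq0 oppr_eq0 oner_eq0 polyXsubC_eq0.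
have {}key : rho ^+ r.+1 * Psi = (1 + 'X) ^+ r * (b + E * H).
  by apply: (mulfI X0); rewrite mulrCA [_ ^+ r * Psi]mulrC -PsiE key EE exprMn mulrA.
have PsiK : nrm Psi.[1] <= K by apply: hK; rewrite mulrC -PsiE; exact: hv.
have bE : b.[toC 1] = toC (\sum_i nrm (B i r).[y] ^+ 2).
  rewrite /b horner_sum rmorph_sum; apply: eq_bigr => i _.
  by rewrite nrm_horner_real horner_comp hornerZ hornerX rmorph1 mulr1.
have E1 : E.[toC 1] = 0 by rewrite /E hornerD hornerN horner_exp hornerX !hornerE rmorph1 expr1n subrr.
have X2 : (1 + 'X : {poly C}).[toC 1] = toC 2 by rewrite hornerD hornerX hornerC rmorph1 rmorph_nat.
have := congr1 (fun w : {poly C} => nrm w.[toC 1]) key.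
rewrite !hornerM !horner_exp rho1 X2 hornerD hornerM E1 mul0r addr0 bE !nrmM !nrmX !nrm_toC.
rewrite ger0_norm ?exprn_ge0 ?nrm_ge0 // ger0_norm // ger0_norm ?sumr_ge0 // => [keyn|i _]; last exact: sqr_ge0.
have le_sum : nrm (B i0 r).[y] ^+ 2 <= \sum_i nrm (B i r).[y] ^+ 2.
  by rewrite (bigD1 i0) //= lerDl sumr_ge0 // => i _; exact: sqr_ge0.
rewrite mulrAC ler_pdivlMr ?exprn_gt0 //.
apply: le_trans (_ : 2 ^+ r * \sum_i nrm (B i r).[y] ^+ 2 <= _).
  by rewrite mulrC ler_pM2l ?exprn_gt0.
rewrite -keyn rmorph1 mulrC -exprM mulnA ler_wpM2r // exprn_ge0 ?nrm_ge0 //.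
Qed.

End SphereNoPole.

Lemma mul_coef_lowest (K : idomainType) (P F : {poly K}) k : P`_0 != 0 ->
  (forall j, (j < k)%N -> (P * F)`_j = 0) -> (P * F)`_k = P`_0 * F`_k.
Proof.
move=> P0; elim/ltn_ind: k => k IH h.
have F0 j : (j < k)%N -> F`_j = 0.
  move=> jk; have := h j jk; rewrite IH // => [/eqP|i ij]; last exact/h/(ltn_trans ij).
  by rewrite mulf_eq0 (negPf P0) => /eqP.
rewrite coefM big_ord_recl /= subn0 big1 ?addr0 // => i _.
by rewrite F0 ?mulr0 // /bump /= add1n subnS; have := ltn_ord i; lia.
Qed.

Section SphereNoZero.
Variables (R : realType) (N : nat).
Local Notation C := (Cplx R).

(** Coefficients of s^k are compared, k being the order of [r] at 0. The factor (X - 1)^(m(k+1))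
    allowed by g_0^(k+1) cancels on both sides, and evaluation at 1 leaves a nonzero constant on one
    of them. *)
Lemma sphere_no_zero (g : {poly {poly C}}) (p : 'I_N -> {poly {poly C}})
    (pi kappa a b : {poly {poly C}}) (i0 : 'I_N) (r : {poly C}) :
  (forall x s : C, nrm x ^+ 2 + nrm s ^+ 2 = 1 ->
    nrm g.[s%:P].[x] ^+ 2 = \sum_i nrm (p i).[s%:P].[x] ^+ 2) ->
  g`_0 != 0 -> g = pi * kappa -> a * pi + b * p i0 = map_poly polyC r -> r != 0 ->
  (pi`_0).[1] != 0.
Proof.
move=> sphere g0 gE abE r0.
have [D sg sp] : exists2 D, (size g <= D.+1)%N & forall i, (size (p i) <= D.+1)%N.
  exists (maxn (size g) (\max_i size (p i))).
    by rewrite ltnW // ltnS leq_maxl.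
  by move=> i; rewrite ltnW // ltnS leq_max (bigop.leq_bigmax i) orbT.
set gam := g`_0 in g0.
have [m [e]] := multiplicity_XsubC gam 1; rewrite g0 /= => e1 gamE.
have [k rk kmin] : exists2 k, r`_k != 0 & forall j, (j < k)%N -> r`_j = 0.
  have ex : exists k, r`_k != 0 by exists (size r).-1; rewrite -lead_coefE lead_coef_eq0.
  exists (ex_minn ex); case: ex_minnP => // j rj jmin i ij.
  by apply/eqP; apply: contraTT ij => /jmin; rewrite -leqNgt.
(* Replacing s by g_0 s clears the powers of g_0 in the denominators of the Taylor coefficients of p
   / g. *)
pose hat (q : {poly {poly C}}) := q \Po (gam *: 'X).
have hatE q j : (hat q)`_j = gam ^+ j * q`_j by exact: coef_comp_scaleX.
have hatM q q' : hat (q * q') = hat q * hat q' by exact: comp_polyM.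
have hatD q q' : hat (q + q') = hat q + hat q' by exact: comp_polyD.
pose g1 : {poly {poly C}} := \poly_(j < D.+1) (if j is j'.+1 then gam ^+ j' * g`_j else 1).
have hatg : hat g = gam *: g1.
  apply/polyP => j; rewrite hatE coefZ coef_poly; case: ltnP => hj.
    by case: j hj => [|j] _; rewrite ?expr0 ?mul1r ?mulr1 // exprS mulrA.
  by rewrite nth_default ?mulr0 // (leq_trans sg).
have g10 : g1`_0 = 1 by rewrite coef_poly.
have [u [w uE]] := inverse_series k g10.
have hu j : (j <= k)%N -> (u * (g \Po (gam *: 'X)))`_j = gam *+ (j == 0%N).
  move=> jk; rewrite -/(hat g) hatg -scalerAr mulrC uE coefZ coefD coef1 coefMXn ltnS jk addr0.
  exact: mulr_natr.
have gamE' : g`_0 = ('X - 1%:P) ^+ m * e by rewrite -/gam gamE mulrC.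
have div := sphere_no_pole sg sp sphere gamE' hu.
(* Up to order [k] in s, this is g_0 times the rescaled a + b kappa p / g, whose product with [pi]
   is [r]. *)
pose F := gam *: hat a + hat kappa * hat b * (u * hat (p i0)).
have coefF j : (j <= k)%N -> (hat pi * F)`_j = gam ^+ j.+1 * (r`_j)%:P.
  move=> jk; have -> : hat pi * F = gam *: hat (map_poly polyC r) +
      gam *: (w * hat b * hat (p i0)) * 'X^(k.+1).
    rewrite -abE hatD [hat (a * pi)]hatM [hat (b * _)]hatM.
    have gen1 (x P A K B U Q : {poly {poly C}}) :
        P * (x * A + K * B * (U * Q)) = x * (P * A) + P * K * U * (B * Q) by ring.
    have gen2 (x P A B Q W X : {poly {poly C}}) :
        x * (P * A) + x * (1 + W * X) * (B * Q) = x * (A * P + B * Q) + x * (W * B * Q) * X by ring.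
    transitivity (gam *: (hat pi * hat a) + hat (pi * kappa) * u * (hat b * hat (p i0))).
      by rewrite hatM /F -!mul_polyC; exact: gen1.
    rewrite -gE hatg -[gam *: g1 * u]scalerAl uE -!mul_polyC; exact: gen2.
  by rewrite coefD coefMXn ltnS jk addr0 coefZ hatE coef_map /= mulrA -exprS.
have pi0 : (hat pi)`_0 != 0.
  rewrite hatE expr0 mul1r; apply: contraNneq g0 => h.
  by rewrite /gam gE coefM big_ord1 h mul0r.
have low j : (j < k)%N -> (hat pi * F)`_j = 0.
  by move=> jk; rewrite (coefF j (ltnW jk)) (kmin j jk) polyC0 mulr0.
have := coefF k (leqnn k); rewrite (mul_coef_lowest pi0 low).
rewrite hatE expr0 mul1r.
pose q : {poly C} := 'X - 1%:P.
have gamq : gam = q ^+ m * e by rewrite gamE mulrC.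
have /dvdpP[f ->] : q ^+ (m * k.+1) %| F`_k.
  rewrite coefD coefZ hatE mulrA -exprS; apply: dvdp_add.
    by rewrite gamq exprMn -exprM -mulrA dvdp_mulr.
  rewrite coefM; apply: (big_ind (fun s => q ^+ (m * k.+1) %| s)) => [|s t|j _]; rewrite ?dvdp0 //.
    exact: dvdp_add.
  have jk : (j <= k)%N by rewrite -ltnS.
  have -> : (m * k.+1 = m * j + m * (k - j).+1)%N by rewrite -mulnDr addnS subnKC.
  rewrite exprD; apply: dvdp_mul; last by apply: div; rewrite leq_subr.
  by rewrite -hatM hatE gamq exprMn -exprM dvdp_mulr // dvdp_mulr.
have q0 : q ^+ (m * k.+1) != 0 by rewrite expf_neq0 // polyXsubC_eq0.
rewrite gamq exprMn -exprM mulrA -[RHS]mulrA [RHS]mulrC => /(mulIf q0) key.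
apply: contra_eq_neq (congr1 (fun s : {poly C} => s.[1]) key) => h.
by rewrite !hornerM h mul0r hornerC horner_exp eq_sym mulf_neq0 // expf_neq0.
Qed.

End SphereNoZero.

(** Elimination of the main variable by the resultant, which is nonzero because a prime [P] that
    does not divide [Q] has no factor of positive degree in common with it. *)
Lemma prime_bezout (K : idomainType) (P Q : {poly K}) : prime_elt P -> ~ rdvd P Q ->
  exists a b c, c != 0 /\ a * P + b * Q = c%:P.
Proof.
move=> [P0 nuP pP] nPQ.
have Q0 : Q != 0 by apply/eqP => Q0; apply: nPQ; exists 0; rewrite Q0 mul0r.
have [sP|sP] := leqP (size P) 1.
  exists 1, 0, P`_0; rewrite mul1r mul0r addr0 -size1_polyC //; split=> //.
  by rewrite -polyC_eq0 -size1_polyC.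
have [sQ|sQ] := leqP (size Q) 1.
  exists 0, 1, Q`_0; rewrite mul1r mul0r add0r -size1_polyC //; split=> //.
  by rewrite -polyC_eq0 -size1_polyC.
have [[a b] /= _ ab] := resultant_in_ideal sP sQ.
exists a, b, (resultant P Q); split=> //; rewrite resultant_eq0 -leqNgt.
set G := gcdp P Q; rewrite leqNgt; apply/negP => sG.
have not_dvd (c : K) : c != 0 -> ~ rdvd P c%:P.
  move=> c0 [k /(congr1 (fun p : {poly K} => size p))].
  have [->|k0] := eqVneq k 0; first by rewrite mul0r size_poly0 size_polyC c0.
  rewrite size_polyC c0 size_mul //.
  by have := k0; rewrite -size_poly_gt0; move: (size k) (size P) sP => x y; lia.
have [[c w] /= c0 cw] := Pdiv.Idomain.dvdpP _ _ (dvdp_gcdl P Q).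
have [[c' w'] /= c'0 cw'] := Pdiv.Idomain.dvdpP _ _ (dvdp_gcdr P Q).
(* [P] does not divide [w], whose degree is smaller because [G] has positive degree; so it divides
   [G], then a constant multiple of [Q], and finally [Q]. *)
have [//|PG] : rdvd P w \/ rdvd P G.
- by apply: pP; rewrite -cw -mul_polyC; exists c%:P.
- move=> [k wk]; have := congr1 (fun p : {poly K} => size p) cw.
  have w0 : w != 0.
    by apply: contraNneq P0 => w0; move/eqP: cw; rewrite w0 mul0r scale_poly_eq0 (negPf c0).
  have G0 : G != 0 by rewrite -size_poly_gt0 (ltn_trans _ sG).
  have k0 : k != 0 by apply: contraNneq w0 => k0; rewrite wk k0 mul0r.
  rewrite size_scale // size_mul // -/G wk size_mul //.
  have := k0; rewrite -size_poly_gt0; move: (size k) (size P) (size G) sG => x y z; lia.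
have [] : rdvd P c'%:P \/ rdvd P Q; last by [].
  by apply: pP; rewrite mul_polyC cw'; case: PG => k Ek; exists (w' * k); rewrite -mulrA -Ek.
exact: not_dvd.
Qed.

Section CimaSuffridge.
Variable R : realType.
Local Notation C := (Cplx R).

(** At the last basis vector q the main variable of [muni] is the coordinate along q, so its
    elimination leaves [r] in the orthogonal directions. *)
Lemma no_pole_last n N (V : 'I_N.+1 -> cpoly R n.+1) : vlowest V -> ball_vector V ->
  peval (V ord0) (delta_mx ord_max ord0) != 0.
Proof.
move=> [V0 lV] [Vball Vsph]; apply/eqP => Vq.
pose pt (v : 'I_n -> C) x : 'cV[C]_n.+1 :=
  \col_i (if unlift ord_max i is Some j then v j else x).
pose ev v x (P : {poly mpoly n C}) := (map_poly (meval v) P).[x].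
have evM v x P Q : ev v x (P * Q) = ev v x P * ev v x Q.
  by rewrite /ev rmorphM hornerM.
have ev_muni v x (q : cpoly R n.+1) : ev v x (muni q) = peval q (pt v x).
  by rewrite /ev meval_muni /peval; congr (meval _ q); apply/funext => i; rewrite mxE.
have ptq : pt (fun=> 0) 1 = delta_mx ord_max ord0.
  apply/colP => i; rewrite !mxE eqxx andbT; case: unliftP => [j ->|->]; last by rewrite eqxx.
  by rewrite eq_sym (negPf (neq_lift _ _)).
have [|u [s [uu ps E]]] := @ufd_poly _ (@ufd_mpoly C n) (muni (V ord0)).
- by rewrite -(muni0 n) (inj_eq (can_inj (@muniK C n))).
have [P Ps Pq] : exists2 P, P \in s & ev (fun=> 0) 1 P = 0.
  have : ev (fun=> 0) 1 (muni (V ord0)) = 0 by rewrite ev_muni ptq.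
  rewrite E evM => /eqP; rewrite mulf_eq0 => /orP[/eqP u0|].
    have := evM (fun=> 0) 1 u u^-1; rewrite u0 mul0r mulrV // /ev rmorph1 hornerC.
    by move/eqP; rewrite oner_eq0.
  rewrite /ev rmorph_prod horner_prod prodf_seq_eq0 => /hasP[P Ps /eqP hP]; by exists P.
have [kappa Ek] : exists kappa, muni (V ord0) = P * kappa.
  by exists (u * \prod_(Q <- rem P s) Q); rewrite E (big_rem P Ps) /= mulrCA.
have [P0 nuP _] := ps P Ps.
have [j nPj] : exists j, ~ rdvd P (muni (V (lift ord0 j))).
  apply: contrapT => H; move/negP: nuP; apply.
  rewrite -(of_muniK P); apply: rmorph_unit; apply: pdeg0_unit.
    by rewrite -(raddf0 (@of_muni C n)) (inj_eq (can_inj (@of_muniK C n))).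
  apply: lV => i; have [k Ei] : rdvd P (muni (V i)).
    have [->|[i' ->]] := ord0_or_lift i; first by exists kappa; rewrite mulrC.
    by apply: contrapT => h; apply: H; exists i'.
  by exists (of_muni k); rewrite -(muniK (V i)) Ei; exact: rmorphM.
have [a [b [r [r0 abr]]]] := prime_bezout (ps P Ps) nPj.
have [v rv] : exists v : 'I_n -> C, meval v r != 0.
  apply: contrapT => h; move/eqP: r0; apply; apply: mpoly_eq0_muni => v.
  by apply/eqP; apply: contrapT => /negP hv; apply: h; exists v.
(* If v = 0, the elimination identity is already absurd at q: the denominator vanishes there, and by
   the condition on the sphere so do all numerators. *)
have [mu0|mu0] := eqVneq (\sum_i nrm (v i) ^+ 2) 0.
  have v0 : v = fun=> 0.
    apply/funext => i; apply/eqP; rewrite -nrm_eq0 -sqrf_eq0.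
    by apply/eqP/(psumr_eq0P _ mu0) => // k _; exact: sqr_ge0.
  have := congr1 (ev (fun=> 0) 1) abr; rewrite /ev rmorphD hornerD -!/(ev _ _ _) !evM Pq mulr0 add0r.
  rewrite ev_muni ptq.
  have -> : peval (V (lift ord0 j)) (delta_mx ord_max ord0) = 0.
    have q1 : nsq (delta_mx ord_max ord0 : 'cV[C]_n.+1) = 1.
      rewrite /nsq (bigD1 ord_max) //= mxE !eqxx nrm1 expr1n big1 ?addr0 // => i /negPf hi.
      by rewrite mxE hi nrm0 expr0n.
    have := Vsph _ q1; rewrite /qf mxE Vq nrm0 expr0n sub0r => /eqP; rewrite oppr_eq0 => /eqP/nsq_eq0.
    by move/colP/(_ j); rewrite !mxE.
  by rewrite mulr0 /ev map_polyC hornerC /= -v0 => /esym/eqP; apply/negP.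
pose c := Num.sqrt (\sum_i nrm (v i) ^+ 2).
have S0 : 0 <= \sum_i nrm (v i) ^+ 2 by apply: sumr_ge0 => i _; exact: sqr_ge0.
have c0 : c != 0 by rewrite sqrtr_eq0 -ltNge lt_def mu0.
pose w i := v i / toC c.
have w1 : \sum_i nrm (w i) ^+ 2 = 1.
  under eq_bigr => i _ do rewrite /w nrmM nrmV nrm_toC exprMn exprVn real_normK ?num_real //.
  by rewrite -mulr_suml /c sqr_sqrtr // divff.
(* [L] restricts to the line spanned by the unit vector [w], so [T Q] is [Q] on the plane x q + s w;
   [swapXY] makes [s] the outer variable, as [sphere_no_zero] expects. *)
pose L : mpoly n C -> {poly C} := mmap polyC (fun i => w i *: 'X).
pose T (Q : {poly mpoly n C}) : {poly {poly C}} := swapXY (map_poly L Q).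
have LE Q t : (L Q).[t] = meval (fun i => w i * t) Q.
  rewrite mevalE /L /mmap -[LHS]/(horner_eval t _) raddf_sum; apply: eq_bigr => m _.
  rewrite /= /horner_eval hornerM hornerC; congr (_ * _).
  rewrite /mmap1 horner_prod; apply: eq_bigr => i _.
  by rewrite horner_exp hornerZ hornerX.
have L0 : L 0 = 0 by exact: raddf0.
have TE Q x t : (T Q).[t%:P].[x] = ev (fun i => w i * t) x Q.
  rewrite /T horner2_swapXY /ev -[LHS]/(horner_eval t _) -horner_map /= /horner_eval hornerC.
  congr (_.[x]); apply/polyP => k.
  by rewrite !coef_map_id0 ?meval0 ?horner0 ?L0 // LE.
have TM P' Q : T (P' * Q) = T P' * T Q by rewrite /T !rmorphM.
have TD P' Q : T (P' + Q) = T P' + T Q by rewrite /T !rmorphD.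
have TC q : T q%:P = map_poly polyC (L q) by rewrite /T map_polyC swapXY_polyC.
clearbody T; clear L0; clearbody L; clearbody ev.
have nsq_pt x t : nrm x ^+ 2 + nrm t ^+ 2 = 1 -> nsq (pt (fun i => w i * t) x) = 1.
  move=> <-; rewrite /nsq big_ord_recr /= mxE unlift_none addrC; congr (_ + _).
  rewrite -[RHS]mul1r -w1 mulr_suml; apply: eq_bigr => i _.
  have -> : widen_ord (leqnSn n) i = lift ord_max i.
    by apply: val_inj; rewrite /= /bump leqNgt ltn_ord.
  by rewrite mxE liftK nrmM exprMn.
have Lr0 : L r != 0.
  apply: contraNneq rv => Lr; have := LE r (toC c); rewrite Lr horner0 => ->.
  apply/eqP; congr (meval _ r); apply/funext => i.
  by rewrite /w divfK // toC_eq0.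
have := @sphere_no_zero R N (T (muni (V ord0))) (fun i => T (muni (V (lift ord0 i)))) (T P)
  (T kappa) (T a) (T b) j (L r) _ _ _ _ Lr0.
have coef0E Q x : ((T Q)`_0).[x] = ev (fun=> 0) x Q.
  rewrite -horner_coef0 -polyC0 TE; congr ev; apply/funext => i; exact: mulr0.
rewrite coef0E Pq eqxx => h; suff : false by []. apply: h.
- move=> x t xt; have := Vsph _ (nsq_pt x t xt).
  rewrite /qf.
  have -> : pv V (pt (fun i => w i * t) x) ord0 ord0 = peval (V ord0) (pt (fun i => w i * t) x).
    by rewrite mxE.
  have E1 : (T (muni (V ord0))).[t%:P].[x] = peval (V ord0) (pt (fun i => w i * t) x).
    by rewrite TE ev_muni.
  rewrite -E1 => /subr0_eq E2; apply: etrans E2 _.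
  apply: eq_bigr => i _.
  have E3 : (T (muni (V (lift ord0 i)))).[t%:P].[x] = peval (V (lift ord0 i)) (pt (fun i => w i * t) x).
    by rewrite TE ev_muni.
  by rewrite E3 !mxE.
- apply: contraTneq isT => T0; have := coef0E (muni (V ord0)) 0; rewrite T0 horner0 ev_muni.
  have -> : pt (fun=> 0) 0 = 0 by apply/colP => i; rewrite !mxE; case: unlift.
  move=> V00; have := pv_neq0 (Vball 0 _); rewrite -V00 eqxx => -> //.
  by rewrite nsq0 ltr01.
- by rewrite Ek TM.
- by rewrite -!TM -TD abr TC.
Qed.

Lemma unitary_last_column n (z : 'cV[C]_n.+1) : nsq z = 1 ->
  exists2 U : 'M[C]_n.+1, U \is unitarymx & U *m delta_mx ord_max ord0 = z.
Proof.
move=> z1; pose Z : 'rV[C]_n.+1 := map_mx Num.conj z^T.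
have uZ : Z \is unitarymx.
  apply/unitarymxP/matrixP => i j; rewrite !mxE (ord1 i) (ord1 j) eqxx /= -(rmorph1 (@toC R)) -z1.
  rewrite /nsq rmorph_sum /=; apply: eq_bigr => k _.
  by rewrite !mxE conjCK mulrC mulCconj.
have [k [W [kn]]] := unitary_extend uZ.
have {}kn : k = n by move: kn; lia.
subst k; set A := col_mx Z W => uA.
have uA' : row_perm (tperm ord0 ord_max) (A : 'M[C]_n.+1) \is unitarymx.
  rewrite row_permE; apply: mul_unitarymx; last exact: uA.
  apply/unitarymxP/matrixP => i j; rewrite !mxE (bigD1 (tperm ord0 ord_max i)) //= big1 => [|l lp].
    by rewrite !mxE eqxx mul1r addr0 (inj_eq perm_inj) eq_sym rmorph_nat.
  by rewrite !mxE eq_sym (negPf lp) mul0r.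
exists (map_mx Num.conj (row_perm (tperm ord0 ord_max) (A : 'M[C]_n.+1))^T).
  by rewrite trmxC_unitary.
apply/colP => i; rewrite mul_delta_col mxE mxE mxE mxE tpermR.
case: fintype.splitP => j //= hj; first by rewrite (ord1 j) !mxE conjCK.
Qed.

Lemma vdeg_exists n N (V : 'I_N.+1 -> cpoly R n) : V ord0 != 0 -> exists d, vdeg d V.
Proof. by move=> V0; eexists; apply/(vdegP _ V0). Qed.

(** A unitary change of variables takes the last basis vector to [z], and it preserves lowest terms.
    For [n = 0] the sphere is empty. *)
Lemma ball_vector_sphere_neq0 n N (V : 'I_N.+1 -> cpoly R n) z : vlowest V -> ball_vector V ->
  nsq z = 1 -> peval (V ord0) z != 0.
Proof.
case: n V z => [|n] V z lV bV z1.
  by move: z1; rewrite /nsq big_ord0 => /esym/eqP; rewrite oner_eq0.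
have [U uU Uz] := unitary_last_column z1.
have [M [pM M1]] := unitary_pseudo_unitary uU.
have V0 : V ord0 != 0 by case: lV.
have [d dV] := vdeg_exists V0; have [sV _] := dV.
have p1 := pseudo_unitary1 R N.
have bV' := ball_vector_tvec p1 pM sV bV.
have V'0 : tvec d 1%:M M V ord0 != 0.
  apply: contraTneq isT => h; have := pv_neq0 (bV'.1 0 _); rewrite h peval0 eqxx => -> //.
  by rewrite nsq0 ltr01.
have [lV' _] := vlowest_tvec (unitmx1 _ _) pM lV dV V'0.
have := no_pole_last lV' bV'.
have e1 : nsq (delta_mx ord_max ord0 : 'cV[C]_n.+1) <= 1 by rewrite -(nsq_unitary _ uU) Uz z1.
have := pv_tvec 1%:M sV (den_neq0 pM e1).
have [-> ->] := M1 (delta_mx ord_max ord0).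
rewrite Uz expr1n scale1r mul1mx => /colP/(_ ord0); rewrite !mxE => -> //.
Qed.

End CimaSuffridge.

(** * Maps represented by vectors *)

Section PolyContinuityBall.
Variables (R : realType) (n : nat).
Local Notation C := (Cplx R).

Lemma peval_continuous (p : cpoly R n) : continuous (peval p : 'cV[C]_n -> C).
Proof.
move=> z; pose T := 'cV[C]_n.
have cX i k : {for z, continuous (fun w : T => w i ord0 ^+ k)}.
  elim: k => [|k IH]; first exact: cst_continuous.
  have -> : (fun w : T => w i ord0 ^+ k.+1) = (fun w : T => w i ord0) \* (fun w : T => w i ord0 ^+ k).
    by apply/funext => w; rewrite exprS.
  by apply: continuousM; [exact: coord_continuous|exact: IH].
have cM (m : multinom n) (s : seq 'I_n) : {for z, continuous (fun w : T => \prod_(i <- s) w i ord0 ^+ m i)}.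
  elim: s => [|i s IH].
    have -> : (fun w : T => \prod_(i <- [::]) w i ord0 ^+ m i) = fun=> 1.
      by apply/funext => w; rewrite big_nil.
    exact: cst_continuous.
  have -> : (fun w : T => \prod_(j <- i :: s) w j ord0 ^+ m j) =
      (fun w : T => w i ord0 ^+ m i) \* (fun w : T => \prod_(j <- s) w j ord0 ^+ m j).
    by apply/funext => w; rewrite big_cons.
  by apply: continuousM; [exact: cX|exact: IH].
have cS (r : seq (multinom n)) : {for z, continuous (fun w : T =>
    \sum_(m <- r) mcoeff m p * \prod_i w i ord0 ^+ m i)}.
  elim: r => [|m r IH].
    have -> : (fun w : T => \sum_(m <- [::]) mcoeff m p * \prod_i w i ord0 ^+ m i) = fun=> 0.
      by apply/funext => w; rewrite big_nil.
    exact: cst_continuous.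
  have -> : (fun w : T => \sum_(m' <- m :: r) mcoeff m' p * \prod_i w i ord0 ^+ m' i) =
      ((fun=> mcoeff m p) \* (fun w : T => \prod_i w i ord0 ^+ m i)) \+
      (fun w : T => \sum_(m' <- r) mcoeff m' p * \prod_i w i ord0 ^+ m' i).
    by apply/funext => w; rewrite big_cons.
  apply: continuousD; last exact: IH.
  by apply: continuousM; [exact: cst_continuous|exact: cM].
have -> : peval p = fun w : T => \sum_(m <- msupp p) mcoeff m p * \prod_i w i ord0 ^+ m i.
  by apply/funext => w; rewrite /peval mevalE.
exact: cS.
Qed.

Lemma nrm_continuous : continuous (@nrm R).
Proof.
move=> z A /nbhs_ballP[e /= e0 hA]; apply/nbhs_nrmP; exists e => // w hw; apply: hA.
rewrite -ball_normE /= distrC; apply: le_lt_trans hw.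
have h1 := nrmD (w - z) z; have h2 := nrmD (z - w) w; rewrite !subrK in h1 h2.
rewrite [nrm (z - w)]nrmB in h2.
by rewrite ler_norml; apply/andP; split; [move: h2; lra|move: h1; lra].
Qed.

Lemma nrm_peval_sqr_continuous (p : cpoly R n) :
  continuous (fun z : 'cV[C]_n => nrm (peval p z) ^+ 2).
Proof.
move=> z; have cp : {for z, continuous (fun z : 'cV[C]_n => nrm (peval p z))}.
  by apply: continuous_comp; [exact: peval_continuous|exact: nrm_continuous].
have -> : (fun w : 'cV[C]_n => nrm (peval p w) ^+ 2) =
    (fun w : 'cV[C]_n => nrm (peval p w)) \* (fun w : 'cV[C]_n => nrm (peval p w)).
  by apply/funext => w; rewrite expr2.
by apply: continuousM; exact: cp.
Qed.

Lemma nsq_continuous : continuous (@nsq R n).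
Proof.
move=> z; rewrite /nsq; apply: continuous_sumr => j.
have -> : (fun w : 'cV[C]_n => nrm (w j ord0) ^+ 2) =
    (fun w : 'cV[C]_n => nrm (peval (mpolyX C (mnm1 j)) w) ^+ 2).
  by apply/funext => w; rewrite pevalX.
exact: nrm_peval_sqr_continuous.
Qed.

Lemma qf_pv_continuous N (V : 'I_N.+1 -> cpoly R n) :
  continuous (fun z : 'cV[C]_n => qf (pv V z)).
Proof.
move=> z.
have -> : (fun w => qf (pv V w)) = (fun w : 'cV[C]_n => nrm (peval (V ord0) w) ^+ 2) \-
    (fun w : 'cV[C]_n => \sum_j nrm (peval (V (lift ord0 j)) w) ^+ 2).
  apply/funext => w; rewrite /qf /nsq mxE; congr (_ - _).
  by apply: eq_bigr => j _; rewrite !mxE.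
apply: continuousB; first exact: nrm_peval_sqr_continuous.
by apply: continuous_sumr => j; exact: nrm_peval_sqr_continuous.
Qed.

Lemma continuous_vcont (F : 'cV[C]_n -> R) z : {for z, continuous F} -> vcont F z.
Proof.
move=> h e e0; have /cvgrPdist_lt/(_ e e0)/nbhs_nsqP[d d0 hd] := h.
by exists d => // w /hd; rewrite distrC.
Qed.

End PolyContinuityBall.

Section Represents.
Variables (R : realType) (n N : nat).
Local Notation C := (Cplx R).
Implicit Types (V : 'I_N.+1 -> cpoly R n) (f : 'cV[C]_n -> 'cV[C]_N).

(** The data carried through every change of coordinates; of properness only [ball_vector] is
    kept. *)
Definition represents d f V :=
  [/\ maps_ball f, holomorphic_on_ball f,
      is_fraction f (fun i => V (lift ord0 i)) (V ord0) &
      [/\ vlowest V, ball_vector V & vdeg d V]].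

Lemma vecp_lift P G : (fun i => @vecp R n N P G (lift ord0 i)) = P.
Proof. by apply/funext => i; rewrite vecpS. Qed.

Lemma rational_represents d f : rational_proper_map d f -> exists V, represents d f V.
Proof.
move=> [[mf pf] hf [p [g [fr lo de]]]]; exists (vecp p g).
have V0 : vecp p g ord0 != 0 by rewrite vecp0; case: lo.
split=> //; first by rewrite vecp_lift vecp0.
split.
- by apply/vlowestP; rewrite vecp_lift vecp0.
- by apply: proper_ball_vector; [split; [exact: mf|exact: pf]|rewrite vecp_lift vecp0].
- by apply/(vdegP _ V0); rewrite vecp_lift vecp0.
Qed.

Lemma qfE V z f : is_fraction f (fun i => V (lift ord0 i)) (V ord0) -> nsq z < 1 ->
  qf (pv V z) = nrm (peval (V ord0) z) ^+ 2 * (1 - nsq (f z)).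
Proof. by move=> /is_fraction_pv h /h[_ ->]; rewrite qfZ qf_homv. Qed.

Lemma represents_neq0 d f V z : represents d f V -> nsq z <= 1 -> peval (V ord0) z != 0.
Proof.
move=> [_ _ _ [lV bV _]]; rewrite le_eqVlt => /orP[/eqP|] z1.
  exact: ball_vector_sphere_neq0.
exact/pv_neq0/bV.1.
Qed.

Lemma represents_ext d f f' V : (forall z, unit_ball z -> f z = f' z) -> holomorphic_on_ball f' ->
  represents d f V -> represents d f' V.
Proof.
move=> E hf' [mf hf fr l]; split=> // z zb; first by rewrite -E //; exact: mf.
by rewrite -E //; exact: fr.
Qed.

Lemma represents_unique d f V V' : represents d f V -> vlowest V' ->
  is_fraction f (fun i => V' (lift ord0 i)) (V' ord0) ->
  represents d f V' /\ exists2 c : C, c != 0 & forall i, V' i = c *: V i.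
Proof.
move=> [mf hf fr [lV bV dV]] lV' fr'.
have [c c0 Ec] := vlowest_unique lV lV' fr fr'; split; last by exists c.
have Epv z : pv V' z = c *: pv V z by apply/colP => i; rewrite !mxE Ec pevalZ.
split=> //; split=> //.
  split=> z hz; rewrite Epv qfZ; last by rewrite bV.2 ?mulr0.
  by rewrite mulr_gt0 ?exprn_gt0 ?nrm_gt0 // bV.1.
have ms i : msize (V' i) = msize (V i) by rewrite Ec msizeZ.
by case: dV => h [i hi]; split=> [j|]; [rewrite ms|exists i; rewrite ms].
Qed.

Lemma represents_scale d f V (c : C) : c != 0 -> represents d f V ->
  represents d f (fun i => c *: V i).
Proof.
move=> c0 rV; have [mf hf fr [[V0 lV] bV dV]] := rV.
have [] := represents_unique (V' := fun i => c *: V i) rV; [split|move=> z zb|by []].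
- by rewrite scaler_eq0 negb_or c0.
- move=> h hh; apply: lV => i; have [k Ek] := hh i; exists (c^-1 *: k).
  by rewrite -scalerAl -Ek scalerA mulVf // scale1r.
- have [g0 ->] := fr z zb; rewrite pevalZ mulf_neq0 //; split=> //.
  by apply/colP => i; rewrite !mxE !pevalZ -mulf_div divff // mul1r.
Qed.

(** The factor [den T] does not vanish because [f] maps into the ball. The second part keeps all the
    factors explicit, for the comparison of denominators in [normalized_equivalent]. *)
Lemma represents_tvec d f V T M : pseudo_unitary T -> pseudo_unitary M -> represents d f V ->
  represents d (fun z => act T (f (act M z))) (tvec d T M V) /\
  forall z, nsq z < 1 -> pv (tvec d T M V) z =
    (den M z ^+ d * peval (V ord0) (act M z) * den T (f (act M z))) *:
      homv (act T (f (act M z))).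
Proof.
move=> pT pM [mf hf /is_fraction_pv fr [lV bV dV]]; have [sV _] := dV; have [uT _] := pT.
have aM z : nsq z < 1 -> nsq (act M z) < 1 by move=> h; apply/unit_ballE/act_ball => //; apply/unit_ballE.
have fM z : nsq z < 1 -> nsq (f (act M z)) < 1.
  by move=> /aM/unit_ballE/mf/unit_ballE.
have pvE z : nsq z < 1 -> pv (tvec d T M V) z =
    (den M z ^+ d * peval (V ord0) (act M z) * den T (f (act M z))) *:
      homv (act T (f (act M z))).
  move=> z1; have d0 := den_neq0 pM (ltW z1).
  rewrite pv_tvec // (fr _ (aM _ z1)).2 -scalemxAr act_homv ?scalerA ?mulrA //.
  exact/(den_neq0 pT)/ltW/fM.
split=> //.
have bV' := ball_vector_tvec pT pM sV bV.
have V'0 : tvec d T M V ord0 != 0.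
  apply: contraTneq isT => h; have := pv_neq0 (bV'.1 0 _); rewrite h peval0 eqxx => -> //.
  by rewrite nsq0 ltr01.
have [lV' dV'] := vlowest_tvec uT pM lV dV V'0.
split; [|..|by split].
- by move=> z /unit_ballE/fM z1; apply: act_ball => //; apply/unit_ballE.
- move=> z /unit_ballE z1; apply: (@differentiable_comp _ _ _ _ (fun z => f (act M z)) (act T)).
    apply: (@differentiable_comp _ _ _ _ (act M) f).
      exact/act_differentiable/den_neq0/ltW.
    exact/hf/unit_ballE/aM.
  exact/act_differentiable/(den_neq0 pT)/ltW/fM.
apply/is_fraction_pv => z z1; have E := pvE z z1.
have E0 : peval (tvec d T M V ord0) z =
    den M z ^+ d * peval (V ord0) (act M z) * den T (f (act M z)).
  by have /colP/(_ ord0) := E; rewrite mxE [in RHS]mxE homv0 mulr1.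
by rewrite E E0; split=> //; rewrite -E0; exact/pv_neq0/bV'.1.
Qed.

(* Schwarz' lemma, in the form [1 - |f|^2 >= 1 - |z|^2]. *)
Lemma represents_schwarz d f V z : represents d f V -> f 0 = 0 -> nsq z < 1 ->
  nrm (peval (V ord0) z) ^+ 2 * (1 - nsq z) <= qf (pv V z).
Proof.
move=> [mf hf fr _] f0 z1; rewrite (qfE fr z1) ler_wpM2l ?sqr_ge0 //.
by have := schwarz_ball mf hf f0 z1; lra.
Qed.

Lemma represents_boost d f V : represents d f V -> exists T, pseudo_unitary T /\
  act T (f 0) = 0.
Proof.
move=> [mf _ _ _]; have /unit_ballE h := mf _ (unit_ball0 R n).
by have [T [pT T0 _]] := boost_exists h; exists T.
Qed.

End Represents.

(** * The minimum of the invariant function *)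

Section Minimum.
Variables (R : realType) (n N : nat).
Local Notation C := (Cplx R).
Implicit Types (V : 'I_N.+1 -> cpoly R n) (f : 'cV[C]_n -> 'cV[C]_N).

Lemma qf_pv_fix0 d f V : represents d f V -> f 0 = 0 -> qf (pv V 0) = nrm (peval (V ord0) 0) ^+ 2.
Proof.
by move=> [_ _ fr _] f0; rewrite (qfE fr) ?nsq0 ?ltr01 // f0 nsq0 subr0 mulr1.
Qed.

(* The minimum of [qf (pv V z) / (1 - |z|^2)^d] is attained: this function is at least
   [kappa (1 - |z|^2)^(1-d)] where [kappa > 0] is the minimum of [|V_0|^2] on the closed ball. *)
Lemma represents_min d f V : represents d f V -> (1 < d)%N -> f 0 = 0 ->
  exists2 z0, nsq z0 < 1 & forall z, nsq z < 1 ->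
    qf (pv V z0) * (1 - nsq z) ^+ d <= qf (pv V z) * (1 - nsq z0) ^+ d.
Proof.
move=> rV d1 f0.
pose L (z : 'cV[C]_n) := qf (pv V z) / (1 - nsq z) ^+ d.
have [zk zk1 hk] := @nsq_ball_min R n (fun z => nrm (peval (V ord0) z) ^+ 2) 1 ler01
  (fun z _ => continuous_vcont (@nrm_peval_sqr_continuous R n (V ord0) z)).
set k := nrm _ ^+ 2 in hk.
have k0 : 0 < k by rewrite exprn_gt0 // nrm_gt0; exact: represents_neq0 rV zk1.
pose l := nrm (peval (V ord0) 0) ^+ 2.
have kl : k <= l by apply: hk; rewrite nsq0 ler01.
have l0 : 0 < l := lt_le_trans k0 kl.
have L0 : L 0 = l by rewrite /L (qf_pv_fix0 rV f0) nsq0 subr0 expr1n divr1.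
(* Where |z|^2 > rho, Schwarz' lemma and d >= 2 give L(z) >= k / (1 - |z|^2) > l = L(0); so a
   minimum on the compact ball |z|^2 <= rho is one on the whole open ball. *)
pose rho := 1 - k / l.
have rho0 : 0 <= rho by rewrite subr_ge0 ler_pdivrMr ?mul1r.
have rho1 : rho < 1 by rewrite ltrBlDr ltrDl divr_gt0.
have t0 z : nsq z <= rho -> 0 < 1 - nsq z.
  by move=> h; rewrite subr_gt0; exact: le_lt_trans h rho1.
have [z zr|z0 z0r hz0] := @nsq_ball_min R n L rho rho0.
  apply: continuous_vcont.
  have -> : L = (fun z : 'cV[C]_n => qf (pv V z)) \* (fun z : 'cV[C]_n => ((1 - nsq z) ^+ d)^-1).
    exact/funext.
  apply: continuousM; first exact: qf_pv_continuous.
  apply: continuousV; first by rewrite expf_neq0 // gt_eqF ?t0.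
  elim: d {rV d1 L L0} => [|e IH]; first exact: cst_continuous.
  have -> : (fun z : 'cV[C]_n => (1 - nsq z) ^+ e.+1) =
      (cst 1 \- (@nsq R n)) \* (fun z : 'cV[C]_n => (1 - nsq z) ^+ e).
    by apply/funext => w; rewrite exprS.
  apply: continuousM; last exact: IH.
  by apply: continuousB; [exact: cst_continuous|exact: nsq_continuous].
exists z0; first exact: le_lt_trans z0r rho1.
move=> z z1; have tz : 0 < 1 - nsq z by rewrite subr_gt0.
suff Lz : L z0 <= L z.
  by move: Lz; rewrite /L ler_pdivrMr ?exprn_gt0 ?t0 // mulrAC ler_pdivlMr ?exprn_gt0.
have [zr|zr] := lerP (nsq z) rho; first exact: hz0.
apply: (@le_trans _ _ (L 0)); first by apply: hz0; rewrite nsq0.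
rewrite L0 /L ler_pdivlMr ?exprn_gt0 //.
apply: le_trans (represents_schwarz rV f0 z1).
apply: (@le_trans _ _ (k * (1 - nsq z))); last by apply: ler_wpM2r; [exact: ltW|exact/hk/ltW].
have tz1 : 1 - nsq z <= 1 by have := nsq_ge0 z; lra.
apply: (@le_trans _ _ (l * (1 - nsq z) ^+ 2)).
  by rewrite ler_pM2l // -(subnK d1) exprD ler_piMl ?exprn_ge0 ?exprn_ile1 ?(ltW tz).
rewrite expr2 mulrA (ler_pM2r tz) mulrC -(ler_pdivlMr _ _ l0).
by move: zr; rewrite /rho; lra.
Qed.

Lemma represents_normalize d f V : represents d f V -> exists psi tau V',
  [/\ ball_automorphism psi, ball_automorphism tau,
      represents d (fun z => tau (f (psi z))) V' &
      [/\ tau (f (psi 0)) = 0, peval (V' ord0) 0 = 1 &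
         (1 < d)%N -> forall z, nsq z < 1 -> (1 - nsq z) ^+ d <= qf (pv V' z)]].
Proof.
move=> rV; have [T1 [pT1 T10]] := represents_boost rV.
have p1 := pseudo_unitary1 R n.
have [rV1 _] := represents_tvec pT1 p1 rV.
set f1 := fun z => _ in rV1; set V1 := tvec _ _ _ _ in rV1.
have f10 : f1 0 = 0 by rewrite /f1 act1.
have [z0 z01 hz0] : exists2 z0, nsq z0 < 1 & (1 < d)%N -> forall z, nsq z < 1 ->
    qf (pv V1 z0) * (1 - nsq z) ^+ d <= qf (pv V1 z) * (1 - nsq z0) ^+ d.
  have [d1|d1] := leqP d 1; first by exists 0; rewrite ?nsq0 ?ltr01.
  by have [z0 z01 h] := represents_min rV1 d1 f10; exists z0.
have [M0 [pM0 M00 _]] := boost_exists z01.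
have pM := pseudo_unitary_inv pM0; set M := invmx M0 in pM.
have M0z : act M 0 = z0 by rewrite -M00 actK //; apply/unit_ballE.
have [T2 [pT2 T20]] : exists T2 : 'M[C]_N.+1, pseudo_unitary T2 /\ act T2 (f1 z0) = 0.
  have [mf1 _ _ _] := rV1; have /mf1/unit_ballE h : unit_ball z0 by apply/unit_ballE.
  by have [T2 [pT2 T20 _]] := boost_exists h; exists T2.
have [rV2 _] := represents_tvec pT2 pM rV1; set V2 := tvec _ _ _ _ in rV2.
have [sV1 _] : vdeg d V1 by case: rV1 => _ _ _ [].
have pvV2 w : nsq w < 1 -> pv V2 w = den M w ^+ d *: (T2 *m pv V1 (act M w)).
  by move=> w1; exact: (pv_tvec T2 sV1 (den_neq0 pM (ltW w1))).
clearbody V2; clearbody V1.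
set f2 := fun z => _ in rV2.
have f20 : f2 0 = 0 by rewrite /f2 M0z.
have n0 : nsq (0 : 'cV[C]_n) < 1 by rewrite nsq0 ltr01.
have c0 : peval (V2 ord0) 0 != 0 by apply: (represents_neq0 rV2); exact: ltW.
set c := peval _ 0 in c0.
have rV3 := represents_scale (invr_neq0 c0) rV2.
exists (act 1%:M \o act M), (act T2 \o act T1), (fun i => c^-1 *: V2 i).
split; try (apply: automorphism_comp; exact: act_automorphism); first exact: rV3.
split; [exact: f20|by rewrite pevalZ mulVf|move=> d1 z z1].
have -> : pv (fun i => c^-1 *: V2 i) z = c^-1 *: pv V2 z.
  by apply/colP => i; rewrite !mxE pevalZ.
have qf2 w : nsq w < 1 -> qf (pv V2 w) = (nrm (den M w) ^+ 2) ^+ d * qf (pv V1 (act M w)).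
  by move=> w1; rewrite pvV2 // qfZ pT2.2 nrmX exprAC.
have n2 w : nsq w < 1 -> (1 - nsq w) ^+ d = (nrm (den M w) ^+ 2) ^+ d * (1 - nsq (act M w)) ^+ d.
  by move=> /ltW w1; rewrite (nsq_act pM w1) exprMn.
have w1 : nsq (act M z) < 1 by apply/unit_ballE/act_ball => //; apply/unit_ballE.
have cE : nrm c ^+ 2 = (nrm (den M 0) ^+ 2) ^+ d * qf (pv V1 z0).
  by have := qf_pv_fix0 rV2 f20; rewrite (qf2 _ n0) M0z; exact: esym.
have dE : 1 = (nrm (den M 0) ^+ 2) ^+ d * (1 - nsq z0) ^+ d.
  by rewrite -M0z -n2 // nsq0 subr0 expr1n.
rewrite qfZ nrmV exprVn mulrC ler_pdivlMr ?exprn_gt0 ?nrm_gt0 // cE (n2 z z1) (qf2 z z1).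
have a0 : 0 <= (nrm (den M z) ^+ 2) ^+ d by rewrite exprn_ge0 ?sqr_ge0.
have e0 : 0 <= (nrm (den M 0) ^+ 2) ^+ d by rewrite exprn_ge0 ?sqr_ge0.
have gen (a e s b q0 q1 : R) : 0 <= a -> 0 <= e -> 1 = e * s -> q0 * b <= q1 * s ->
    a * b * (e * q0) <= a * q1.
  move=> ha he es h; have -> : a * q1 = a * e * (q1 * s) by rewrite [RHS]mulrACA -es mulr1.
  by rewrite (_ : a * b * (e * q0) = a * e * (q0 * b)); [rewrite ler_wpM2l ?mulr_ge0|ring].
exact: (gen _ _ _ _ _ _ a0 e0 dE (hz0 d1 _ w1)).
Qed.

End Minimum.

Section LinearTerm.
Variable R : realType.
Local Notation C := (Cplx R).

Lemma bernoulli_sub (x : R) d : 0 <= x -> x <= 1 -> 1 - d%:R * x <= (1 - x) ^+ d.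
Proof.
move=> x0 x1; elim: d => [|d IH]; first by rewrite mul0r subr0 expr0.
have : (1 - d%:R * x) * (1 - x) <= (1 - x) ^+ d.+1 by rewrite exprSr ler_wpM2r // subr_ge0.
apply: le_trans; rewrite -natr1; have : 0 <= d%:R * (x * x) by rewrite !mulr_ge0.
by nra.
Qed.

(** In the unit direction [w] with c w = -|c|, |A|^2 decreases linearly in r, whereas (1 - r^2)^d
    decreases only quadratically. *)
Lemma poly_linear_eq0 (A : {poly C}) d : A`_0 = 1 ->
  (forall t, 0 < nrm t -> nrm t < 1 -> (1 - nrm t ^+ 2) ^+ d <= nrm A.[t] ^+ 2) -> A`_1 = 0.
Proof.
move=> A0 h; apply/eqP; apply: contrapT => /negP; set c := A`_1 => c0.
pose m := nrm c; have m0 : 0 < m by rewrite nrm_gt0.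
pose B := \poly_(i < size A) A`_i.+2.
have AE : A = 1 + c *: 'X + 'X^2 * B.
  apply/polyP => i; rewrite !coefD coefZ coef1 coefX coefXnM coef_poly.
  case: i => [|[|i]] /=; rewrite ?A0 ?mulr0 ?mulr1 ?addr0 ?add0r //.
  rewrite subn2 /=; case: ltnP => // hi; apply: nth_default; apply: leq_trans hi _.
  by rewrite ltnW.
pose K := \sum_(i < size B) nrm B`_i.
have K0 : 0 <= K by apply: sumr_ge0 => i _; exact: nrm_ge0.
have BK t : nrm t <= 1 -> nrm B.[t] <= K.
  move=> t1; rewrite horner_coef; apply: le_trans (nrm_sum _ _ _) _; apply: ler_sum => i _.
  by rewrite nrmM nrmX ler_piMr ?nrm_ge0 // exprn_ile1 ?nrm_ge0.
(* These bounds make both K r and d r at most m / 4 and keep 1 - m r nonnegative. *)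
pose r := Num.min (2^-1) (Num.min (m / (4 * (K + 1))) (Num.min (m / (4 * (d%:R + 1))) (2 * m)^-1)).
have K1 : 0 < 4 * (K + 1) by rewrite mulr_gt0 // ltr_wpDl.
have d1 : 0 < 4 * (d%:R + 1) :> R by rewrite mulr_gt0 // ltr_wpDl.
have r0 : 0 < r.
  by rewrite !lt_min invr_gt0 ltr0n !divr_gt0 //= invr_gt0 mulr_gt0.
have : r <= r by []. rewrite {2}/r !le_min => /and4P[r1 r2 r3 r4].
pose w : C := - (c^* * toC m^-1).
have cw : c * w = - toC m.
  by rewrite mulrN mulrA mulCconj -rmorphM /= -/m expr2 mulfK ?gt_eqF.
have w1 : nrm w = 1.
  by rewrite nrmN nrmM nrm_conj nrm_toC gtr0_norm ?invr_gt0 // divff // gt_eqF.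
pose t := w * toC r.
have nt : nrm t = r by rewrite nrmM w1 mul1r nrm_toC gtr0_norm.
have rl1 : r < 1 by apply: le_lt_trans r1 _; rewrite invf_lt1 // ltr1n.
have := h t; rewrite nt => /(_ r0 rl1).
have r21 : r ^+ 2 <= 1 by rewrite exprn_ile1 ?ltW.
have := bernoulli_sub d (sqr_ge0 r) r21.
have At : nrm A.[t] <= 1 - m * r + K * r ^+ 2.
  rewrite AE !hornerD hornerM hornerXn hornerZ hornerX hornerC.
  apply: le_trans (nrmD _ _) _; apply: lerD.
    rewrite /t mulrA cw mulNr -rmorphM -(rmorph1 (@toC R)) -rmorphB /= nrm_toC ger0_norm //.
    rewrite subr_ge0; have := ler_wpM2l (ltW m0) r4; rewrite invfM mulrCA divff ?gt_eqF // mulr1.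
    by move=> /le_trans; apply; rewrite invf_le1 // ler1n.
  by rewrite nrmM nrmX nt mulrC ler_wpM2r ?sqr_ge0 // BK // nt ltW.
have {}r2 : (K + 1) * r <= m / 4.
  by move: r2; rewrite invfM mulrA ler_pdivlMr ?ltr_wpDl // mulrC.
have {}r3 : (d%:R + 1) * r <= m / 4.
  by move: r3; rewrite invfM mulrA ler_pdivlMr ?ltr_wpDl // mulrC.
have := nrm_ge0 A.[t].
move: (nrm A.[t]) At => a At a0 b1 b2.
have d0 : 0 <= d%:R :> R by exact: ler0n.
have a1 : a <= 1 - m * r / 2 by nra.
have mr : 0 < m * r by exact: mulr_gt0.
have a2 : a ^+ 2 <= a by rewrite expr2 ler_piMl //; lra.
have : d%:R * r ^+ 2 >= m * r / 2 by lra.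
by nra.
Qed.

End LinearTerm.

(** * Existence of the normal form *)

Section HomogParts.
Variables (R : realType) (n : nat).
Local Notation C := (Cplx R).
Implicit Types (p q : cpoly R n) (v z : 'cV[C]_n).

Lemma on_line_scale v p (c : C) : on_line 0 (c *: v) p = on_line 0 v p \Po (c *: 'X).
Proof.
apply/subr0_eq/(@poly_eq0_near0 R _ 1) => // t _ _.
by rewrite hornerD hornerN horner_comp hornerZ hornerX !on_lineE scalerA [c * _]mulrC subrr.
Qed.

Lemma homog_part_scale k p v (c : C) :
  peval (homog_part k p) (c *: v) = c ^+ k * peval (homog_part k p) v.
Proof. by rewrite -!on_line0_coef on_line_scale coef_comp_scaleX. Qed.

Lemma homog_part_eq0_sphere k p : (0 < k)%N ->
  (forall v, nsq v = 1 -> peval (homog_part k p) v = 0) -> homog_part k p = 0.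
Proof.
move=> k0 h; apply: mpoly_eq0_ball => z _.
have [z0|z0] := eqVneq (nsq z) 0.
  by rewrite (nsq_eq0 z0) -(scale0r (0 : 'cV[C]_n)) homog_part_scale expr0n gtn_eqF // mul0r.
pose r := Num.sqrt (nsq z); have r2 : r ^+ 2 = nsq z by rewrite sqr_sqrtr ?nsq_ge0.
have r0 : r != 0 by rewrite -sqrf_eq0 r2.
have -> : z = toC r *: ((toC r)^-1 *: z) by rewrite scalerA divff ?scale1r ?toC_eq0.
rewrite homog_part_scale h ?mulr0 // nsqZ nrmV nrm_toC exprVn real_normK ?num_real // r2.
by rewrite mulVf.
Qed.

Lemma mdeg2_monomial (m : multinom n) : mdeg m = 2%N ->
  exists i j, forall v, peval (mpolyX C m) v = v i ord0 * v j ord0.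
Proof.
have split1 (m' : multinom n) k : mdeg m' = k.+1 -> exists i m1, mdeg m1 = k /\
    forall v, peval (mpolyX C m') v = v i ord0 * peval (mpolyX C m1) v.
  move=> mk; have [i mi] : exists i, m' i != 0%N.
    apply: contrapT => h; move: mk; rewrite mdegE big1 // => i _.
    by apply/eqP; apply: contrapT => /negP hi; apply: h; exists i.
  have Em : mnm_add (mnm_sub m' (mnm1 i)) (mnm1 i) = m' by apply: submK; rewrite lep1mP.
  exists i, (mnm_sub m' (mnm1 i)); split.
    by have := mk; rewrite -{1}Em mdegD mdeg1 addn1 => -[].
  by move=> v; rewrite -{1}Em mpolyXD pevalM pevalX mulrC.
move=> /split1[i [m1 [/split1[j [m2 [/eqP]]]]]]; rewrite mdeg_eq0 => /eqP -> h2 h1.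
by exists i, j => v; rewrite h1 h2 mpolyX0 peval1 mulr1.
Qed.

(** Each monomial z_i z_j is shared evenly between the entries (i, j) and (j, i). *)
Lemma homog2_symmetric p : exists2 S : 'M[C]_n, S^T = S &
  forall v, peval (homog_part 2 p) v = (v^T *m S *m v) ord0 ord0.
Proof.
pose Q q := exists2 S : 'M[C]_n, S^T = S & forall v, peval q v = (v^T *m S *m v) ord0 ord0.
suff : Q (homog_part 2 p) by [].
rewrite /homog_part pihomogE; apply: (big_ind Q).
- by exists 0; rewrite ?trmx0 // => v; rewrite mulmx0 mul0mx mxE peval0.
- move=> q q' [S tS hS] [S' tS' hS']; exists (S + S'); first by rewrite linearD /= tS tS'.
  by move=> v; rewrite pevalD hS hS' mulmxDr mulmxDl [RHS]mxE.
move=> m /eqP /mdeg2_monomial[i [j hm]]; set c := mcoeff _ _.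
exists ((c / 2) *: (delta_mx i j + delta_mx j i)).
  by rewrite linearZ /= linearD /= !trmx_delta addrC.
have E (v : 'cV[C]_n) k l : (v^T *m delta_mx k l *m v) ord0 ord0 = v k ord0 * v l ord0.
  rewrite -mulmxA mxE (bigD1 k) //= big1 ?addr0 => [|s sk].
    rewrite mxE; congr (_ * _); rewrite mxE (bigD1 l) //= big1 ?addr0 => [|s sl].
      by rewrite mxE !eqxx mul1r.
    by rewrite mxE (negPf sl) andbF mul0r.
  by rewrite [X in _ * X]mxE big1 ?mulr0 // => l' _; rewrite mxE (negPf sk) mul0r.
have D (v : 'cV[C]_n) : (v^T *m (delta_mx i j + delta_mx j i) *m v) ord0 ord0 =
    v i ord0 * v j ord0 + v j ord0 * v i ord0.
  by rewrite mulmxDr mulmxDl [LHS]mxE (E v i j) (E v j i).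
move=> v; rewrite pevalZ hm -scalemxAr -scalemxAl [RHS]mxE D.
have two : (2 : C) != 0 by rewrite pnatr_eq0.
by transitivity (c / 2 * 2 * (v i ord0 * v j ord0)); [rewrite divfK|ring].
Qed.

End HomogParts.

Section Existence.
Variables (R : realType) (n N : nat).
Hypothesis n_gt0 : (0 < n)%N.
Local Notation C := (Cplx R).
Implicit Types (V : 'I_N.+1 -> cpoly R n) (f : 'cV[C]_n -> 'cV[C]_N).

Lemma represents_lift0 d f V i : represents d f V -> f 0 = 0 -> peval (V (lift ord0 i)) 0 = 0.
Proof.
move=> [_ _ fr _] f0; have [g0] := fr 0 (unit_ball0 R n); rewrite f0 => /colP/(_ i) /eqP.
by rewrite !mxE eq_sym mulf_eq0 invr_eq0 (negPf g0) orbF => /eqP.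
Qed.

(* On a complex line through [0] the top coefficient of [V_0] is orthogonal, by the circle
   identity, to its constant term, since the other [V_i] vanish at [0]. *)
Lemma represents_deg d f V : represents d f V -> f 0 = 0 ->
  (0 < d)%N /\ (msize (V ord0) <= d)%N.
Proof.
move=> rV f0; have [_ _ _ [_ [_ sph] [sV _]]] := rV.
have V00 : peval (V ord0) 0 != 0 by apply: (represents_neq0 rV); rewrite nsq0 ler01.
have key v : nsq v = 1 -> peval (homog_part d (V ord0)) v = 0.
  move=> v1.
  have := @circle_coef R N (on_line 0 v (V ord0)) (fun i => on_line 0 v (V (lift ord0 i))) d d
    (leq_trans (size_on_line _ _ _) (sV _)) (fun i => leq_trans (size_on_line _ _ _) (sV _)) _ (leqnn d).
  have lineE p : (on_line 0 v p)`_0 = peval p 0.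
    by rewrite -horner_coef0 on_lineE scale0r addr0.
  rewrite subnn big_ord1 add0n lineE => E; apply/eqP.
  have {E} : peval (V ord0) 0 * ((on_line 0 v (V ord0))`_d)^* = 0.
    rewrite E ?big1 // => [i _|w w1].
      by rewrite big_ord1 lineE (represents_lift0 _ rV) // mul0r.
    have := sph (w *: v); rewrite nsqZ w1 v1 expr1n mulr1 => /(_ erefl).
    rewrite /qf mxE => /subr0_eq; rewrite !on_lineE add0r => ->.
    by apply: eq_bigr => i _; rewrite !mxE on_lineE add0r.
  by move=> /eqP; rewrite mulf_eq0 (negPf V00) /= conjC_eq0 on_line0_coef.
have d0 : (0 < d)%N.
  rewrite lt0n; apply: contraTneq isT => d0; rewrite d0 in key.
  pose v : 'cV[C]_n := delta_mx (Ordinal n_gt0) ord0.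
  have v1 : nsq v = 1.
    rewrite /nsq (bigD1 (Ordinal n_gt0)) //= mxE !eqxx nrm1 expr1n big1 ?addr0 // => i /negPf hi.
    by rewrite mxE hi nrm0 expr0n.
  have := key v v1; rewrite -on_line0_coef -horner_coef0 on_lineE scale0r addr0 => h.
  by rewrite h eqxx in V00.
split=> //; apply: msize_le_homog; first exact: sV.
exact: homog_part_eq0_sphere.
Qed.

(** The form is at most |V_0|^2, so minimality at 0 bounds |V_0|^2 from below on each line through
    0, as [poly_linear_eq0] requires. For d <= 1 the denominator is constant. *)
Lemma represents_homog1 d f V : represents d f V -> f 0 = 0 -> peval (V ord0) 0 = 1 ->
  ((1 < d)%N -> forall z, nsq z < 1 -> (1 - nsq z) ^+ d <= qf (pv V z)) ->
  homog_part 1 (V ord0) = 0.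
Proof.
move=> rV f0 V0 hmin; have [d0 sV] := represents_deg rV f0.
have [d1|d1] := ltnP 1 d; last first.
  apply: mpoly_eq0_ball => z _; rewrite -on_line0_coef nth_default //.
  exact: leq_trans (size_on_line _ _ _) (leq_trans sV d1).
apply: mpoly_eq0_ball => z /unit_ballE z1; rewrite -on_line0_coef.
apply: (@poly_linear_eq0 _ _ d).
  by rewrite -horner_coef0 on_lineE scale0r addr0.
move=> t t0 t1; rewrite on_lineE add0r.
have tz : nrm t ^+ 2 * nsq z <= nrm t ^+ 2 by rewrite ler_piMr ?sqr_ge0 // ltW.
have t2 : nrm t ^+ 2 < 1 by rewrite expr_lt1 ?nrm_ge0.
have tz1 : nsq (t *: z) < 1 by rewrite nsqZ; exact: le_lt_trans tz t2.
apply: le_trans (_ : (1 - nsq (t *: z)) ^+ d <= _).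
  rewrite nsqZ lerXn2r ?nnegrE; [|by move: t2; lra|by move: tz t2; lra|by lra].
  by move: tz; lra.
apply: le_trans (hmin d1 _ tz1) _.
by rewrite /qf mxE lerBlDr lerDl nsq_ge0.
Qed.

Lemma homog0_const (p : cpoly R n) : peval p 0 = 1 -> homog_part 0 p = 1.
Proof.
move=> p0; apply: mpoly_eq_ball => z _; rewrite -on_line0_coef -horner_coef0 on_lineE scale0r addr0.
by rewrite p0 peval1.
Qed.

Lemma normal_form_exists d f : rational_proper_map d f ->
  exists sigma : 'I_n -> R, has_normal_form d f sigma.
Proof.
move=> /rational_represents[V0 rV0].
have [psi [tau [V1 [apsi atau rV1 [f10 V10 hmin]]]]] := represents_normalize rV0.
have [S tS hS] := homog2_symmetric (V1 ord0).
have [U [s [uU s0 sS ES]]] := takagi tS; exists s.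
have [M [pM hM]] := unitary_pseudo_unitary uU.
have p1 := pseudo_unitary1 R N.
have [rV2 _] := represents_tvec p1 pM rV1.
have [sV1 _] : vdeg d V1 by case: rV1 => _ _ _ [].
have pvV2 z : peval (tvec d 1%:M M V1 ord0) z = peval (V1 ord0) (U *m z).
  have [d1 aM] := hM z; have dz : den M z != 0 by rewrite d1 oner_neq0.
  have := pv_tvec 1%:M sV1 dz; rewrite d1 aM expr1n scale1r mul1mx => /colP/(_ ord0).
  by rewrite !mxE.
set V2 := tvec _ _ _ _ in rV2 pvV2; clearbody V2.
set f2 := fun z => _ in rV2.
have aM0 : act M 0 = 0 by rewrite (hM 0).2 mulmx0.
have f20 : f2 0 = 0 by rewrite /f2 aM0 f10 act1.
have V20 : peval (V2 ord0) 0 = 1 by rewrite pvV2 mulmx0.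
have [d0 sV2] := represents_deg rV2 f20.
have lineE v : on_line 0 v (V2 ord0) = on_line 0 (U *m v) (V1 ord0).
  apply/subr0_eq/(@poly_eq0_near0 R _ 1) => // t _ _.
  by rewrite hornerD hornerN !on_lineE pvV2 !add0r -scalemxAr subrr.
have h1 : homog_part 1 (V2 ord0) = 0.
  apply: mpoly_eq0_ball => z _; rewrite -on_line0_coef lineE on_line0_coef.
  by rewrite (represents_homog1 rV1) ?peval0.
have h2v v : peval (homog_part 2 (V2 ord0)) v = \sum_k toC (s k) * v k ord0 ^+ 2.
  rewrite -on_line0_coef lineE on_line0_coef hS trmx_mul !mulmxA.
  have -> : v^T *m U^T *m S *m U = v^T *m diag_mx (\row_i toC (s i)) by rewrite -ES !mulmxA.
  rewrite mul_mx_diag mxE; apply: eq_bigr => k _; rewrite !mxE; ring.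
have h2 : homog_part 2 (V2 ord0) = \sum_(k < n) toC (s k) *: mpolyX C (mnm1 k) ^+ 2.
  apply: mpoly_eq_ball => z _; rewrite h2v peval_sum; apply: eq_bigr => k _.
  by rewrite pevalZ pevalXn pevalX.
split.
  (* On the line through the k-th basis vector the quadratic coefficient is the k-th sigma and the
     denominator has no zero in the disc; [coef2_bound] applies with m = d - 1. *)
  split=> // k; pose e : 'cV[C]_n := delta_mx k ord0.
  have e1 : nsq e = 1.
    rewrite /nsq (bigD1 k) //= mxE !eqxx nrm1 expr1n big1 ?addr0 // => i /negPf hi.
    by rewrite mxE hi nrm0 expr0n.
  have := @coef2_bound R (on_line 0 e (V2 ord0)) d.-1.
  rewrite !on_line0_coef h1 peval0 homog0_const // peval1 prednK // h2v.
  have -> : \sum_i toC (s i) * e i ord0 ^+ 2 = toC (s k).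
    rewrite (bigD1 k) //= big1 ?addr0 => [|i /negPf hi]; first by rewrite mxE !eqxx expr1n mulr1.
    by rewrite mxE hi expr0n mulr0.
  rewrite nrm_toC ger0_norm // -subn1 natrB //; apply=> //.
    exact: leq_trans (size_on_line _ _ _) sV2.
  move=> t t1; rewrite on_lineE add0r; apply: (represents_neq0 rV2).
  by rewrite nsqZ e1 mulr1 expr_le1 ?nrm_ge0 // ltW.
exists (psi \o act M), (act 1%:M \o tau), (fun i => V2 (lift ord0 i)), (V2 ord0); split.
- by apply: automorphism_comp => //; exact: act_automorphism.
- by apply: automorphism_comp => //; exact: act_automorphism.
- by case: rV2.
split=> //.
- by apply/vlowestP; case: rV2 => _ _ _ [].
- by move=> i; exact: represents_lift0 rV2 f20.
- by split; [exact: homog0_const|exact: h1].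
Qed.

End Existence.

(** * Uniqueness of the normal form *)

Section Isometries.
Variable R : realType.
Local Notation C := (Cplx R).

Local Open Scope sesquilinear_scope.

(** [U] takes the range of [A] to that of [B] and matches their orthogonal complements arbitrarily.
    This serves in degree 1, where normal forms are linear isometries. *)
Lemma isometry_extend n N (A B : 'M[C]_(N, n)) : (forall v, nsq (A *m v) = nsq v) ->
  (forall v, nsq (B *m v) = nsq v) -> exists2 U : 'M[C]_N, U \is unitarymx & U *m A = B.
Proof.
have adj (A' : 'M[C]_(N, n)) : (forall v, nsq (A' *m v) = nsq v) -> A' ^t* \is unitarymx.
  by move=> h; apply/unitarymxP; rewrite trmxCK; exact: isometry_adjoint.
move=> /adj/unitary_extend[k [W [kn uX]]] /adj/unitary_extend[k' [W' [kn' uY]]].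
have ek : k' = k by apply: (@addnI n); rewrite kn.
subst k'; subst N.
set X := col_mx _ W in uX; set Y := col_mx _ W' in uY.
have colE (A' : 'M[C]_(n + k, n)) (W1 : 'M[C]_(k, n + k)) :
    (col_mx (A' ^t*) W1) ^t* *m col_mx 1%:M 0 = A'.
  by rewrite tr_col_mx map_row_mx trmxCK mul_row_col mulmx1 mulmx0 addr0.
exists (Y ^t* *m X).
  by apply: mul_unitarymx; rewrite ?trmxC_unitary.
rewrite -[in LHS](colE A W) -/X -mulmxA [X *m _]mulmxA (unitarymxP uX) mul1mx.
exact: colE.
Qed.

Lemma symmetric_form_eq n (S S' : 'M[C]_n) : S^T = S -> S'^T = S' ->
  (forall z, unit_ball z -> (z^T *m S *m z) ord0 ord0 = (z^T *m S' *m z) ord0 ord0) -> S = S'.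
Proof.
move=> tS tS' h0.
have h (z : 'cV[C]_n) : (z^T *m S *m z) ord0 ord0 = (z^T *m S' *m z) ord0 ord0.
  pose t : R := (1 + nsq z)^-1; have nz := nsq_ge0 z.
  have p0 : 0 < 1 + nsq z by lra.
  have t0 : 0 < t by rewrite invr_gt0.
  have E (T : 'M[C]_n) : ((toC t *: z)^T *m T *m (toC t *: z)) ord0 ord0 =
      toC t ^+ 2 * (z^T *m T *m z) ord0 ord0.
    by rewrite [(toC t *: z)^T]linearZ /= -!scalemxAl -scalemxAr scalerA mxE expr2.
  have tz : unit_ball (toC t *: z).
    apply/unit_ballE; rewrite nsqZ nrm_toC gtr0_norm //.
    have t1 : t * (1 + nsq z) = 1 by rewrite mulVf ?gt_eqF.
    have : t * nsq z < 1 by lra.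
    have : t <= 1 by rewrite invf_le1 //; lra.
    by have := mulr_ge0 (ltW t0) nz; nra.
  have := h0 _ tz; rewrite !E => /(mulfI _); apply.
  by rewrite expf_neq0 // toC_eq0 gt_eqF.
have E (T : 'M[C]_n) (i j : 'I_n) : ((delta_mx i ord0 : 'cV[C]_n)^T *m T *m (delta_mx j ord0 : 'cV[C]_n)) ord0 ord0 = T i j.
  rewrite mul_delta_col mxE (bigD1 i) //= big1 => [|k ki]; last by rewrite !mxE (negPf ki) mul0r.
  by rewrite !mxE !eqxx mul1r addr0.
have sumE (T : 'M[C]_n) (x y : 'cV[C]_n) : ((x + y)^T *m T *m (x + y)) ord0 ord0 =
    (x^T *m T *m x) ord0 ord0 + (x^T *m T *m y) ord0 ord0 +
    ((y^T *m T *m x) ord0 ord0 + (y^T *m T *m y) ord0 ord0).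
  rewrite [(x + y)^T]linearD /= !mulmxDl !mulmxDr [LHS]mxE.
  by congr (_ + _); rewrite [LHS]mxE.
apply/matrixP => i j; have := h (delta_mx i ord0 + delta_mx j ord0).
have D (T : 'M[C]_n) : T^T = T ->
    ((delta_mx i ord0 + delta_mx j ord0 : 'cV[C]_n)^T *m T *m
      (delta_mx i ord0 + delta_mx j ord0 : 'cV[C]_n)) ord0 ord0 =
    T i i + T j j + 2 * T i j.
  move=> tT; rewrite sumE (E T i i) (E T i j) (E T j i) (E T j j).
  have -> : T j i = T i j by rewrite -{1}tT mxE.
  by ring.
have diag k : S k k = S' k k by rewrite -(E S k k) h (E S' k k).
rewrite (D S tS) (D S' tS') (diag i) (diag j) => /addrI /(mulfI _); apply.
by rewrite pnatr_eq0.
Qed.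

End Isometries.

Section Equivalence.
Variables (R : realType) (n N : nat).
Local Notation C := (Cplx R).
Implicit Types (f F Phi : 'cV[C]_n -> 'cV[C]_N) (V : 'I_N.+1 -> cpoly R n).

Lemma automorphism_inv m (psi : 'cV[C]_m -> 'cV[C]_m) : ball_automorphism psi ->
  exists phi, [/\ ball_automorphism phi, forall z, unit_ball z -> phi (psi z) = z &
    forall z, unit_ball z -> psi (phi z) = z].
Proof.
move=> [mp hp [phi [mq hq pK qK]]]; exists phi; split=> //.
by split=> //; exists psi.
Qed.

Lemma spherically_equivalent_sym f F : maps_ball f ->
  spherically_equivalent f F -> spherically_equivalent F f.
Proof.
move=> mf [psi [tau [ap at' E]]].
have [psi' [ap' pK' p'K]] := automorphism_inv ap; have [tau' [at'' tK' t'K]] := automorphism_inv at'.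
exists psi', tau'; split=> // z zb; have [mp _ _] := ap'.
by rewrite E ?p'K ?tK' //; [exact: mf|exact: mp].
Qed.

Lemma spherically_equivalent_trans f F Phi :
  spherically_equivalent f F -> spherically_equivalent F Phi -> spherically_equivalent f Phi.
Proof.
move=> [psi [tau [ap at' E]]] [psi' [tau' [ap' at'' E']]].
exists (psi \o psi'), (tau' \o tau); split; [exact: automorphism_comp|exact: automorphism_comp|].
by move=> z zb; have [mp _ _] := ap'; rewrite E' // E //; exact: mp.
Qed.

Lemma represents_equivalent d f F V : holomorphic_on_ball F -> represents d f V ->
  spherically_equivalent f F -> exists psi tau T M,
  [/\ ball_automorphism psi, ball_automorphism tau,
      forall z, unit_ball z -> F z = tau (f (psi z)) &
      [/\ pseudo_unitary T, pseudo_unitary M, forall z, unit_ball z -> psi z = act M z &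
          represents d F (tvec d T M V)]].
Proof.
move=> hF rV [psi [tau [ap at' E]]].
have [M pM hM] := automorphism_act ap; have [T pT hT] := automorphism_act at'.
exists psi, tau, T, M; split=> //; split=> //.
have [rW _] := represents_tvec pT pM rV.
have [mf hf _ _] := rV.
have EF z : unit_ball z -> act T (f (act M z)) = F z.
  by move=> zb; rewrite E // -hM // hT //; apply: mf; rewrite hM //; exact: act_ball.
exact: represents_ext rW.
Qed.

(** The conditions that locate the minimum of [Lambda]; the diagonal shape of the quadratic part
    enters with [quadratic_parts_unitary]. *)
Definition normalized (d : nat) f V :=
  [/\ represents d f V, f 0 = 0, peval (V ord0) 0 = 1 & homog_part 1 (V ord0) = 0].

(** One factor 1 - |z|^2 comes from Schwarz' lemma, the other d - 1 from [disc_poly_gt] on the line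
    through [z]; strictness comes from the latter. *)
Lemma normalized_strict_min d f V z : (0 < n)%N -> normalized d f V -> (1 < d)%N ->
  nsq z < 1 -> z != 0 -> (1 - nsq z) ^+ d < qf (pv V z).
Proof.
move=> n0 [rV f0 V0 h1] d1 z1 z0; apply: lt_le_trans (represents_schwarz rV f0 z1).
have nz : nsq z != 0 by apply: contraNneq z0 => /nsq_eq0 ->.
pose r := Num.sqrt (nsq z); have r2 : r ^+ 2 = nsq z by rewrite sqr_sqrtr ?nsq_ge0.
have r0 : 0 < r by rewrite sqrtr_gt0 lt_def nz nsq_ge0.
have r1 : r < 1 by rewrite -(@expr_lt1 _ 2) ?r2 // ltW.
pose v := (toC r)^-1 *: z.
have v1 : nsq v = 1 by rewrite nsqZ nrmV nrm_toC gtr0_norm // exprVn r2 mulVf.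
have zE : z = toC r *: v by rewrite scalerA divff ?scale1r // toC_eq0 gt_eqF.
have [_ sV] := represents_deg n0 rV f0.
have sd : d = d.-1.+1 by rewrite prednK // ltnW.
have := @disc_poly_gt R (on_line 0 v (V ord0)) d.-1 r.
rewrite (on_line0_coef v (V ord0) 1) h1 peval0 on_lineE add0r -zE r2 => key.
rewrite [X in _ ^+ X]sd exprSr ltr_pM2r ?subr_gt0 //; apply: key => //.
- by rewrite -ltnS -sd.
- by rewrite -horner_coef0 on_lineE scale0r addr0.
- by rewrite -sd; exact: leq_trans (size_on_line _ _ _) sV.
- move=> t t1; rewrite on_lineE add0r; apply: (represents_neq0 rV).
  by rewrite nsqZ v1 mulr1 expr_le1 ?nrm_ge0.
Qed.

Lemma normalized_equivalent d d' F Phi V V' : (0 < n)%N ->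
  normalized d F V -> normalized d' Phi V' -> spherically_equivalent F Phi ->
  d = d' /\ ((1 < d)%N -> exists U W, [/\ U \is unitarymx, W \is unitarymx,
    forall z, unit_ball z -> Phi z = U *m F (W *m z) &
    forall z, unit_ball z -> peval (V' ord0) z = peval (V ord0) (W *m z)]).
Proof.
move=> n0 nV nV' eqFP; have [rV F0 V0 _] := nV; have [rV' P0 V'0 _] := nV'.
have [_ hP frV' [lV' _ dV']] := rV'; have [_ _ _ [_ _ dV]] := rV; have [sV _] := dV.
have [psi [tau [T [M [ap at' E [pT pM hM rW]]]]]] := represents_equivalent hP rV eqFP.
have [rV'' [c c0 Ec]] := represents_unique rW lV' frV'.
have dd : d = d'.
  have V'00 : V' ord0 != 0 by case: lV'.
  have [_ _ _ [_ _ /(vdegP _ V'00) <-]] := rV''.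
  by move/(vdegP _ V'00): dV'.
split=> // d1; subst d'.
(* Write Lambda and Lambda' for the functions of [V] and [V'], so that Lambda' = |c|^2 Lambda o psi;
   both have minimum 1, attained only at 0. If psi(0) were not 0, then 1 = Lambda'(0) = |c|^2
   Lambda(psi(0)) > |c|^2. *)
have psi0 : psi 0 = 0.
  rewrite hM; last exact: unit_ball0.
  apply: contrapT => /eqP a0.
  have n00 : nsq (0 : 'cV[C]_n) < 1 by rewrite nsq0 ltr01.
  have qfE' z : nsq z < 1 ->
      qf (pv V' z) = nrm c ^+ 2 * ((nrm (den M z) ^+ 2) ^+ d * qf (pv V (act M z))).
    move=> z1; have -> : pv V' z = c *: pv (tvec d T M V) z.
      by apply/colP => i; rewrite !mxE Ec pevalZ.
    by rewrite qfZ pv_tvec ?(den_neq0 pM (ltW z1)) // qfZ pT.2 nrmX exprAC.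
  have n2 w : nsq w < 1 -> (1 - nsq w) ^+ d = (nrm (den M w) ^+ 2) ^+ d * (1 - nsq (act M w)) ^+ d.
    by move=> /ltW w1; rewrite (nsq_act pM w1) exprMn.
  have dp w : nsq w < 1 -> 0 < (nrm (den M w) ^+ 2) ^+ d.
    by move=> w1; rewrite !exprn_gt0 // nrm_gt0 (den_neq0 pM (ltW w1)).
  have a1 : nsq (act M 0) < 1 by apply/unit_ballE/act_ball => //; exact: unit_ball0.
  have pM' := pseudo_unitary_inv pM.
  pose b := act (invmx M) 0.
  have b1 : nsq b < 1 by apply/unit_ballE/act_ball => //; exact: unit_ball0.
  have Mb : act M b = 0 by rewrite /b actVK //; exact: unit_ball0.
  have min0 : qf (pv V 0) = 1 by rewrite (qf_pv_fix0 rV F0) V0 nrm1 expr1n.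
  have min0' : qf (pv V' 0) = 1 by rewrite (qf_pv_fix0 rV' P0) V'0 nrm1 expr1n.
  (* At [b], which [psi] sends to 0, Lambda'(b) = |c|^2 Lambda(0) = |c|^2, and Lambda' is at least
     1. *)
  have cle : 1 <= nrm c ^+ 2.
    have := qfE' b b1; rewrite Mb min0 mulr1 => Eb.
    have := n2 b b1; rewrite Mb nsq0 subr0 expr1n mulr1 => Db.
    have : (1 - nsq b) ^+ d <= qf (pv V' b).
      have [->|b0] := eqVneq b 0; first by rewrite nsq0 subr0 expr1n min0'.
      exact/ltW/(normalized_strict_min n0 nV').
    by rewrite Eb Db mulrC -{1}[leLHS]mulr1 ler_pM2l ?(dp b b1).
  have := normalized_strict_min n0 nV d1 a1 a0.
  have := n2 0 n00; rewrite nsq0 subr0 expr1n => Da.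
  rewrite -(ltr_pM2l (dp 0 n00)) -Da => lt1.
  have := qfE' 0 n00; rewrite min0' => Ea.
  have : 1 < nrm c ^+ 2 * ((nrm (den M 0) ^+ 2) ^+ d * qf (pv V (act M 0))).
    apply: (lt_le_trans lt1); rewrite ler_peMl //.
    by apply: ltW; apply: (lt_trans _ lt1); exact: ltr01.
  by rewrite -Ea ltxx.
have tau0 : tau 0 = 0 by rewrite -{1}F0 -psi0 -E ?P0 //; exact: unit_ball0.
have [W uW hW] := automorphism_fix0 ap psi0; have [U uU hU] := automorphism_fix0 at' tau0.
have [mF _ _ _] := rV; have [mp _ _] := ap.
have EP z : unit_ball z -> Phi z = U *m F (W *m z).
  by move=> zb; rewrite E // hU ?hW //; apply: mF; rewrite -hW //; exact: mp.
exists U, W; split=> // z zb.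
(* With matrices built from [W] and [U] all the denominators [den] are 1, so the two polynomials
   differ by a constant, which the origin shows to be 1. *)
have [MW [pMW hMW]] := unitary_pseudo_unitary uW.
have [TU [pTU hTU]] := unitary_pseudo_unitary uU.
have [rW2 pvW2] := represents_tvec pTU pMW rV.
have {}rW2 : represents d Phi (tvec d TU MW V).
  apply: represents_ext rW2 => // w wb.
  by rewrite (hTU _).2 (hMW w).2 EP.
have [_ [c' c'0 Ec']] := represents_unique rW2 lV' frV'.
have V'E w : nsq w < 1 -> peval (V' ord0) w = c' * peval (V ord0) (W *m w).
  move=> w1; rewrite Ec' pevalZ; congr (_ * _).
  have /colP/(_ ord0) := pvW2 w w1; rewrite mxE [in RHS]mxE homv0 mulr1 => ->.
  by rewrite (hTU _).1 (hMW w).1 (hMW w).2 expr1n mul1r mulr1.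
rewrite V'E; last exact/unit_ballE.
suff -> : c' = 1 by rewrite mul1r.
have := V'E 0; rewrite nsq0 ltr01 mulmx0 V'0 V0 mulr1 => -> //.
Qed.

(** Denominators that agree on the ball agree on lines through 0, hence so do their quadratic parts;
    [symmetric_form_eq] passes from forms to matrices. *)
Lemma quadratic_parts_unitary V V' (W : 'M[C]_n) (s s' : 'I_n -> R) : W \is unitarymx ->
  (forall z, unit_ball z -> peval (V' ord0) z = peval (V ord0) (W *m z)) ->
  (forall v, peval (homog_part 2 (V ord0)) v = \sum_k toC (s k) * v k ord0 ^+ 2) ->
  (forall v, peval (homog_part 2 (V' ord0)) v = \sum_k toC (s' k) * v k ord0 ^+ 2) ->
  W^T *m diag_mx (\row_i toC (s i)) *m W = diag_mx (\row_i toC (s' i)).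
Proof.
move=> uW E h h'.
have diagE (r : 'I_n -> R) (v : 'cV[C]_n) : (v^T *m diag_mx (\row_i toC (r i)) *m v) ord0 ord0 =
    \sum_k toC (r k) * v k ord0 ^+ 2.
  by rewrite mul_mx_diag mxE; apply: eq_bigr => k _; rewrite !mxE; ring.
apply: symmetric_form_eq; [|exact: tr_diag_mx|].
  by rewrite !trmx_mul trmxK tr_diag_mx mulmxA.
move=> z /unit_ballE z1; rewrite diagE -h' -on_line0_coef.
have -> : on_line 0 z (V' ord0) = on_line 0 (W *m z) (V ord0).
  apply/subr0_eq/(@poly_eq0_near0 R _ 1) => // t t0 t1.
  rewrite hornerD hornerN !on_lineE !add0r E ?scalemxAr ?subrr //.
  apply/unit_ballE; rewrite nsqZ nrm_toC gtr0_norm //.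
  by apply: le_lt_trans z1; rewrite ler_piMl ?nsq_ge0 // expr_le1 ?ltW.
by rewrite on_line0_coef h -diagE trmx_mul !mulmxA.
Qed.

Lemma homog1_linear (p : cpoly R n) :
  exists a : 'I_n -> C, forall v, peval (homog_part 1 p) v = \sum_k a k * v k ord0.
Proof.
pose Q (q : cpoly R n) := exists a : 'I_n -> C, forall v, peval q v = \sum_k a k * v k ord0.
suff : Q (homog_part 1 p) by [].
rewrite /homog_part pihomogE; apply: (big_ind Q).
- by exists (fun=> 0) => v; rewrite peval0 big1 // => k _; rewrite mul0r.
- move=> q q' [a ha] [b hb]; exists (fun k => a k + b k) => v.
  by rewrite pevalD ha hb -big_split; apply: eq_bigr => k _; rewrite mulrDl.
move=> m; rewrite mdeg_eq1 => /existsP[i /eqP ->]; set c := mcoeff _ _.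
exists (fun k => if k == i then c else 0) => v.
rewrite pevalZ pevalX (bigD1 i) //= eqxx big1 ?addr0 // => k /negPf ->.
by rewrite mul0r.
Qed.

(** By [represents_deg] the denominator is constant and the numerators are linear; the condition on
    the sphere then says that they form an isometry. *)
Lemma normalized_deg1 f V : (0 < n)%N -> normalized 1 f V ->
  exists A : 'M[C]_(N, n), (forall v, nsq (A *m v) = nsq v) /\
    forall z, unit_ball z -> f z = A *m z.
Proof.
move=> n0 [rV f0 V0 _]; have [_ sV0] := represents_deg n0 rV f0.
have [_ _ fr [_ bV [sV _]]] := rV.
have V0E z : peval (V ord0) z = 1.
  by move: V0; rewrite (msize1_polyC sV0) !pevalC.
have [a ha] := choice (fun i => homog1_linear (V (lift ord0 i))).
pose A : 'M[C]_(N, n) := \matrix_(i, j) a i j.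
have VE i z : peval (V (lift ord0 i)) z = (A *m z) i ord0.
  have -> : peval (V (lift ord0 i)) z = (on_line 0 z (V (lift ord0 i))).[1].
    by rewrite on_lineE add0r scale1r.
  rewrite (@horner_coef_wide _ 2); last exact: leq_trans (size_on_line _ _ _) (sV _).
  rewrite big_ord_recl big_ord1 !expr1n !mulr1 -horner_coef0 on_lineE scale0r addr0.
  rewrite (represents_lift0 _ rV f0) add0r on_line0_coef ha mxE.
  by apply: eq_bigr => k _; rewrite mxE.
exists A; split=> [v|z zb]; last first.
  by have [_ ->] := fr z zb; apply/colP => i; rewrite mxE V0E divr1 VE.
have [v0|v0] := eqVneq (nsq v) 0; first by rewrite (nsq_eq0 v0) mulmx0 !nsq0.
pose r := Num.sqrt (nsq v); have r2 : r ^+ 2 = nsq v by rewrite sqr_sqrtr ?nsq_ge0.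
have r0 : r != 0 by rewrite -sqrf_eq0 r2.
have -> : v = toC r *: ((toC r)^-1 *: v) by rewrite scalerA divff ?scale1r ?toC_eq0.
set w := _^-1 *: v.
have w1 : nsq w = 1 by rewrite nsqZ nrmV nrm_toC exprVn real_normK ?num_real // r2 mulVf.
rewrite -scalemxAr [LHS]nsqZ [RHS]nsqZ w1; congr (_ * _).
have := bV.2 w w1; rewrite /qf mxE V0E nrm1 expr1n => /subr0_eq e; apply: etrans (esym e).
by apply: eq_bigr => i _; rewrite [in RHS]mxE [in RHS]mxE VE.
Qed.

End Equivalence.

Section NormalForms.
Variables (R : realType) (n N : nat).
Hypothesis n_gt0 : (0 < n)%N.
Local Notation C := (Cplx R).
Implicit Types (f F Phi : 'cV[C]_n -> 'cV[C]_N).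

Lemma homog2_diag (G : cpoly R n) (s : 'I_n -> R) v :
  homog_part 2 G = \sum_(k < n) toC (s k) *: mpolyX C (mnm1 k) ^+ 2 ->
  peval (homog_part 2 G) v = \sum_k toC (s k) * v k ord0 ^+ 2.
Proof.
by move=> ->; rewrite peval_sum; apply: eq_bigr => k _; rewrite pevalZ pevalXn pevalX.
Qed.

Lemma normal_fraction_normalized d F (P : 'I_N -> cpoly R n) (G : cpoly R n) sigma W :
  represents d F W -> is_fraction F P G -> normal_fraction d sigma P G ->
  normalized d F (vecp P G).
Proof.
move=> rW fr [lo P0 sG [h0 h1] _].
have [] := represents_unique (V' := vecp P G) rW.
- by apply/vlowestP; rewrite vecp_lift vecp0.
- by rewrite vecp_lift vecp0.
move=> rV _; split; rewrite ?vecp0 //.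
  have [_ ->] := fr 0 (unit_ball0 R n); apply/colP => i.
  by rewrite !mxE P0 mul0r.
by have := on_line0_coef 0 G 0; rewrite h0 peval1 -horner_coef0 on_lineE scale0r addr0.
Qed.

Lemma normal_sigma_unique d d' F Phi P G P' G' (s s' : 'I_n -> R) :
  normalized d F (vecp P G) -> normalized d' Phi (vecp P' G') ->
  spherically_equivalent F Phi -> admissible d s -> admissible d' s' ->
  normal_fraction d s P G -> normal_fraction d' s' P' G' ->
  [/\ d = d', s =1 s' &
    (1 < d)%N -> exists U W, [/\ U \is unitarymx, W \is unitarymx,
      forall z, unit_ball z -> Phi z = U *m F (W *m z) &
      forall z, peval (homog_part 2 G) (W *m z) = peval (homog_part 2 G) z]].
Proof.
move=> nV nV' eqF [s0 sS sb] [s'0 s'S s'b] [_ _ _ _ h2] [_ _ _ _ h2'].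
have [dd h] := normalized_equivalent n_gt0 nV nV' eqF; subst d'.
have [rV F0 _ _] := nV; have [d0 _] := represents_deg n_gt0 rV F0.
have hG v := homog2_diag v h2; have hG' v := homog2_diag v h2'.
(* For d = 1 the bound (d - 1) / 2 forces every sigma to be 0. *)
have [d1|d1] := ltnP 1 d; last first.
  have dE : d = 1%N by move: d0 d1; lia.
  have z0 (r : 'I_n -> R) : (forall k, 0 <= r k) -> (forall k, r k <= (d%:R - 1) / 2) ->
      forall k, r k = 0.
    move=> r0 rb k; apply: le_anti; rewrite r0 andbT; apply: le_trans (rb k) _.
    by rewrite dE subrr mul0r.
  by split=> // k; rewrite (z0 s) // (z0 s').
have [U [W [uU uW EP EG]]] := h d1.
have key := @quadratic_parts_unitary R n N (vecp P G) (vecp P' G') W s s' uW EG.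
rewrite !vecp0 in key; have {}key := key hG hG'.
have ss : s =1 s' by exact: takagi_unique uW s0 s'0 sS s'S key.
split=> // _; exists U, W; split=> // z.
have diagE (r : 'I_n -> R) (v : 'cV[C]_n) : (v^T *m diag_mx (\row_i toC (r i)) *m v) ord0 ord0 =
    \sum_k toC (r k) * v k ord0 ^+ 2.
  by rewrite mul_mx_diag mxE; apply: eq_bigr => k _; rewrite !mxE; ring.
rewrite !hG -!diagE trmx_mul !mulmxA -[z^T *m _ *m _]mulmxA -[z^T *m _ *m W]mulmxA key.
have -> : \row_i toC (s i) = \row_i toC (s' i) by apply/rowP => k; rewrite !mxE ss.
by [].
Qed.

End NormalForms.

Theorem theorem1p1 (R : realType) (n N : nat) (n_gt0 : (0 < n)%N)
    (N_gt0 : (0 < N)%N) :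
  (forall (d : nat) (f : 'cV[Cplx R]_n -> 'cV[Cplx R]_N),
     rational_proper_map d f ->
     exists sigma : 'I_n -> R, has_normal_form d f sigma) /\
  (forall (d d' : nat) (f f' : 'cV[Cplx R]_n -> 'cV[Cplx R]_N)
          (sigma sigma' : 'I_n -> R),
     rational_proper_map d f -> rational_proper_map d' f' ->
     spherically_equivalent f f' ->
     has_normal_form d f sigma -> has_normal_form d' f' sigma' ->
     forall k, sigma k = sigma' k) /\
  (forall (d : nat) (F Phi : 'cV[Cplx R]_n -> 'cV[Cplx R]_N)
          (P Pi : 'I_N -> cpoly R n) (G Gamma : cpoly R n)
          (sigma sigma' : 'I_n -> R),
     rational_proper_map d F -> rational_proper_map d Phi ->
     spherically_equivalent F Phi ->
     is_fraction F P G -> is_fraction Phi Pi Gamma ->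
     admissible d sigma -> admissible d sigma' ->
     normal_fraction d sigma P G -> normal_fraction d sigma' Pi Gamma ->
     (forall k, sigma k = sigma' k) /\
     exists (U : 'M[Cplx R]_N) (V : 'M[Cplx R]_n),
       [/\ U \is unitarymx, V \is unitarymx,
           forall z, unit_ball z -> Phi z = U *m F (V *m z) &
           forall z : 'cV[Cplx R]_n,
             peval (homog_part 2 G) (V *m z) = peval (homog_part 2 G) z]).
Proof.
split; first by move=> d f; exact: normal_form_exists.
split.
- move=> d d' f f' s s' rf rf' eqf [as_ [psi [tau [P [G [ap at_ fr nf]]]]]].
  move=> [as' [psi' [tau' [P' [G' [ap' at' fr' nf']]]]]].
  have [V rV] := rational_represents rf; have [V' rV'] := rational_represents rf'.
  have holo e g p t U : represents e g U -> ball_automorphism p -> ball_automorphism t ->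
      holomorphic_on_ball (fun z : 'cV[Cplx R]_n => t (g (p z)) : 'cV[Cplx R]_N).
    move=> [mg hg _ _] [mp hp _] [_ ht _] z zb.
    apply: (@differentiable_comp _ _ _ _ (fun z => g (p z)) t); last exact/ht/mg/mp.
    by apply: (@differentiable_comp _ _ _ _ p g); [exact: hp|exact/hg/mp].
  have eq1 : spherically_equivalent f (fun z => tau (f (psi z))) by exists psi, tau.
  have eq2 : spherically_equivalent f' (fun z => tau' (f' (psi' z))) by exists psi', tau'.
  have [_ [_ [T [M [_ _ _ [_ _ _ rW]]]]]] := represents_equivalent (holo _ _ _ _ _ rV ap at_) rV eq1.
  have [_ [_ [T' [M' [_ _ _ [_ _ _ rW']]]]]] := represents_equivalent (holo _ _ _ _ _ rV' ap' at') rV' eq2.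
  have nV := normal_fraction_normalized rW fr nf.
  have nV' := normal_fraction_normalized rW' fr' nf'.
  have mf : maps_ball f by case: rV.
  have eqF := spherically_equivalent_trans (spherically_equivalent_trans
    (spherically_equivalent_sym mf eq1) eqf) eq2.
  by have [] := normal_sigma_unique n_gt0 nV nV' eqF as_ as' nf nf'.
move=> d F Phi P P' G G' s s' rF rP eqF fr fr' as_ as' nf nf'.
have [V rV] := rational_represents rF; have [V' rV'] := rational_represents rP.
have nV := normal_fraction_normalized rV fr nf.
have nV' := normal_fraction_normalized rV' fr' nf'.
have [_ ss h] := normal_sigma_unique n_gt0 nV nV' eqF as_ as' nf nf'; split=> //.
(* In degree 1 an equivalence may move the origin, so the given automorphisms are set aside: [V] is
   the identity and [U] takes one isometry to the other. *)
have [d1|d1] := ltnP 1 d; first exact: h.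
have [rW F0 _ _] := nV; have [d0 _] := represents_deg n_gt0 rW F0.
have dE : d = 1%N by move: d0 d1; lia.
subst d.
have [A [iA FA]] := normalized_deg1 n_gt0 nV.
have [B [iB PB]] := normalized_deg1 n_gt0 nV'.
have [U uU UA] := isometry_extend iA iB.
exists U, 1%:M; split=> // [|z zb|z].
- by apply/unitarymxP; rewrite trmx1 map_mx1 mulmx1.
- by rewrite mul1mx PB // FA // mulmxA UA.
- by rewrite mul1mx.
Qed.
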